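(* Let $E$ be a symmetric Banach space on $(0,1)$. Suppose that at least one of the following two conditions holds for every finite von Neumann algebra $\mathcal M$ (with faithful normal trace $\tau$, $\tau(1)=1$) and every sequence $(x_k)_{k\geq 0}\subset E(\mathcal{M})$ of martingale differences, with constants depending only on $E$: (a) $$\Big\|\sum_{k\geq 0}x_k\Big\|_{E(\mathcal{M})}\approx_E\inf_{x_k=y_k+z_k}\Big(\Big\|\Big(\sum_{k\geq 0}|y_k|^2\Big)^{1/2}\Big\|_{E(\mathcal{M})}+\Big\|\Big(\sum_{k\geq 0}|z_k^*|^2\Big)^{1/2}\Big\|_{E(\mathcal{M})}\Big),$$ the infimum being taken over sequences $(y_k)$ and $(z_k)$ of martingale differences with $x_k=y_k+z_k$ for all $k$; (b) $$\Big\|\sum_{k\geq 0}x_k\Big\|_{E(\mathcal{M})}\approx_E\max\Big\{\Big\|\Big(\sum_{k\geq 0}|x_k|^2\Big)^{1/2}\Big\|_{E(\mathcal{M})},\Big\|\Big(\sum_{k\geq 0}|x_k^*|^2\Big)^{1/2}\Big\|_{E(\mathcal{M})}\Big\}.$$ (That is, either (a) holds for all such $\mathcal M$ and $(x_k)$, or (b) holds for all such $\mathcal M$ and $(x_k)$.) Then $E\in Int(L_p(0,1),L_q(0,1))$ for some $1<p<q<\infty$.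
   Context: $A\approx_E B$ means $A\le C_EB$ and $B\le C_E'A$ with constants depending only on $E$. $|x|=(x^*x)^{1/2}$. $L_0(\mathcal M)$ is the space of $\tau$-measurable operators and $\mu(t,x)=\inf\{s>0:\tau(e_{(s,\infty)}(|x|))\le t\}$, $t>0$; for functions, $\mu(f)$ is the decreasing rearrangement of $|f|$. A Banach function space $E$ on $(0,1)$ is symmetric if $g\in E$, $f$ measurable and $\mu(f)\le\mu(g)$ imply $f\in E$ and $\|f\|_E\le\|g\|_E$. $E(\mathcal M)=\{x\in L_0(\mathcal M):\mu(x)\in E\}$ with $\|x\|_{E(\mathcal M)}=\|\mu(x)\|_E$. For symmetric spaces with $F_1\cap F_2\subset E\subset F_1+F_2$, $E\in Int(F_1,F_2)$ means that every linear $T:F_1+F_2\to F_1+F_2$ which is bounded $F_1\to F_1$ and $F_2\to F_2$ is also bounded $E\to E$. Martingale differences: $(\mathcal M_k)_{k\ge0}$ is an increasing sequence of von Neumann subalgebras of $\mathcal M$ with weak$^*$-dense union (arbitrary), $\mathcal E_k$ is the trace preserving conditional expectation onto $\mathcal M_k$ (extended to $L_1(\mathcal M)$). A sequence $(x_k)_{k\ge0}$ in $L_1(\mathcal M)$ is a sequence of martingale differences if $x_k\in L_1(\mathcal M_k)$ for $k\ge0$ and $\mathcal E_{k-1}(x_k)=0$ for $k\ge1$. Sums: $\sum_k x_k$ is understood as a series converging in $L_1(\mathcal M)$ (finite sequences included); sums of positive operators are increasing limits in $L_0(\mathcal M)$ (measure topology); norms are $+\infty$ if the limit does not exist or is outside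 the space. *)

(* Defs.v *)
From HB Require Import structures.
From mathcomp Require Import all_boot all_order all_algebra.
From mathcomp Require Import all_classical all_reals all_analysis.
From mathcomp Require Import complex sesquilinear.

Set Implicit Arguments.
Unset Strict Implicit.
Unset Printing Implicit Defensive.

Import Order.TTheory GRing.Theory Num.Theory.
Import numFieldNormedType.Exports.

Local Open Scope classical_set_scope.
Local Open Scope complex_scope.
Local Open Scope ring_scope.

(* A function on (0,1) is a function R -> R whose values outside (0,1) are
   ignored; functions equal almost everywhere on (0,1) are identified through
   [ae01] rather than by a quotient.  Scalars are real. *)

Definition I01 (R : realType) : set R := `]0%R, 1%R[.
Arguments I01 {R}.

Definition ae01 (R : realType) (f g : R -> R) : Prop :=
  {ae (@lebesgue_measure R), forall u, I01 u -> f u = g u}.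

Definition rearrangement (R : realType) (f : R -> R) (t : R) : R :=
  inf [set s : R | 0 < s /\
    (lebesgue_measure (I01 `&` [set u | (s < `|f u|)%R]) <= t%:E)%E].

Record fspace (R : realType) := FSpace {
  fcarrier :> (R -> R) -> Prop;
  fnorm : (R -> R) -> R  (* meaningful on [fcarrier] only *)
}.

(* The zero space is excluded, by [sym_nontriv]. *)
Record symmetric_space (R : realType) (E : fspace R) : Prop := SymmetricSpace {
  sym_meas : forall f, E f -> measurable_fun I01 f;
  sym_add : forall f g, E f -> E g -> E (fun u => f u + g u);
  sym_scale : forall a f, E f -> E (fun u => a * f u);
  sym_normD : forall f g, E f -> E g ->
    fnorm E (fun u => f u + g u) <= fnorm E f + fnorm E g;
  sym_normZ : forall a f, E f -> fnorm E (fun u => a * f u) = `|a| * fnorm E f;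
  sym_norm_eq0 : forall f, E f -> fnorm E f = 0 -> ae01 f (fun=> 0);
  sym_complete : forall f : nat -> R -> R, (forall n, E (f n)) ->
    (forall e, 0 < e -> exists N, forall m n, (N <= m)%N -> (N <= n)%N ->
       fnorm E (fun u => f m u - f n u) < e) ->
    exists2 g, E g & fnorm E (fun u => f n u - g u) @[n --> \oo] --> 0;
  sym_rearr : forall f g, E g -> measurable_fun I01 f ->
    (forall t, 0 < t -> rearrangement f t <= rearrangement g t) ->
    E f /\ fnorm E f <= fnorm E g;
  sym_nontriv : exists2 f, E f & ~ ae01 f (fun=> 0)
}.

Definition Lp01 (R : realType) (p : R) : fspace R :=
  let N f := 'N[lebesgue_measure]_(p%:E)[EFin \o (f \_ I01)]%E in
  FSpace [set f | measurable_fun I01 f /\ (N f < +oo)%E] (fun f => fine (N f)).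

Definition fsum (R : realType) (F1 F2 : fspace R) : set (R -> R) :=
  [set f | exists f1 f2, [/\ F1 f1, F2 f2 & f = (fun u => f1 u + f2 u)]].

Definition linear_on01 (R : realType) (D : set (R -> R))
    (T : (R -> R) -> R -> R) : Prop :=
  [/\ forall f, D f -> D (T f),
      forall f g, D f -> D g -> ae01 f g -> ae01 (T f) (T g) &
      forall a f g, D f -> D g ->
        ae01 (T (fun u => a * f u + g u)) (fun u => a * T f u + T g u)].

Definition bounded_on (R : realType) (E : fspace R)
    (T : (R -> R) -> R -> R) : Prop :=
  exists C, forall f, E f -> E (T f) /\ fnorm E (T f) <= C * fnorm E f.

Definition interpolation (R : realType) (E F1 F2 : fspace R) : Prop :=
  [/\ fcarrier F1 `&` fcarrier F2 `<=` fcarrier E, fcarrier E `<=` fsum F1 F2 &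
      forall T, linear_on01 (fsum F1 F2) T ->
        bounded_on F1 T -> bounded_on F2 T -> bounded_on E T].

(* [dot] is linear in its first argument. *)
Record hilbert (R : realType) := Hilbert {
  hsort :> completeNormedModType R[i];
  dot : {dot hsort for Num.conj};
  hnormE : forall h : hsort, `|h| ^+ 2 = dot h h
}.

(* A possibly unbounded operator is represented by its graph. *)
Definition op (R : realType) (H : hilbert R) := set (H * H).

Section Operators.
Context (R : realType) (H : hilbert R).
Implicit Types (x y a : op H) (S T U : H -> H) (A : set (H -> H)).

Definition bounded_op T : Prop := linear T /\ continuous T.

Definition is_adjoint T S : Prop :=
  forall h g, dot H (T h) g = dot H h (S g).

Definition positive_op T : Prop := forall h, 0 <= dot H (T h) h.

Definition op_le S T : Prop := forall h, dot H (S h) h <= dot H (T h) h.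

Definition projection_op T : Prop :=
  [/\ bounded_op T, is_adjoint T T & forall h, T (T h) = T h].

Definition unitary_op T : Prop :=
  [/\ bounded_op T, forall h g, dot H (T h) (T g) = dot H h g &
      forall g, exists h, T h = g].

Definition commutant A : set (H -> H) :=
  [set T | bounded_op T /\ forall S, A S -> T \o S = S \o T].

Record von_neumann_algebra A : Prop := VonNeumannAlgebra {
  vna_bounded : forall T, A T -> bounded_op T;
  vna_adjoint : forall T, A T -> exists2 S, A S & is_adjoint T S;
  vna_bicommutant : commutant (commutant A) = A
}.

(* The weak-star topology on bounded operators is generated by the functionals
   T |-> \sum_j <T (h j), g j> with h and g square-summable. *)
Definition square_summable (h : nat -> H) : Prop :=
  exists c : R[i], forall n, \sum_(j < n) `|h j| ^+ 2 <= c.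

Definition weakstar_dense (B A : set (H -> H)) : Prop :=
  forall T, A T -> forall (m : nat) (h g : 'I_m -> nat -> H),
    (forall i, square_summable (h i) /\ square_summable (g i)) ->
    forall e : R[i], 0 < e -> exists2 S, B S &
      forall i, \forall n \near \oo,
        `|\sum_(j < n) dot H (T (h i j) - S (h i j)) (g i j)| < e.

Definition graph_op T : op H := [set hg | hg.2 = T hg.1].

Definition op0 : op H := graph_op (fun=> 0).

Definition densely_closed x : Prop :=
  [/\ x (0, 0) /\ (forall (c : R[i]) h g h' g', x (h, g) -> x (h', g') ->
                     x (c *: h + h', c *: g + g')),
      forall h g g', x (h, g) -> x (h, g') -> g = g',
      closure [set h | exists g, x (h, g)] = setT &
      closed x].

Definition adj x : op H :=
  [set hg | forall u v, x (u, v) -> dot H v hg.1 = dot H u hg.2].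

Definition op_comp x y : op H :=
  [set hg | exists2 k, y (hg.1, k) & x (k, hg.2)].

(* The sum of operators in L_0 is the strong sum, that is, the closure of
   the algebraic sum. *)
Definition op_add x y : op H :=
  closure [set hg | exists g1 g2,
    [/\ x (hg.1, g1), y (hg.1, g2) & hg.2 = g1 + g2]].

Definition op_opp x : op H := [set hg | x (hg.1, - hg.2)].

Definition op_psum (x : nat -> op H) (n : nat) : op H :=
  \big[op_add/op0]_(k < n) x k.

Definition positive_selfadjoint a : Prop :=
  [/\ densely_closed a, adj a = a & forall h g, a (h, g) -> 0 <= dot H g h].

Definition is_sqrt y a : Prop := positive_selfadjoint a /\ op_comp a a = y.

Definition abs_sq x : op H := op_comp (adj x) x.

Definition is_abs x a : Prop := is_sqrt (abs_sq x) a.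

(* [P] is the spectral resolution of the self-adjoint operator [a], and
   [nu h] is the scalar measure B |-> <P B h, h>.  By polarization, the domain
   of [a] and its quadratic form determine [a]. *)
Definition spectral_measure a (P : set R -> H -> H) : Prop :=
  [/\ forall B, measurable B -> projection_op (P B),
      P setT = id &
      exists nu : H -> {measure set R -> \bar R},
      [/\ forall h B, measurable B -> nu h B = (complex.Re (dot H (P B h) h))%:E,
          forall h, (exists g, a (h, g)) <->
                    (\int[nu h]_s (s ^+ 2)%:E < +oo)%E &
          forall h g, a (h, g) -> dot H g h = (\int[nu h]_s s)%R%:C]].

Definition affiliated A x : Prop :=
  densely_closed x /\
  forall U, commutant A U -> unitary_op U ->
    forall h g, x (h, g) -> x (U h, U g).

End Operators.

(* Only the values of [tr] on [alg] matter. *)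
Record finite_vna (R : realType) := FiniteVNA {
  space :> hilbert R;
  alg : set (space -> space);
  tr : (space -> space) -> R[i];
  alg_vna : von_neumann_algebra alg;
  tr_linear : forall (c : R[i]) S T, alg S -> alg T ->
    tr (fun h => c *: S h + T h) = c * tr S + tr T;
  tr_cyclic : forall S T, alg S -> alg T -> tr (S \o T) = tr (T \o S);
  tr_pos : forall T, alg T -> positive_op T -> 0 <= tr T;
  tr_faithful : forall T, alg T -> positive_op T -> tr T = 0 -> T = (fun=> 0);
  tr_normal : forall (D : set (space -> space)) T,
    D !=set0 -> (forall S, D S -> alg S /\ positive_op S) ->
    (forall S S', D S -> D S' -> exists V, [/\ D V, op_le S V & op_le S' V]) ->
    alg T -> (forall S, D S -> op_le S T) ->
    (forall V, alg V -> (forall S, D S -> op_le S V) -> op_le T V) ->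
    complex.Re (tr T) = sup [set complex.Re (tr S) | S in D];
  tr_unit : tr id = 1
}.
Arguments alg {R} f _.
Arguments tr {R} f _.

Section NoncommutativeSpaces.
Context (R : realType) (M : finite_vna R).
Implicit Types (x y z w : op M) (E : fspace R) (A : set (M -> M)).

(* The trace being finite, every operator affiliated with the algebra is
   tau-measurable. *)
Definition L0 : set (op M) := [set x | affiliated (alg M) x].

Definition mu x (t : R) : R :=
  inf [set s : R | 0 < s /\ exists a P, [/\ is_abs x a, spectral_measure a P &
                          complex.Re (tr M (P [set` `]s, +oo[])) <= t]].

Definition in_space E x : Prop := L0 x /\ E (mu x).

Definition enorm E x : \bar R :=
  if `[< in_space E x >] then (fnorm E (mu x))%:E else +oo%E.

Definition L1_cvg (x : nat -> op M) y : Prop :=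
  enorm (Lp01 1) (op_add (x n) (op_opp y)) @[n --> \oo] --> 0%E.

(* Basic neighbourhoods of 0 in the measure topology: those x with
   ||x p|| <= e and tau(1 - p) <= d for some projection p of the algebra. *)
Definition measure_nbhs (e d : R) : set (op M) :=
  [set x | exists p, [/\ alg M p, projection_op p,
      complex.Re (tr M (fun h => h - p h)) <= d &
      forall h, exists2 g, x (p h, g) & `|g| <= e%:C * `|h|]].

Definition measure_cvg (x : nat -> op M) y : Prop :=
  forall e d : R, 0 < e -> 0 < d -> \forall n \near \oo,
    measure_nbhs e d (op_add (x n) (op_opp y)).

(* In the next two definitions the infimum is over at most one value; an empty
   infimum is +oo, the value prescribed for a norm when no limit exists. *)
Definition sum_norm E (x : nat -> op M) : \bar R :=
  ereal_inf [set enorm E s | s in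
    [set s | in_space (Lp01 1) s /\ L1_cvg (op_psum x) s]].

Definition square_norm E (x : nat -> op M) : \bar R :=
  ereal_inf [set enorm E r | r in
    [set r | exists s, [/\ L0 s,
       measure_cvg (op_psum (fun k => abs_sq (x k))) s & is_sqrt s r]]].

Record cond_expectation A (X : (M -> M) -> (M -> M)) : Prop :=
  CondExpectation {
    ce_into : forall T, alg M T -> A (X T);
    ce_linear : forall (c : R[i]) S T, alg M S -> alg M T ->
      X (fun h => c *: S h + T h) = (fun h => c *: X S h + X T h);
    ce_id : forall T, A T -> X T = T;
    ce_pos : forall T, alg M T -> positive_op T -> positive_op (X T);
    ce_bimod : forall S T V, A S -> alg M T -> A V ->
      X (S \o T \o V) = S \o X T \o V;
    ce_trace : forall T, alg M T -> tr M (X T) = tr M T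
  }.

(* The conditional expectation is extended from the algebra to L_1 by
   continuity; [w] is its value at [x]. *)
Definition L1_cond_expectation A x w : Prop :=
  exists X (T : nat -> M -> M),
    [/\ cond_expectation A X, forall n, alg M (T n),
        L1_cvg (fun n => graph_op (T n)) x &
        L1_cvg (fun n => graph_op (X (T n))) w].

Record filtration (A : nat -> set (M -> M)) : Prop := Filtration {
  filt_vna : forall k, von_neumann_algebra (A k);
  filt_sub : forall k, A k `<=` alg M;
  filt_incr : forall k, A k `<=` A k.+1;
  filt_dense : weakstar_dense (\bigcup_k A k) (alg M)
}.

Definition martingale_differences (A : nat -> set (M -> M))
    (x : nat -> op M) : Prop :=
  (forall k, in_space (Lp01 1) (x k) /\ affiliated (A k) (x k)) /\
  (forall k, L1_cond_expectation (A k) (x k.+1) (@op0 R M)).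

Definition column_norm E (x : nat -> op M) : \bar R := square_norm E x.
Definition row_norm E (x : nat -> op M) : \bar R :=
  square_norm E (fun k => adj (x k)).

Definition decomposition_norm E (A : nat -> set (M -> M))
    (x : nat -> op M) : \bar R :=
  ereal_inf [set v | exists y z : nat -> op M,
    [/\ martingale_differences A y, martingale_differences A z,
        forall k, x k = op_add (y k) (z k) &
        v = (column_norm E y + row_norm E z)%E]].

End NoncommutativeSpaces.

Definition equiv_up_to (R : realType) (C : R) (a b : \bar R) : Prop :=
  (a <= C%:E * b /\ b <= C%:E * a)%E.

Definition BG_decomposition_equivalence (R : realType) (E : fspace R) : Prop :=
  exists2 C : R, 0 < C &
    forall (M : finite_vna R) (A : nat -> set (M -> M)) (x : nat -> op M),
      filtration A -> martingale_differences A x ->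
      (forall k, in_space E (x k)) ->
      equiv_up_to C (sum_norm E x) (decomposition_norm E A x).

Definition BG_max_equivalence (R : realType) (E : fspace R) : Prop :=
  exists2 C : R, 0 < C &
    forall (M : finite_vna R) (A : nat -> set (M -> M)) (x : nat -> op M),
      filtration A -> martingale_differences A x ->
      (forall k, in_space E (x k)) ->
      equiv_up_to C (sum_norm E x) (Order.max (column_norm E x) (row_norm E x)).

(* Main.v *)
From HB Require Import structures.
Require Import Defs.
From mathcomp Require Import all_boot all_order all_algebra.
From mathcomp Require Import all_classical all_reals all_analysis.
From mathcomp Require Import complex sesquilinear ring lra zify.
From mathcomp Require Import measurable_realfun.

Set Implicit Arguments.
Unset Strict Implicit.
Unset Printing Implicit Defensive.
Import Order.TTheory GRing.Theory Num.Theory.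
Import numFieldNormedType.Exports.
Local Open Scope classical_set_scope.
Local Open Scope complex_scope.
Local Open Scope ring_scope.

(** The Burkholder-Gundy equivalence is only tested on commutative algebras.

    Give nat the probability weights [wt m], for which each block of 2^m
    consecutive points is twice as heavy as the next one and the points of a
    block weigh the same.  The bounded sequences, acting on l_2 by
    multiplication, form a finite von Neumann algebra whose measurable operators
    are the diagonal operators [dg f]; mu(dg f) is the decreasing rearrangement
    of the step function with values |f k| on intervals of lengths [wt m k], and
    the subalgebras of sequences constant on blocks of length 2^(n-l) form a
    filtration.  For the real martingale differences x_l of this filtration, both
    forms of the hypothesis say that sum x_l and the square function
    (sum x_l^2)^(1/2) have equivalent norms; in the first form because
    S(x) <= 2 (S(y) + S(z)) pointwise when x = y + z.  This is
    [square_function_of_BG], after which no operator occurs.  Infinitely many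
    atoms are used because bounded functions need not be dense in E and E need
    not have the Fatou property: the values of a decreasing rearrangement at the
    points 2^-i form a nondecreasing sequence, possibly unbounded, and such
    sequences dominate all martingales considered.

    Two martingales give the two Boyd indices.  Let N(c) be the norm of the step
    function equal to c i on [2^-(i+1), 2^-i[, and let [shiftr j] be the shift
    to the right, that is, compression of the function by 2^j.
    - A Rademacher sum c (r_1 + ... + r_n) equals n c on a set of relative
      measure 2^-n, while its square function is sqrt n c.  So
      n N(shiftr n c) <= C sqrt n N(c), and compression by a suitable 2^n halves
      the norm ([compress_half]).
    - For j uniformly distributed among 2^n values, the martingale of the
      densities 2^l 1_{j < 2^(n-l)} ends at the spike 2^n 1_{j = 0} and its square
      function is at least the hyperbola 2^(n-1) / j for j > 0.  Taking two
      independent copies, the product of the hyperbolas is controlled by the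
      product of the spikes; but it is at least 2^(n-1) at (n-1) 2^(n-2) points or
      more, by a divisor sum, and the logarithmic factor n - 1 makes this better
      than the trivial bound for a dilation ([expand_half]).
    Iteration gives geometric bounds for all dyadic dilations
    ([dilation_bounds]).

    The conclusion is then Boyd's interpolation argument.  The exponents p and q
    are chosen so that 2^(1/p) and 2^(1/q) separate the dilation exponents from
    2 and 1.  If c are the dyadic values of the rearrangement of f, split f at
    the height c i; Chebyshev's inequality in L_p and L_q bounds the rearrangement
    of T f at 2^-(i+1) by a multiple of
    sum_l ga^-l c (i + l) + sum_(l <= i) ga'^l c (i - l)
    ([interpolation_of_dilation]).  This is a series of dilations of c whose norms
    are summable, and completeness puts its sum in E ([Em_series]). *)

(** * Absolutely convergent series *)

Section RealSeries.
Variable R : realType.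
Implicit Types (u v : nat -> R).

Definition asummable u := exists B, forall n, \sum_(k < n) `|u k| <= B.
Definition rsum u : R := limn (series u).

Lemma seriesE_ord u n : series u n = \sum_(k < n) u k.
Proof. by rewrite seriesEord. Qed.

Lemma asummable_cvg u : asummable u -> cvgn (series u).
Proof.
move=> [B uB]; apply: normed_cvg; apply: nondecreasing_is_cvgn.
  by apply: nondecreasing_series => n _ _; exact: normr_ge0.
by exists B => _ [n _ <-] /=; rewrite seriesE_ord; exact: uB.
Qed.

Lemma asummable_rsum u : asummable u -> series u @ \oo --> rsum u.
Proof. by move=> /asummable_cvg. Qed.

Lemma asummable_le u v : (forall k, `|u k| <= v k) -> asummable v -> asummable u.
Proof.
move=> uv [B vB]; exists B => n; apply: le_trans (vB n).
by apply: ler_sum => k _; apply: le_trans (uv k) (ler_norm _).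
Qed.

Lemma asummableD u v : asummable u -> asummable v -> asummable (fun k => u k + v k).
Proof.
move=> [B uB] [B' vB]; exists (B + B') => n.
apply: le_trans (lerD (uB n) (vB n)); rewrite -big_split /=.
by apply: ler_sum => k _; exact: ler_normD.
Qed.

Lemma asummableZ a u : asummable u -> asummable (fun k => a * u k).
Proof.
move=> [B uB]; exists (`|a| * B) => n.
under eq_bigr do rewrite normrM; rewrite -mulr_sumr.
by apply: ler_wpM2l => //; exact: normr_ge0.
Qed.

Lemma asummableN u : asummable u -> asummable (fun k => - u k).
Proof. by move=> [B uB]; exists B => n; under eq_bigr do rewrite normrN. Qed.

Lemma rsumD u v : asummable u -> asummable v ->
  rsum (fun k => u k + v k) = rsum u + rsum v.
Proof.
move=> su sv; apply/cvg_lim => //.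
have -> : series (fun k => u k + v k) = series u \+ series v.
  by apply/funext => n; rewrite /= !seriesE_ord big_split.
by apply: cvgD; exact: asummable_rsum.
Qed.

Lemma rsumZ a u : asummable u -> rsum (fun k => a * u k) = a * rsum u.
Proof.
move=> su; apply/cvg_lim => //.
have -> : series (fun k => a * u k) = (fun n => a * series u n).
  by apply/funext => n; rewrite /= !seriesE_ord mulr_sumr.
by apply: cvgMr; exact: asummable_rsum.
Qed.

Lemma rsumN u : asummable u -> rsum (fun k => - u k) = - rsum u.
Proof.
move=> su; rewrite -mulN1r -rsumZ //; congr rsum.
by apply/funext => k; rewrite mulN1r.
Qed.

Lemma rsum_le u v : asummable u -> asummable v -> (forall k, u k <= v k) ->
  rsum u <= rsum v.
Proof.
move=> su sv uv; apply: ler_lim; [exact: asummable_cvg..|].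
by near=> n; rewrite !seriesE_ord; apply: ler_sum.
Unshelve. all: by end_near. Qed.

Lemma rsum0 : rsum (fun=> 0) = 0.
Proof.
apply/cvg_lim => //; apply: cvg_near_cst; near=> n.
by rewrite seriesE_ord big1.
Unshelve. all: by end_near. Qed.

Lemma asummable0 : asummable (fun=> 0).
Proof. by exists 0 => n; rewrite big1 // => k _; rewrite normr0. Qed.

Lemma rsum_ge0 u : asummable u -> (forall k, 0 <= u k) -> 0 <= rsum u.
Proof. by move=> su u0; rewrite -rsum0; apply: rsum_le => //; exact: asummable0. Qed.

Lemma rsum_ge_part u n : asummable u -> (forall k, 0 <= u k) ->
  \sum_(k < n) u k <= rsum u.
Proof.
move=> su u0; rewrite -seriesE_ord.
apply: nondecreasing_cvgn_le (asummable_cvg su) n.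
by apply: nondecreasing_series => k _ _.
Qed.

Lemma rsum_le_bound u B : asummable u -> (forall n, \sum_(k < n) u k <= B) ->
  rsum u <= B.
Proof.
move=> su uB; apply: limr_le; first exact: asummable_cvg.
by near=> n; rewrite seriesE_ord.
Unshelve. all: by end_near. Qed.

Lemma asummable_fin u N : (forall k, (N <= k)%N -> u k = 0) -> asummable u.
Proof.
move=> u0; exists (\sum_(k < N) `|u k|) => n.
have [nN|Nn] := leqP n N.
  rewrite (big_ord_widen N (fun k => `|u k|) nN) big_mkcond /=.
  by apply: ler_sum => k _; case: ifP.
rewrite (big_ord_widen n (fun k => `|u k|) (ltnW Nn)) [leRHS]big_mkcond /=.
apply: ler_sum => k _; case: ifP => // /negbT; rewrite -leqNgt => /u0 ->.
by rewrite normr0.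
Qed.

Lemma rsum_fin u N : (forall k, (N <= k)%N -> u k = 0) ->
  rsum u = \sum_(k < N) u k.
Proof.
move=> u0; apply/cvg_lim => //; apply: cvg_near_cst; near=> n.
have Nn : (N <= n)%N by near: n; exact: nbhs_infty_ge.
rewrite seriesE_ord (big_ord_widen n u Nn) [RHS]big_mkcond /=.
apply: eq_bigr => k _; case: ifP => // /negbT; rewrite -leqNgt => /u0 //.
Unshelve. all: by end_near. Qed.

Lemma rsum1 u i : (forall k, k != i -> u k = 0) -> rsum u = u i.
Proof.
move=> u0; rewrite (@rsum_fin u i.+1) => [|k ik]; last first.
  by apply: u0; rewrite gtn_eqF.
by rewrite big_ord_recr /= big1 ?add0r // => k _; rewrite u0 // ltn_eqF.
Qed.

Lemma rsum_eq0 u : asummable u -> (forall k, 0 <= u k) -> rsum u = 0 ->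
  forall k, u k = 0.
Proof.
move=> su u0 us k; apply/eqP; rewrite eq_le u0 andbT -us.
by apply: le_trans (rsum_ge_part k.+1 su u0); rewrite big_ord_recr /= lerDr sumr_ge0.
Qed.

End RealSeries.

(** * The Hilbert space l_2 *)

Section SquareSummable.
Variable R : realType.
Local Notation C := R[i].
Local Notation Re := (@complex.Re R).
Local Notation Im := (@complex.Im R).

(** The squared modulus, as a real number. *)
Definition n2 (z : C) : R := Re z ^+ 2 + Im z ^+ 2.

Lemma n2_ge0 z : 0 <= n2 z. Proof. by rewrite addr_ge0 ?sqr_ge0. Qed.
Lemma n2_0 : n2 0 = 0. Proof. by rewrite /n2 /= expr0n /= addr0. Qed.
Lemma n2_eq0 z : n2 z = 0 -> z = 0.
Proof.
move=> /eqP; rewrite /n2 paddr_eq0 ?sqr_ge0 // !sqrf_eq0.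
by case: z => a b /= /andP[/eqP -> /eqP ->].
Qed.
Lemma n2M a z : n2 (a * z) = n2 a * n2 z.
Proof. by case: a z => a b [x y]; rewrite /n2 /=; ring. Qed.
Lemma n2D a z : n2 (a + z) <= 2 * n2 a + 2 * n2 z.
Proof.
case: a z => a b [x y]; rewrite /n2 /=.
have := sqr_ge0 (a - x); have := sqr_ge0 (b - y); lra.
Qed.
Lemma normCn2 z : `|z| = (Num.sqrt (n2 z))%:C :> C.
Proof. by rewrite normc_def. Qed.

Definition l2 (h : nat -> C) := asummable (n2 \o h).

Lemma l2P (h : nat -> C) : l2 h <-> exists B, forall n, \sum_(k < n) n2 (h k) <= B.
Proof.
have e n : \sum_(k < n) `|(n2 \o h) k| = \sum_(k < n) n2 (h k).
  by apply: eq_bigr => k _; rewrite /= ger0_norm ?n2_ge0.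
by split=> -[B hB]; exists B => n; have := hB n; rewrite e.
Qed.

Lemma l20 : l2 0.
Proof.
by apply: (@asummable_fin _ _ 0) => k _ /=; rewrite n2_0.
Qed.
Lemma l2Z a (h : nat -> C) : l2 h -> l2 (a *: h).
Proof.
move=> /(asummableZ (n2 a)); apply: asummable_le => k /=.
by rewrite ger0_norm ?n2_ge0 // n2M.
Qed.
Lemma l2D (h g : nat -> C) : l2 h -> l2 g -> l2 (h + g).
Proof.
move=> /(asummableZ 2) hh /(asummableZ 2) gg.
apply: asummable_le (asummableD hh gg) => k /=.
by rewrite ger0_norm ?n2_ge0 // n2D.
Qed.

Definition l2pred : {pred (nat -> C)} := [pred h | `[< l2 h >]].
Lemma l2_submod : submod_closed l2pred.
Proof.
split; first by apply/asboolP; exact: l20.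
move=> a h g /asboolP hh /asboolP gg; apply/asboolP.
by apply: l2D => //; exact: l2Z.
Qed.
HB.instance Definition _ := GRing.isSubmodClosed.Build _ _ l2pred l2_submod.

Record ell2 := Ell2 { ev :> nat -> C; _ : ev \in l2pred }.
HB.instance Definition _ := [isSub for ev].
HB.instance Definition _ := [Choice of ell2 by <:].
HB.instance Definition _ := [SubChoice_isSubLmodule of ell2 by <:].

Lemma ell2P (h : ell2) : l2 h.
Proof. by case: h => h /= /asboolP. Qed.
Lemma ell2_ext (h g : ell2) : (forall i, h i = g i) -> h = g.
Proof. by move=> hg; apply/val_inj/funext. Qed.
Lemma evD (h g : ell2) i : (h + g) i = h i + g i. Proof. by []. Qed.
Lemma evZ a (h : ell2) i : (a *: h) i = a * h i. Proof. by []. Qed.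
End SquareSummable.

Lemma eq_asummable (R : realType) (u v : nat -> R) :
  u =1 v -> asummable u -> asummable v.
Proof. by move=> /funext ->. Qed.

Lemma conjcD (R : realType) (a b : R[i]) : (a + b)^*%C = a^*%C + b^*%C.
Proof. by case: a b => a1 a2 [b1 b2]; simpc; congr (_ +i* _); ring. Qed.
Lemma conjcM (R : realType) (a b : R[i]) : (a * b)^*%C = a^*%C * b^*%C.
Proof. by case: a b => a1 a2 [b1 b2]; simpc; congr (_ +i* _); ring. Qed.

Section ComplexSeries.
Variable R : realType.
Local Notation C := R[i].
Local Notation Re := (@complex.Re R).
Local Notation Im := (@complex.Im R).
Implicit Types (u v : nat -> C).

Definition csummable u := asummable (Re \o u) /\ asummable (Im \o u).
Definition csum u : C := rsum (Re \o u) +i* rsum (Im \o u).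

Lemma csumD u v : csummable u -> csummable v ->
  csum (fun k => u k + v k) = csum u + csum v.
Proof.
move=> [a b] [c d]; rewrite /csum; simpc; rewrite -!rsumD //.
by congr (rsum _ +i* rsum _); apply/funext => k /=; case: (u k) (v k) => ? ? [].
Qed.

Lemma csummableZ a u : csummable u -> csummable (fun k => a * u k).
Proof.
case: a => a b [s t]; split.
  have := asummableD (asummableZ a s) (asummableZ (- b) t).
  by apply: eq_asummable => k /=; case: (u k) => x y /=; ring.
have := asummableD (asummableZ a t) (asummableZ b s).
by apply: eq_asummable => k /=; case: (u k) => x y /=; ring.
Qed.

Lemma csumZ a u : csummable u -> csum (fun k => a * u k) = a * csum u.
Proof.
case: a => a b [s t]; rewrite /csum; simpc; rewrite -!rsumZ // -rsumN; last exact: asummableZ.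
rewrite -!rsumD; do ?exact: asummableZ; last by apply/asummableN/asummableZ.
by congr (rsum _ +i* rsum _); apply/funext => k /=; case: (u k) => x y /=; ring.
Qed.

Lemma csumJ u : csummable u -> csum (fun k => (u k)^*%C) = (csum u)^*%C.
Proof.
move=> [s t]; rewrite /csum /= -rsumN //.
by congr (rsum _ +i* rsum _); apply/funext => k /=; case: (u k).
Qed.

Lemma csum1 u i : (forall k, k != i -> u k = 0) -> csum u = u i.
Proof.
move=> u0; rewrite /csum !(@rsum1 _ _ i) /=; first by case: (u i).
- by move=> k /u0 /= ->.
- by move=> k /u0 /= ->.
Qed.

Lemma csum_real (u : nat -> R) : csum (fun k => (u k)%:C) = (rsum u)%:C.
Proof. by rewrite /csum; congr (_ +i* _); exact: rsum0. Qed.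

Lemma csummable_bound u v : (forall k, n2 (u k) <= n2 (v k)) ->
  asummable (fun k => Num.sqrt (n2 (v k))) -> csummable u.
Proof.
move=> uv; move=> H; split; apply: asummable_le H => k /=;
  (apply: le_trans (ler_wsqrtr (uv k)); rewrite -sqrtr_sqr; apply: ler_wsqrtr;
   by rewrite /n2 ?lerDl ?lerDr sqr_ge0).
Qed.

Lemma csummable_dot (h g : nat -> C) : l2 h -> l2 g ->
  csummable (fun k => h k * (g k)^*%C).
Proof.
move=> hh gg; split; apply: asummable_le (asummableD hh gg) => k /=;
  case: (h k) (g k) => a b [x y]; rewrite /n2 /= ler_norml.
- have := sqr_ge0 (a - x); have := sqr_ge0 (b - y).
  by have := sqr_ge0 (a + x); have := sqr_ge0 (b + y); nra.
- have := sqr_ge0 (a - y); have := sqr_ge0 (b - x).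
  by have := sqr_ge0 (a + y); have := sqr_ge0 (b + x); nra.
Qed.

End ComplexSeries.

Section Ell2.
Variable R : realType.
Local Notation C := R[i].
Local Notation H := (ell2 R).
Local Notation Re := (@complex.Re R).
Local Notation Im := (@complex.Im R).
Implicit Types (h g : H).

Definition dotl h g : C := csum (fun k => h k * (g k)^*%C).

Lemma dotlP h g : csummable (fun k => h k * (g k)^*%C).
Proof. by apply: csummable_dot; exact: ell2P. Qed.

Lemma dotlD h h' g : dotl (h + h') g = dotl h g + dotl h' g.
Proof.
rewrite /dotl -csumD; do ?exact: dotlP.
by congr csum; apply/funext => k; rewrite evD mulrDl.
Qed.

Lemma dotlZ a h g : dotl (a *: h) g = a * dotl h g.
Proof.
rewrite /dotl -csumZ; do ?exact: dotlP.
by congr csum; apply/funext => k; rewrite evZ mulrA.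
Qed.

Lemma dotlC h g : dotl g h = (dotl h g)^*%C.
Proof.
rewrite /dotl -csumJ; last exact: dotlP.
by congr csum; apply/funext => k; rewrite conjcM conjcK mulrC.
Qed.

Lemma dotlDr h g g' : dotl h (g + g') = dotl h g + dotl h g'.
Proof. by rewrite dotlC dotlD conjcD -!dotlC. Qed.

Lemma dotlZr a h g : dotl h (a *: g) = a^*%C * dotl h g.
Proof. by rewrite dotlC dotlZ conjcM -!dotlC. Qed.

Definition sqn h : R := rsum (@n2 R \o h).

Lemma sqn_ge0 h : 0 <= sqn h.
Proof. by apply: rsum_ge0; [exact: ell2P|move=> k; exact: n2_ge0]. Qed.

Lemma dotlE h : dotl h h = (sqn h)%:C.
Proof.
rewrite /sqn -csum_real; congr csum; apply/funext => k /=.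
by case: (h k) => a b; rewrite /n2; simpc; congr (_ +i* _); ring.
Qed.

Lemma sqn_eq0 h : sqn h = 0 -> h = 0.
Proof.
move=> h0; apply: ell2_ext => i; apply: n2_eq0.
by apply: (rsum_eq0 (ell2P h)) => // k; exact: n2_ge0.
Qed.

Lemma sqnZ a h : sqn (a *: h) = n2 a * sqn h.
Proof.
rewrite /sqn -rsumZ; last exact: ell2P.
by congr rsum; apply/funext => k; rewrite /= n2M.
Qed.

Lemma sqnD h g : sqn (h + g) = sqn h + sqn g + 2 * Re (dotl h g).
Proof.
apply: complexI; rewrite -dotlE dotlD !dotlDr !dotlE (dotlC h g).
by case: (dotl h g) => x y /=; rewrite /real_complex_def; simpc; congr (_ +i* _); ring.
Qed.

Definition nl h : R := Num.sqrt (sqn h).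
Lemma nl_ge0 h : 0 <= nl h. Proof. exact: sqrtr_ge0. Qed.
Lemma sqr_nl h : nl h ^+ 2 = sqn h.
Proof. by rewrite sqr_sqrtr // sqn_ge0. Qed.

Lemma nlZ a h : nl (a *: h) = Num.sqrt (n2 a) * nl h.
Proof. by rewrite /nl sqnZ sqrtrM // n2_ge0. Qed.

Lemma n2C (a : R) : n2 (a%:C) = a ^+ 2.
Proof. by rewrite /n2 /= expr0n addr0. Qed.

Lemma nl_eq0 h : nl h = 0 -> h = 0.
Proof.
by move=> h0; apply: sqn_eq0; rewrite -sqr_nl h0 expr0n.
Qed.

(** Cauchy-Schwarz, by expanding the square norm of |g| h - |h| g. *)
Lemma Re_dotl_le h g : Re (dotl h g) <= nl h * nl g.
Proof.
have [h0|h0] := eqVneq (nl h) 0.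
  rewrite h0 mul0r (nl_eq0 h0) -(scale0r h) dotlZ mul0r //.
have [g0|g0] := eqVneq (nl g) 0.
  by rewrite g0 mulr0 (nl_eq0 g0) -(scale0r g) dotlZr raddf0 mul0r.
have := sqn_ge0 ((nl g)%:C *: h + (- nl h)%:C *: g).
rewrite sqnD !sqnZ !n2C dotlZ dotlZr conjc_real -!sqr_nl.
have -> : Re ((nl g)%:C * ((- nl h)%:C * dotl h g)) = - nl g * nl h * Re (dotl h g).
  by case: (dotl h g) => x y; simpc => /=; ring.
have hp : 0 < nl h by rewrite lt_def h0 nl_ge0.
have gp : 0 < nl g by rewrite lt_def g0 nl_ge0.
move: (Re _) => x H0.
have : 0 <= 2 * (nl g * nl h) * (nl h * nl g - x) by move: H0; lra.
by rewrite pmulr_rge0 ?subr_ge0 // !mulr_gt0.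
Qed.

Lemma nlD h g : nl (h + g) <= nl h + nl g.
Proof.
rewrite -(@ler_pXn2r _ 2) ?nnegrE ?addr_ge0 ?nl_ge0 // sqr_nl sqnD -!sqr_nl.
by have := Re_dotl_le h g; rewrite sqrrD; lra.
Qed.

Lemma n2_le_sqn h i : n2 (h i) <= sqn h.
Proof.
apply: le_trans (rsum_ge_part i.+1 (ell2P h) _) => [|k]; last exact: n2_ge0.
by rewrite big_ord_recr /= lerDr sumr_ge0 // => k _; exact: n2_ge0.
Qed.

Lemma nlDC h g : (nl (h + g))%:C <= (nl h)%:C + (nl g)%:C :> C.
Proof. by rewrite -rmorphD /= lecR nlD. Qed.
Lemma nlZC (a : C) h : (nl (a *: h))%:C = `|a| * (nl h)%:C :> C.
Proof. by rewrite nlZ rmorphM normCn2. Qed.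
Lemma nl0C h : (nl h)%:C = 0 :> C -> h = 0.
Proof. by move=> [] /nl_eq0. Qed.
HB.instance Definition _ :=
  Lmodule_isNormed.Build C H nlDC nlZC nl0C.

Lemma normlE h : `|h| = (nl h)%:C :> C. Proof. by []. Qed.

Lemma sqn_le_part h (e : R) : 
  (forall n, \sum_(k < n) n2 (h k) <= e) -> sqn h <= e.
Proof. by move=> he; apply: rsum_le_bound => //; exact: ell2P. Qed.

End Ell2.

Section Hilbert.
Variable R : realType.
Local Notation C := R[i].
Local Notation H := (ell2 R).
Local Notation Re := (@complex.Re R).
Local Notation Im := (@complex.Im R).
Implicit Types (h g : H).

Lemma nl_ballE (h g : H) (e : R) : ball h e%:C g = (nl (h - g) < e).
Proof. by rewrite -ball_normE /ball_ /= normlE ltcR. Qed.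

Lemma nl_ltP h (e : R) : 0 < e -> (nl h < e) = (sqn h < e ^+ 2).
Proof. by move=> e0; rewrite -sqr_nl ltr_pXn2r ?nnegrE ?nl_ge0 ?ltW. Qed.

Lemma n2_le_nl h i : Num.sqrt (n2 (h i)) <= nl h.
Proof. by rewrite ler_wsqrtr // n2_le_sqn. Qed.

Lemma Re_le_sqrtn2 (z : C) : `|Re z| <= Num.sqrt (n2 z).
Proof. by rewrite -sqrtr_sqr ler_wsqrtr // lerDl sqr_ge0. Qed.
Lemma Im_le_sqrtn2 (z : C) : `|Im z| <= Num.sqrt (n2 z).
Proof. by rewrite -sqrtr_sqr ler_wsqrtr // lerDr sqr_ge0. Qed.

(** A Cauchy filter converges in each coordinate, and its norm bounds, which
    pass to the limit on each finite set of coordinates, hold for the limit. *)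
Lemma ell2_complete (F : set_system H) : ProperFilter F -> cauchy F -> cvg F.
Proof.
move=> FF /cauchy_ballP Fc.
have Fc' (e : R) : 0 < e -> \forall x & y \near F, nl (x - y) < e.
  move=> e0; have e0C : (0 : C) < e%:C by rewrite ltcR.
  by apply: filterS (Fc _ e0C) => -[x y] /=; rewrite nl_ballE.
have cv (p : C -> R) : (forall z z', p (z - z') = p z - p z') ->
    (forall z, `|p z| <= Num.sqrt (n2 z)) ->
    forall i, cvg (p (ev h i) @[h --> F]).
  move=> pB pn i; apply: R_complete; apply/cauchy_ballP => e e0.
  have [[A B] /= [FA FB] AB] := Fc' _ e0.
  exists ([set p (ev h i) | h in A], [set p (ev h i) | h in B]) => /=.
    by split; [apply: filterS FA|apply: filterS FB] => x xA /=; exists x.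
  move=> [a b] /= [[x Ax <-] [y By <-]].
  rewrite -ball_normE /ball_ /= -pB.
  apply: le_lt_trans (pn _) _; apply: le_lt_trans (n2_le_nl (x - y) i) _.
  exact: (AB (x, y)).
have RB (z z' : C) : Re (z - z') = Re z - Re z' by case: z z' => ? ? [].
have IB (z z' : C) : Im (z - z') = Im z - Im z' by case: z z' => ? ? [].
have cR := cv _ RB Re_le_sqrtn2; have cI := cv _ IB Im_le_sqrtn2.
pose l i : C := lim (Re (ev h i) @[h --> F]) +i* lim (Im (ev h i) @[h --> F]).
have n2cv x i : n2 (ev x i - ev h i) @[h --> F] --> n2 (ev x i - l i).
  rewrite /n2 /=; under eq_cvg do rewrite RB IB.
  rewrite RB IB; apply: cvgD; rewrite expr2; under eq_cvg do rewrite expr2.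
    by apply: cvgM; apply: cvgB; (try exact: cvg_cst); exact: cR.
  by apply: cvgM; apply: cvgB; (try exact: cvg_cst); exact: cI.
have key (e : R) : 0 < e -> \forall x \near F,
    forall n, \sum_(k < n) n2 (ev x k - l k) <= e ^+ 2.
  move=> e0; have [[A B] /= [FA FB] AB] := Fc' _ e0.
  apply: filterS FA => x Ax n.
  have cvs : \sum_(k < n) n2 (ev x k - ev h k) @[h --> F] -->
      \sum_(k < n) n2 (ev x k - l k).
    by apply: cvg_big => [|k _]; [exact: add_continuous|exact: n2cv].
  rewrite -(cvg_lim (@Rhausdorff R) cvs); apply: limr_le.
    by apply/cvg_ex; eexists; exact: cvs.
  apply: filterS FB => y By.
  have /ltW := AB (x, y) (conj Ax By); rewrite /= => xy.
  apply: le_trans (_ : sqn (x - y) <= _); last first.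
    by rewrite -sqr_nl ler_pXn2r ?nnegrE ?nl_ge0 // ltW.
  apply: le_trans (rsum_ge_part n (ell2P (x - y)) _) => [|k]; last exact: n2_ge0.
  by apply: ler_sum => k _.
have l2l : l2 l.
  have [x xP] := filter_ex (key 1 ltr01).
  have : l2 (ev x - l).
    by apply/l2P; exists (1 ^+ 2) => n; have := xP n.
  move=> /(l2Z (-1)) /(l2D (ell2P x)).
  by rewrite scaleN1r opprB addrC subrK.
have lP : l \in @l2pred R by apply/asboolP.
apply/cvg_ex; exists (Ell2 lP); apply/cvgrPdist_lt => eC eC0.
have [e e0 eE] : exists2 e : R, 0 < e & eC = e%:C.
  case: eC eC0 => a b; rewrite ltcE /= => /andP[/eqP -> a0].
  by exists a.
rewrite eE; apply: filterS (key (e / 2) _) => [x xP|]; last by rewrite divr_gt0.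
rewrite distrC normlE ltcR nl_ltP //; apply: le_lt_trans (_ : _ <= (e / 2) ^+ 2) _.
  by apply: sqn_le_part => n; exact: xP.
by rewrite ltr_pXn2r ?nnegrE ?divr_ge0 ?ltW // ltr_pdivrMr // ltr_pMr // ltr1n.
Qed.

HB.instance Definition _ := Uniform_isComplete.Build H ell2_complete.

Definition hdot : H -> H -> C := @dotl R.

Lemma dotl_bilinear : bilinear_for *%R (Num.conj_op \; *%R) hdot.
Proof.
split=> [g a x y|h a x y] /=; rewrite /hdot; first by rewrite dotlD dotlZ.
by rewrite dotlDr dotlZr.
Qed.
HB.instance Definition _ := bilinear_isBilinear.Build C H H C *%R
  (Num.conj_op \; *%R) hdot dotl_bilinear.

Lemma dotl_herm (x y : H) : hdot x y = (-1) ^+ false * Num.conj_op (hdot y x).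
Proof. by rewrite mul1r /hdot dotlC. Qed.
HB.instance Definition _ := isHermitianSesquilinear.Build C H false Num.conj_op hdot dotl_herm.

Lemma dotl_gt0 (u : H) : u != 0 -> 0 < hdot u u.
Proof.
move=> u0; rewrite /hdot dotlE ltcR lt_def sqn_ge0 andbT.
by apply/negP => /eqP /sqn_eq0 /eqP; rewrite (negbTE u0).
Qed.
HB.instance Definition _ := isDotProduct.Build C H hdot dotl_gt0.

Lemma hdot_norm (h : H) : `|h| ^+ 2 = hdot h h.
Proof. by rewrite /hdot dotlE normlE -rmorphXn /= sqr_nl. Qed.

Definition ell2_hilbert : hilbert R :=
  @Hilbert R (ell2 R : completeNormedModType C) (hdot : {dot (ell2 R) for Num.conj}) hdot_norm.

Definition mk_ell2 (u : nat -> C) : H := insubd (0 : H) u.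
Lemma mk_ell2E u : l2 u -> ev (mk_ell2 u) = u.
Proof. by move=> ul; rewrite /mk_ell2 insubdK //; apply/asboolP. Qed.

End Hilbert.

(** A Hilbert space with coordinates identifying it with l_2; nothing else about
    l_2 is used below. *)
Record l2_model (R : realType) := L2Model {
  l2H :> hilbert R;
  co : l2H -> nat -> R[i];
  mk : (nat -> R[i]) -> l2H;
  co_lin : forall a (h g : l2H) i, co (a *: h + g) i = a * co h i + co g i;
  co_ext : forall h g, (forall i, co h i = co g i) -> h = g;
  co_l2 : forall h, l2 (co h);
  mkE : forall u, l2 u -> co (mk u) = u;
  dotHE : forall h g, dot l2H h g = csum (fun k => co h k * (co g k)^*%C)
}.

Definition ell2_model (R : realType) : l2_model R :=
  @L2Model R (ell2_hilbert R) (@ev R) (@mk_ell2 R)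
    (fun a h g i => erefl) (@ell2_ext R) (@ell2P R) (@mk_ell2E R)
    (fun h g => erefl).
Arguments mk {R l} _.
Arguments co {R l} _ _.
Arguments mkE {R l} [u] _.

(** * Diagonal operators on l_2 *)

Section DiagonalOperators.
Variables (R : realType) (H : l2_model R).
Local Notation C := R[i].
Local Notation Re := (@complex.Re R).
Local Notation Im := (@complex.Im R).
Implicit Types (h g : H) (f : nat -> C) (x r : op H).

Lemma coZ a h i : co (a *: h) i = a * co h i.
Proof.
have := co_lin a h 0 i; rewrite addr0 => ->.
have := co_lin 1 (0 : H) 0 i; rewrite scaler0 addr0 mul1r => /eqP.
by rewrite addrC -subr_eq subrr eq_sym => /eqP ->; rewrite addr0.
Qed.
Lemma coD h g i : co (h + g) i = co h i + co g i.
Proof. by have := co_lin 1 h g i; rewrite scale1r mul1r. Qed.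
Lemma coN h i : co (- h) i = - co h i.
Proof. by rewrite -scaleN1r coZ mulN1r. Qed.
Lemma coB h g i : co (h - g) i = co h i - co g i.
Proof. by rewrite coD coN. Qed.
Lemma co0 i : co (0 : H) i = 0.
Proof. by rewrite -(scale0r (0 : H)) coZ mul0r. Qed.

Definition sq h : R := rsum (@n2 R \o co h).
Definition nrm h : R := Num.sqrt (sq h).
Lemma sq_ge0 h : 0 <= sq h.
Proof. by apply: rsum_ge0; [exact: co_l2|move=> k; exact: n2_ge0]. Qed.
Lemma sq_dot h : dot H h h = (sq h)%:C.
Proof.
rewrite dotHE /sq -csum_real; congr csum; apply/funext => k /=.
by case: (co h k) => a b; rewrite /n2; simpc; congr (_ +i* _); ring.
Qed.
Lemma nrmE h : `|h| = (nrm h)%:C.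
Proof.
apply/eqP; rewrite -(@eqrXn2 _ 2) ?normr_ge0 ?ler0c ?sqrtr_ge0 //.
by rewrite hnormE sq_dot -rmorphXn sqr_sqrtr ?sq_ge0.
Qed.
Lemma nrm_ge0 h : 0 <= nrm h. Proof. exact: sqrtr_ge0. Qed.
Lemma sqr_nrm h : nrm h ^+ 2 = sq h. Proof. by rewrite sqr_sqrtr ?sq_ge0. Qed.
Lemma sq_eq0 h : sq h = 0 -> h = 0.
Proof.
move=> h0; apply: co_ext => i; rewrite co0; apply: n2_eq0.
by apply: (rsum_eq0 (co_l2 h)) => // k; exact: n2_ge0.
Qed.
Lemma nrm_ballE h g (e : R) : ball h e%:C g = (nrm (h - g) < e).
Proof. by rewrite -ball_normE /ball_ /= nrmE ltcR. Qed.
Lemma nrm_ltP h (e : R) : 0 < e -> (nrm h < e) = (sq h < e ^+ 2).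
Proof. by move=> e0; rewrite -sqr_nrm ltr_pXn2r ?nnegrE ?nrm_ge0 ?ltW. Qed.
Lemma n2_le_sq h i : n2 (co h i) <= sq h.
Proof.
apply: le_trans (rsum_ge_part i.+1 (co_l2 h) _) => [|k]; last exact: n2_ge0.
by rewrite big_ord_recr /= lerDr sumr_ge0 // => k _; exact: n2_ge0.
Qed.
Lemma co_le h i : Num.sqrt (n2 (co h i)) <= nrm h.
Proof. by rewrite ler_wsqrtr // n2_le_sq. Qed.

Definition basis i : H := mk (fun k => (k == i)%:R).
Lemma basisE i k : co (basis i) k = (k == i)%:R.
Proof.
rewrite mkE //; apply: (@asummable_fin _ _ i.+1) => j ij /=.
by rewrite gtn_eqF // n2_0.
Qed.

Lemma dot_basisr h i : dot H h (basis i) = co h i.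
Proof.
rewrite dotHE (@csum1 _ _ i) => [|k ki]; rewrite basisE ?eqxx ?(negbTE ki).
  by rewrite conjc1 mulr1.
by rewrite conjc0 mulr0.
Qed.
Lemma dot_basisl h i : dot H (basis i) h = (co h i)^*%C.
Proof.
rewrite dotHE (@csum1 _ _ i) => [|k ki]; rewrite basisE ?eqxx ?(negbTE ki).
  by rewrite mul1r.
by rewrite mul0r.
Qed.

Lemma nrm_basis i : nrm (basis i) = 1.
Proof.
rewrite /nrm /sq (@rsum1 _ _ i) => [|k /negbTE kj] /=; rewrite basisE ?kj ?eqxx.
  by rewrite /n2 /= expr1n expr0n addr0 sqrtr1.
exact: n2_0.
Qed.

Definition bdd f := exists B : R, forall i, n2 (f i) <= B.
Definition mulf f h : H := mk (fun i => f i * co h i).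
Lemma mulfE f h i : bdd f -> co (mulf f h) i = f i * co h i.
Proof.
move=> [B fB]; rewrite mkE //.
apply: asummable_le (asummableZ B (co_l2 h)) => k /=.
by rewrite ger0_norm ?n2_ge0 // n2M ler_wpM2r // n2_ge0.
Qed.

Definition cut n h : H := mulf (fun i => (i < n)%:R) h.
Lemma bdd_ind (P : pred nat) : bdd (fun i => (P i)%:R).
Proof.
exists 1 => i; case: (P i); rewrite ?n2_0 ?ler01 // /n2 /=.
by rewrite expr1n expr0n addr0.
Qed.
Lemma cutE n h i : co (cut n h) i = (i < n)%:R * co h i.
Proof. by rewrite mulfE //; exact: (bdd_ind (fun i => i < n)%N). Qed.

Lemma n2N (z : C) : n2 (- z) = n2 z.
Proof. by case: z => a b; rewrite /n2 /= !sqrrN. Qed.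

(** The finitely supported vectors are a common core of all diagonal operators. *)
Lemma cut_cvg h (e : R) : 0 < e -> exists N, forall n, (N <= n)%N ->
  nrm (h - cut n h) < e.
Proof.
move=> e0; have hs := asummable_rsum (co_l2 h).
have [N _ NP] : \forall n \near \oo, `|sq h - series (@n2 R \o co h) n| < e ^+ 2.
  by move/cvgrPdist_lt: hs; apply; rewrite exprn_gt0.
exists N => n Nn; have := NP n Nn.
have part : series (@n2 R \o co h) n = sq (cut n h).
  rewrite seriesE_ord /sq (@rsum_fin _ _ n); last first.
    by move=> k nk; rewrite /= cutE ltnNge nk mul0r n2_0.
  apply: eq_bigr => k _ /=; rewrite cutE ltn_ord.
  by rewrite mul1r.
have -> : sq h = sq (cut n h) + sq (h - cut n h).
  have E k : n2 (co h k) = n2 (co (cut n h) k) + n2 (co h k - co (cut n h) k).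
    rewrite cutE; case: (k < n)%N;
      by rewrite ?mul1r ?mul0r ?subrr ?subr0 ?n2_0 ?addr0 ?add0r.
  rewrite /sq -rsumD; [|exact: co_l2|exact: co_l2].
  by congr rsum; apply/funext => k; rewrite /= coB; exact: E.
rewrite part addrC addKr ger0_norm; last exact: sq_ge0.
by rewrite nrm_ltP.
Qed.

Lemma posC_real (z : C) : 0 < z -> exists2 e : R, 0 < e & z = e%:C.
Proof. by case: z => a b; rewrite ltcE /= => /andP[/eqP -> a0]; exists a. Qed.

Lemma clP (S : set H) h : closure S h <->
  forall e : R, 0 < e -> exists2 h', S h' & nrm (h - h') < e.
Proof.
split=> [Sh e e0|Sh B].
  have e0C : (0 : C) < e%:C by rewrite ltcR.
  have [h' [Sh' hh']] := Sh _ (nbhsx_ballx h _ e0C).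
  by exists h' => //; rewrite -nrm_ballE.
move=> /nbhs_ballP[eC /= eC0 eB].
have [e e0 eE] := posC_real eC0.
have [h' Sh' hh'] := Sh e e0.
by exists h'; split=> //; apply: eB; rewrite eE nrm_ballE.
Qed.

Lemma cl2P (S : set (H * H)) h g : closure S (h, g) <->
  forall e : R, 0 < e -> exists h' g',
    [/\ S (h', g'), nrm (h - h') < e & nrm (g - g') < e].
Proof.
split=> [Sh e e0|Sh B].
  have e0C : (0 : C) < e%:C by rewrite ltcR.
  have [[h' g'] [Sh' [/= a b]]] := Sh _ (nbhsx_ballx (h, g) _ e0C).
  by exists h', g'; rewrite -!nrm_ballE.
move=> /nbhs_ballP[eC /= eC0 eB].
have [e e0 eE] := posC_real eC0.
have [h' [g' [Sh' hh' gg']]] := Sh e e0.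
by exists (h', g'); split=> //; apply: eB; rewrite eE; split; rewrite /= nrm_ballE.
Qed.

(** Multiplication by the sequence f, with its maximal domain. *)
Definition dg f : op H := [set hg | forall i, co hg.2 i = f i * co hg.1 i].

Lemma sqrtn2D (a b : C) : Num.sqrt (n2 (a + b)) <= Num.sqrt (n2 a) + Num.sqrt (n2 b).
Proof. by have := ler_normD a b; rewrite !normCn2 -rmorphD lecR. Qed.
Lemma sqrtn2M (a b : C) : Num.sqrt (n2 (a * b)) = Num.sqrt (n2 a) * Num.sqrt (n2 b).
Proof. by rewrite n2M sqrtrM // n2_ge0. Qed.

Lemma small_eq0 (z : C) (K : R) : 0 <= K ->
  (forall e : R, 0 < e -> Num.sqrt (n2 z) <= K * e) -> z = 0.
Proof.
move=> K0 ze; apply: n2_eq0; apply/eqP; rewrite eq_le n2_ge0 andbT -sqrtr_eq0.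
rewrite eq_le sqrtr_ge0 andbT; apply/ler_addgt0Pr => e e0; rewrite add0r.
apply: le_trans (ze (e / (K + 1)) _) _; first by rewrite divr_gt0 // ltr_wpDl.
by rewrite mulrCA ger_pMr // ler_pdivrMr ?ltr_wpDl // mul1r lerDl.
Qed.

Lemma dg_closed f : closed (dg f).
Proof.
rewrite closure_id; apply/seteqP; split; first exact: subset_closure.
move=> [h g] /cl2P hg i /=; apply/eqP; rewrite -subr_eq0; apply/eqP.
apply: (@small_eq0 _ (1 + Num.sqrt (n2 (f i)))) => [|e e0]; first by rewrite addr_ge0 ?sqrtr_ge0.
have [h' [g' [/= d a b]]] := hg e e0.
have -> : co g i - f i * co h i = co (g - g') i + f i * (- co (h - h') i).
  by rewrite !coB d; ring.
apply: le_trans (sqrtn2D _ _) _; rewrite mulrDl mul1r sqrtn2M n2N.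
apply: lerD; first exact: le_trans (co_le _ _) (ltW b).
by rewrite ler_wpM2l ?sqrtr_ge0 //; exact: le_trans (co_le _ _) (ltW a).
Qed.

Lemma cut_dg f n h : dg f (cut n h, mk (fun i => f i * co (cut n h) i)).
Proof.
move=> i /=; rewrite mkE //; apply: (@asummable_fin _ _ n) => k nk /=.
by rewrite cutE ltnNge nk mul0r mulr0 n2_0.
Qed.

Lemma dg_densely_closed f : densely_closed (dg f).
Proof.
split.
- split=> [i|c h g h' g' hg hg' i] /=; first by rewrite !co0 mulr0.
  rewrite !coD !coZ.
  by rewrite (hg i) (hg' i) /=; ring.
- by move=> h g g' hg hg'; apply: co_ext => i; rewrite (hg i) (hg' i).
- apply/seteqP; split=> // h _; apply/clP => e /cut_cvg -/(_ h)[N NP].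
  exists (cut N h); last exact: NP.
  by eexists; exact: cut_dg.
- exact: dg_closed.
Qed.

Lemma dg_basis f i : dg f (basis i, f i *: basis i).
Proof.
move=> k /=; rewrite coZ !basisE; case: eqP => [->|] //.
by rewrite !mulr0.
Qed.

Lemma adj_dg f : adj (dg f) = dg (fun i => (f i)^*%C).
Proof.
apply/seteqP; split=> -[h g] hg.
  move=> i /=; have := hg _ _ (dg_basis f i).
  rewrite /= dot_basisl => e; rewrite -[LHS]conjcK -e.
  have -> : dot H (f i *: basis i) h = f i * dot H (basis i) h by exact: linearZl_LR.
  by rewrite dot_basisl conjcM conjcK.
move=> u v uv; rewrite !dotHE; congr csum; apply/funext => k.
by have := uv k; have := hg k; rewrite /= => -> ->; rewrite conjcM conjcK; ring.
Qed.

(** The strong sum is the closure of the algebraic sum, and truncation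
    approximates every vector of the graph of the sum of the symbols. *)
Lemma op_add_dg f f' : op_add (dg f) (dg f') = dg (fun i => f i + f' i).
Proof.
apply/seteqP; split=> -[h g]; last first.
  move=> hg; apply/cl2P => e e0.
  have [N NP] := cut_cvg h e0; have [N' NP'] := cut_cvg g e0.
  exists (cut (maxn N N') h), (cut (maxn N N') g); split; last 2 first.
  - by apply: NP; rewrite leq_maxl.
  - by apply: NP'; rewrite leq_maxr.
  exists (mk (fun i => f i * co (cut (maxn N N') h) i)),
    (mk (fun i => f' i * co (cut (maxn N N') h) i)).
  split; [exact: cut_dg|exact: cut_dg|]; apply: co_ext => i; rewrite coD.
  rewrite (cut_dg f _ h i) (cut_dg f' _ h i) /= !cutE (hg i) /=; ring.
move=> hg; rewrite (_ : dg _ = closure (dg (fun i => f i + f' i))); last first.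
  exact/closure_id/dg_closed.
move: (h, g) hg; rewrite /op_add.
apply: closure_subset => -[u v] /= [a [b [ua ub ->]]] i.
by rewrite /= coD (ua i) (ub i) /= mulrDl.
Qed.

Lemma op_opp_dg f : op_opp (dg f) = dg (fun i => - f i).
Proof.
apply/seteqP; split=> -[h g] hg i; have := hg i; rewrite /= coN.
  by move=> /eqP; rewrite eqr_oppLR mulNr => /eqP.
by move=> ->; rewrite mulNr opprK.
Qed.

Lemma op0_dg : @op0 R H = dg (fun=> 0).
Proof.
apply/seteqP; split=> -[h g] /=; first by rewrite /op0 /graph_op /= => -> i /=; rewrite co0 mul0r.
by move=> hg; apply: co_ext => i; rewrite (hg i) mul0r co0.
Qed.

Lemma n2E (z : C) : (n2 z)%:C = z^*%C * z.
Proof. by case: z => a b; rewrite /n2; simpc; congr (_ +i* _); ring. Qed.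

(** For the form of a positive diagonal operator: the vectors h with h and a h
    square summable have a |h|^2 summable. *)
Lemma mul_le_sqr (a b : R) : 0 <= a -> 0 <= b -> a * b <= b + a ^+ 2 * b.
Proof.
move=> a0 b0; have := mulr_ge0 b0 (sqr_ge0 (a - 1)).
by have := mulr_ge0 a0 b0; rewrite expr2; lra.
Qed.

Lemma abs_sq_dg f : abs_sq (dg f) = dg (fun i => (n2 (f i))%:C).
Proof.
rewrite /abs_sq adj_dg; apply/seteqP; split=> -[h g] /=.
  by move=> [k hk kg] i; rewrite (kg i) (hk i) /= n2E mulrA.
move=> hg.
have l2k : l2 (fun i => f i * co h i).
  apply: asummable_le (asummableD (co_l2 h) (co_l2 g)) => k /=.
  rewrite ger0_norm ?n2_ge0 // (hg k) /= !n2M n2C.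
  by apply: mul_le_sqr; exact: n2_ge0.
exists (mk (fun i => f i * co h i)) => i /=; rewrite mkE //.
by rewrite (hg i) /= n2E mulrA.
Qed.

Lemma dg_inj f f' : dg f = dg f' -> f = f'.
Proof.
move=> ff; apply/funext => i; have := dg_basis f i; rewrite ff => /(_ i) /=.
by rewrite coZ basisE eqxx !mulr1.
Qed.

Lemma dg_self (g : nat -> R) : (forall i, 0 <= g i) ->
  positive_selfadjoint (dg (fun i => (g i)%:C)).
Proof.
move=> g0; split; first exact: dg_densely_closed.
  by rewrite adj_dg; congr dg; apply/funext => i; rewrite conjc_real.
move=> h k hk; rewrite dotHE.
rewrite (_ : (fun _ => _) = (fun i => (g i * n2 (co h i))%:C)); last first.
  apply/funext => i; rewrite (hk i) /= rmorphM /= n2E; ring.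
rewrite csum_real ler0c; apply: rsum_ge0 => [|i]; last by rewrite mulr_ge0 ?n2_ge0.
apply: asummable_le (asummableD (co_l2 h) (co_l2 k)) => i /=.
rewrite (hk i) /= n2M n2C ger0_norm ?mulr_ge0 ?n2_ge0 //.
by apply: mul_le_sqr; rewrite ?n2_ge0.
Qed.

(** A basis vector e is an eigenvector of r^2 for s^2, so v = r e - s e
    satisfies r v = - s v; since r is positive, v = 0.  By symmetry r is then
    contained in the diagonal operator, and a self-adjoint operator has no proper
    self-adjoint extension. *)
Lemma sqrt_dg_unique (g : nat -> R) r : (forall i, 0 <= g i) ->
  is_sqrt (dg (fun i => (g i ^+ 2)%:C)) r -> r = dg (fun i => (g i)%:C).
Proof.
move=> g0 [[[[r0 rlin] rfun _ _] radj rpos] rr].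
have rpos' h k : r (h, k) -> 0 <= Re (dot H k h).
  by move=> /rpos; rewrite lecE /= => /andP[].
have rsym u v h k : r (u, v) -> r (h, k) -> dot H v h = dot H u k.
  by move=> uv; rewrite -radj => /(_ _ _ uv).
have rb i : r (basis i, (g i)%:C *: basis i).
  have := dg_basis (fun i => (g i ^+ 2)%:C) i; rewrite -rr => -[v /= bv vb].
  have rv := rlin (- (g i)%:C) _ _ _ _ bv vb.
  pose w := v - (g i)%:C *: basis i.
  have rw : r (w, - (g i)%:C *: w).
    move: rv; congr (r (_, _)).
      by rewrite /w addrC scaleNr.
    rewrite /w scalerBr !scaleNr opprK scalerA; congr (_ + _ *: _).
    by rewrite rmorphXn expr2.
  suff w0 : w = 0.
    by move: w0 => /eqP; rewrite subr_eq0 => /eqP <-.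
  have [gi0|gi0] := eqVneq (g i) 0.
    have v0 : dot H v v = 0.
      rewrite (rsym _ _ _ _ bv vb) gi0 expr0n /= scale0r.
      by exact: linear0r.
    apply: (@sq_eq0); apply: complexI.
    by rewrite -sq_dot /w gi0 scale0r subr0.
  have := rpos' _ _ rw.
  have -> : dot H (- (g i)%:C *: w) w = - (g i)%:C * (sq w)%:C.
    by rewrite -sq_dot; exact: linearZl_LR.
  have -> : - (g i)%:C * (sq w)%:C = (- (g i * sq w))%:C.
    by rewrite mulNr -rmorphM -rmorphN.
  rewrite oppr_ge0 => gw.
  apply: (@sq_eq0); apply/eqP; rewrite eq_le sq_ge0 andbT.
  have gp : 0 < g i by rewrite lt_def gi0 g0.
  by rewrite -(pmulr_rle0 _ gp).
have sub : r `<=` dg (fun i => (g i)%:C).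
  move=> [h k] hk i /=; have := rsym _ _ _ _ hk (rb i).
  rewrite dot_basisr => ->.
  have -> : dot H h ((g i)%:C *: basis i) = ((g i)%:C)^*%C * dot H h (basis i).
    exact: linearZr_LR.
  by rewrite conjc_real dot_basisr.
apply/seteqP; split=> // hg hg1; suff : adj r hg by rewrite radj.
move=> u v uv.
have [_ sa _] := dg_self g0; move: hg1; rewrite -sa; apply.
exact: sub.
Qed.

Lemma sqrt_dg (g : nat -> R) : (forall i, 0 <= g i) ->
  is_sqrt (dg (fun i => (g i ^+ 2)%:C)) (dg (fun i => (g i)%:C)).
Proof.
move=> g0; split; first exact: dg_self.
have [_ sa _] := dg_self g0; rewrite -{1}sa -/(abs_sq _) abs_sq_dg.
by congr dg; apply/funext => i; rewrite n2C.
Qed.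

Lemma abs_dg f r : is_abs (dg f) r <-> r = dg (fun i => (Num.sqrt (n2 (f i)))%:C).
Proof.
rewrite /is_abs abs_sq_dg.
have -> : (fun i => (n2 (f i))%:C) = (fun i => (Num.sqrt (n2 (f i)) ^+ 2)%:C).
  by apply/funext => i; rewrite sqr_sqrtr ?n2_ge0.
split=> [/sqrt_dg_unique->//|->]; last by apply: sqrt_dg => i; exact: sqrtr_ge0.
Qed.

End DiagonalOperators.
Arguments basis {R H} _.
Arguments dg {R H} _.
Arguments bdd_ind {R} _.

(** * The von Neumann algebra of a partition of nat *)

Section DiagonalAlgebra.
Variables (R : realType) (H : l2_model R).
Local Notation C := R[i].
Local Notation Re := (@complex.Re R).
Local Notation Im := (@complex.Im R).
Implicit Types (h g : H) (f : nat -> C) (T S : H -> H).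

Lemma mulf_bounded f : bdd f -> bounded_op (mulf f : H -> H).
Proof.
move=> bf; have [B fB] := bf.
have lin : linear (mulf f : H -> H).
  by move=> a u v; apply: co_ext => i; rewrite coD coZ !mulfE // coD coZ; ring.
split=> // h; apply/cvgrPdist_lt => eC eC0.
have [e e0 eE] := posC_real eC0.
have B0 : 0 <= B by apply: le_trans (fB 0%N); exact: n2_ge0.
pose K := Num.sqrt (B + 1).
have K0 : 0 < K by rewrite sqrtr_gt0 ltr_wpDl.
apply/nbhs_ballP; exists (e / K)%:C => [|g]; first by rewrite /= ltcR divr_gt0.
rewrite nrm_ballE => hg; rewrite eE nrmE ltcR.
have -> : mulf f h - mulf f g = mulf f (h - g).
  by apply: co_ext => i; rewrite coB !mulfE // coB mulrBr.
apply: le_lt_trans (_ : _ <= K * nrm (h - g)) _; last by rewrite mulrC -ltr_pdivlMr.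
rewrite -sqrtrM ?addr_ge0 // ler_wsqrtr // -rsumZ; last exact: co_l2.
apply: rsum_le; [exact: co_l2|by apply: asummableZ; exact: co_l2|].
move=> k /=; rewrite mulfE // n2M ler_wpM2r ?n2_ge0 //.
by apply: le_trans (fB k) _; rewrite lerDl.
Qed.

Lemma rank1_bounded i j : bounded_op (fun h : H => co h i *: (basis j : H)).
Proof.
have lin : linear (fun h : H => co h i *: (basis j : H)).
  by move=> a u v; rewrite coD coZ scalerDl scalerA.
split=> // h; apply/cvgrPdist_lt => eC eC0.
apply/nbhs_ballP; exists eC => // g.
have [e e0 ->] := posC_real eC0.
rewrite nrm_ballE => hg; rewrite -scalerBl -coB normrZ nrmE.
rewrite nrm_basis.
by rewrite mulr1 normCn2 ltcR; exact: le_lt_trans (co_le _ _) hg.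
Qed.

Lemma linear0' T : linear T -> T 0 = 0.
Proof.
move=> lin; have := lin (-1) 0 0.
by rewrite scaler0 addr0 scaleN1r addNr.
Qed.
Lemma linearZ' T a h : linear T -> T (a *: h) = a *: T h.
Proof. by move=> lin; rewrite -[in LHS](addr0 (a *: h)) lin linear0' // addr0. Qed.

Lemma bounded_op_bdd T : bounded_op T -> bdd (fun i => co (T (basis i)) i).
Proof.
move=> [lin cT].
have T0 := linear0' lin.
have /cvgrPdist_lt/(_ 1 ltr01)/nbhs_ballP[eC /= eC0 eP] := cT 0.
have [e e0 eE] := posC_real eC0.
pose a := e / 2; have a0 : 0 < a by rewrite divr_gt0.
exists ((1 / a) ^+ 2) => i.
have nb := @nrm_basis R H i.
have : ball (0 : H) eC (a%:C *: basis i).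
  rewrite eE -ball_normE /ball_ /= sub0r normrN normrZ nrmE nb mulr1 normCn2 n2C.
  by rewrite ltcR sqrtr_sqr gtr0_norm // ltr_pdivrMr // ltr_pMr // ltr1n.
move=> /eP /=; rewrite T0 sub0r normrN.
rewrite linearZ' // nrmE ltcR => lt1.
have := le_lt_trans (co_le (a%:C *: T (basis i)) i) lt1.
rewrite coZ sqrtn2M n2C sqrtr_sqr gtr0_norm // => lt2.
rewrite -(sqr_sqrtr (n2_ge0 _)) ler_pXn2r ?nnegrE ?sqrtr_ge0 ?divr_ge0 // ?ltW //.
by rewrite ltr_pdivlMr // mulrC.
Qed.

(** Bounded sequences constant on the classes of the partition cls; the identity
    partition gives the whole algebra. *)
Definition diag_alg (cls : nat -> nat) : set (H -> H) :=
  [set T | exists f, [/\ bdd f, forall i j, cls i = cls j -> f i = f j & T = mulf f]].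

Lemma bddM f f' : bdd f -> bdd f' -> bdd (fun i => f i * f' i).
Proof.
move=> [B fB] [B' fB']; exists (B * B') => i.
by rewrite n2M ler_pM ?n2_ge0.
Qed.
Lemma bddD f f' : bdd f -> bdd f' -> bdd (fun i => f i + f' i).
Proof.
move=> [B fB] [B' fB']; exists (2 * B + 2 * B') => i.
by apply: le_trans (n2D _ _) _; rewrite lerD // ler_wpM2l.
Qed.
Lemma bddJ f : bdd f -> bdd (fun i => (f i)^*%C).
Proof.
move=> [B fB]; exists B => i; apply: le_trans (fB i).
by rewrite /n2; case: (f i) => a b /=; rewrite sqrrN.
Qed.
Lemma bdd_cst (c : C) : bdd (fun=> c). Proof. by exists (n2 c). Qed.

Lemma mulf_comp f f' : bdd f -> bdd f' ->
  (mulf f : H -> H) \o mulf f' = mulf (fun i => f i * f' i).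
Proof.
move=> bf bf'; apply/funext => h; apply: co_ext => i /=.
by rewrite !mulfE //; [ring|exact: bddM].
Qed.

Lemma mulf_basis f i : bdd f -> mulf f (basis i : H) = f i *: basis i.
Proof.
move=> bf; apply: co_ext => k; rewrite mulfE // coZ basisE.
by case: eqP => [->//|]; rewrite !mulr0.
Qed.

Lemma mulf_adj f : bdd f -> is_adjoint (mulf f : H -> H) (mulf (fun i => (f i)^*%C)).
Proof.
move=> bf h g; rewrite !dotHE; congr csum; apply/funext => k.
by rewrite !mulfE ?conjcM ?conjcK; [ring|exact: bddJ|].
Qed.

Lemma basis_scale h i : mulf (fun k => (k == i)%:R) h = co h i *: basis i.
Proof.
apply: co_ext => k; rewrite mulfE; last exact: (bdd_ind (fun k => k == i)).
by rewrite coZ basisE; case: eqP => [->|_]; rewrite ?mul1r ?mulr1 // mul0r mulr0.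
Qed.

Lemma commute_diag T : bounded_op T ->
  (forall i, T \o mulf (fun k => (k == i)%:R) = mulf (fun k => (k == i)%:R) \o T) ->
  T = mulf (fun i => co (T (basis i)) i).
Proof.
move=> bT Tc; apply/funext => h; apply: co_ext => i.
rewrite mulfE; last exact: bounded_op_bdd.
have := congr1 (fun S => co (S h) i) (Tc i); rewrite /= !basis_scale.
by rewrite (linearZ' _ _ (proj1 bT)) !coZ basisE eqxx mulr1 mulrC => <-.
Qed.

(** The bicommutant commutes with the diagonal, hence is diagonal; it also
    commutes with the rank one operators sending a point to another of its class,
    which makes its symbol constant on classes. *)
Lemma diag_alg_vna cls : von_neumann_algebra (diag_alg cls).
Proof.
split.
- by move=> T [f [bf _ ->]]; exact: mulf_bounded.
- move=> T [f [bf fc ->]]; exists (mulf (fun i => (f i)^*%C)); last exact: mulf_adj.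
  by exists (fun i => (f i)^*%C); split=> //; [exact: bddJ|move=> i j /fc ->].
apply/seteqP; split=> T; last first.
  move=> AT; have [f [bf _ Tf]] := AT; split; first by rewrite Tf; exact: mulf_bounded.
  by move=> S [_ SA]; rewrite SA.
move=> [bT Tc]; have diag : T = mulf (fun i => co (T (basis i)) i).
  apply: commute_diag => // i; apply: Tc; split.
    by apply: mulf_bounded; exact: (bdd_ind (fun k => k == i)).
  move=> S [f [bf _ ->]].
  have bi := @bdd_ind R (fun k => k == i).
  rewrite !mulf_comp //.
  by congr mulf; apply/funext => k; rewrite mulrC.
exists (fun i => co (T (basis i)) i); split=> //; first exact: bounded_op_bdd.
move=> i j ij.
pose S0 (h : H) : H := co h i *: basis j.
have : T \o S0 = S0 \o T.
  apply: Tc; split; first exact: rank1_bounded.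
  move=> S [f [bf fc ->]]; apply/funext => h /=; apply: co_ext => k.
  rewrite /S0 coZ mulfE // mulfE // coZ basisE.
  by case: eqP => [->|_]; rewrite ?mulr1 ?(fc _ _ ij) // !mulr0.
move=> /(congr1 (fun S => co (S (basis i)) j)) /=.
by rewrite /S0 (linearZ' _ _ (proj1 bT)) !coZ !basisE !eqxx mulr1 mul1r => <-.
Qed.

Lemma positive_mulf f : bdd f ->
  positive_op (mulf f : H -> H) <-> forall i, 0 <= f i.
Proof.
move=> bf; split=> [P i|f0 h].
  have := P (basis i); rewrite mulf_basis //.
  have -> : dot H (f i *: basis i) (basis i) = f i * dot H (basis i) (basis i).
    exact: linearZl_LR.
  by rewrite dot_basisr basisE eqxx mulr1.
have fr i : f i = (Re (f i))%:C.
  by have := f0 i; rewrite lecE /=; case: (f i) => a b /= /andP[/eqP ->].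
rewrite dotHE (_ : (fun _ => _) = (fun i => (Re (f i) * n2 (co h i))%:C)); last first.
  by apply/funext => i; rewrite mulfE // {1}fr rmorphM /= n2E; ring.
have f0' i : 0 <= Re (f i) by rewrite -ler0c -fr.
rewrite csum_real ler0c; apply: rsum_ge0 => [|i]; last by rewrite mulr_ge0 ?n2_ge0.
apply: asummable_le (asummableD (co_l2 h) (co_l2 (mulf f h))) => i /=.
rewrite mulfE // n2M {2}fr n2C ger0_norm ?mulr_ge0 ?n2_ge0 //.
by apply: mul_le_sqr; rewrite ?n2_ge0.
Qed.

Lemma op_le_mulf f f' : bdd f -> bdd f' ->
  op_le (mulf f : H -> H) (mulf f') <-> forall i, f i <= f' i.
Proof.
move=> bf bf'.
have bd : bdd (fun i => f' i - f i).
  have := bddD bf' (bddM (bdd_cst (-1)) bf); congr bdd.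
  by apply/funext => i; rewrite mulN1r.
have -> : op_le (mulf f : H -> H) (mulf f') <-> positive_op (mulf (fun i => f' i - f i) : H -> H).
  have E h : dot H (mulf (fun i => f' i - f i) h) h =
      dot H (mulf f' h) h - dot H (mulf f h) h.
    have -> : mulf (fun i => f' i - f i) h = mulf f' h - mulf f h.
      by apply: co_ext => i; rewrite coB !mulfE // mulrBl.
    exact: linearBl.
  by split=> P h; have := P h; rewrite E subr_ge0.
rewrite positive_mulf //; split=> P i; have := P i; by rewrite subr_ge0.
Qed.

End DiagonalAlgebra.

(** * The trace given by a probability weight *)

Section DiagonalTrace.
Variables (R : realType) (H : l2_model R).
Local Notation C := R[i].
Local Notation Re := (@complex.Re R).
Local Notation Im := (@complex.Im R).
Variable w : nat -> R.
Hypothesis w_gt0 : forall i, 0 < w i.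
Hypothesis w_sum : asummable w.
Hypothesis w_1 : rsum w = 1.
Implicit Types (f : nat -> C) (T S : H -> H).

Definition dtr T : C := csum (fun i => (w i)%:C * co (T (basis i)) i).

Lemma csummable_w f : bdd f -> csummable (fun i => (w i)%:C * f i).
Proof.
move=> [B fB]; apply: (@csummable_bound _ _ (fun i => (w i * Num.sqrt B)%:C)).
  have B0 : 0 <= B by apply: le_trans (fB 0%N); exact: n2_ge0.
  move=> k; rewrite n2M !n2C exprMn sqr_sqrtr // ler_wpM2l // ?sqr_ge0 //.
apply: eq_asummable (asummableZ (Num.sqrt B) w_sum) => k.
by rewrite n2C sqrtr_sqr ger0_norm ?mulr_ge0 ?sqrtr_ge0 ?ltW // mulrC.
Qed.

Lemma dtr_mulf f : bdd f -> dtr (mulf f) = csum (fun i => (w i)%:C * f i).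
Proof.
move=> bf; congr csum; apply/funext => i.
by rewrite mulf_basis // coZ basisE eqxx mulr1.
Qed.

Lemma mulf_pos_real f : (forall i, 0 <= f i) ->
  exists2 r : nat -> R, (forall i, 0 <= r i) & f = (fun i => (r i)%:C).
Proof.
move=> f0; exists (Re \o f) => [i|]; first by have := f0 i; rewrite lecE => /andP[].
apply/funext => i /=; have := f0 i; rewrite lecE /=.
by case: (f i) => a b /= /andP[/eqP ->].
Qed.

Lemma asummable_wr (r : nat -> R) : bdd (fun i => (r i)%:C) -> asummable (fun i => w i * r i).
Proof.
move=> /csummable_w [+ _]; apply: eq_asummable => i /=.
by rewrite mul0r subr0.
Qed.

Lemma dtr_real (r : nat -> R) : bdd (fun i => (r i)%:C) ->
  dtr (mulf (fun i => (r i)%:C)) = (rsum (fun i => w i * r i))%:C.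
Proof.
move=> br; rewrite dtr_mulf // -csum_real; congr csum; apply/funext => i.
by rewrite rmorphM.
Qed.

Definition dM := diag_alg (H := H) id.

Lemma dM_mulf f : bdd f -> dM (mulf f).
Proof. by move=> bf; exists f; split=> // i j ->. Qed.

Lemma dtr_linear (c : C) S T : dM S -> dM T ->
  dtr (fun h => c *: S h + T h) = c * dtr S + dtr T.
Proof.
move=> [f [bf _ ->]] [f' [bf' _ ->]].
have -> : (fun h : H => c *: mulf f h + mulf f' h) = mulf (fun i => c * f i + f' i).
  apply/funext => h; apply: co_ext => i; rewrite coD coZ !mulfE //; first ring.
  by apply: bddD => //; apply: bddM => //; exact: bdd_cst.
rewrite !dtr_mulf //; last by apply: bddD => //; apply: bddM => //; exact: bdd_cst.
rewrite -csumZ; last exact: csummable_w.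
rewrite -csumD; [|by apply: csummableZ; exact: csummable_w|exact: csummable_w].
by congr csum; apply/funext => i; ring.
Qed.

Lemma dtr_cyclic S T : dM S -> dM T -> dtr (S \o T) = dtr (T \o S).
Proof.
move=> [f [bf _ ->]] [f' [bf' _ ->]]; rewrite !mulf_comp //.
by congr (dtr (mulf _)); apply/funext => i; rewrite mulrC.
Qed.

Lemma dtr_pos T : dM T -> positive_op T -> 0 <= dtr T.
Proof.
move=> [f [bf _ ->]]; rewrite positive_mulf // => /mulf_pos_real[r r0 fr].
rewrite fr in bf *; rewrite dtr_real // ler0c; apply: rsum_ge0 => [|i].
  exact: asummable_wr.
by rewrite mulr_ge0 // ltW.
Qed.

Lemma dtr_faithful T : dM T -> positive_op T -> dtr T = 0 -> T = (fun=> 0).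
Proof.
move=> [f [bf _ ->]]; rewrite positive_mulf // => /mulf_pos_real[r r0 fr].
rewrite fr in bf *; rewrite dtr_real // => -[] wr0.
have r_0 i : r i = 0.
  have := rsum_eq0 (asummable_wr bf) (fun i => mulr_ge0 (ltW (w_gt0 i)) (r0 i)) wr0 i.
  by move=> /eqP; rewrite mulf_eq0 gt_eqF //= => /eqP.
by apply/funext => h; apply: co_ext => i; rewrite mulfE // r_0 mul0r co0.
Qed.

Lemma dtr_unit : dtr id = 1.
Proof.
have -> : (id : H -> H) = mulf (fun=> (1 : R)%:C).
  apply/funext => h; apply: co_ext => i; rewrite mulfE ?mul1r //.
  exact: bdd_cst.
rewrite dtr_real; last exact: bdd_cst.
by rewrite (_ : (fun i => _) = w) ?w_1 //; apply/funext => i; rewrite mulr1.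
Qed.

Lemma directed_fin (D : set (H -> H)) (N : nat) (S : nat -> H -> H) :
  D !=set0 ->
  (forall S S', D S -> D S' -> exists V, [/\ D V, op_le S V & op_le S' V]) ->
  (forall i, D (S i)) -> exists2 V, D V & forall i, (i < N)%N -> op_le (S i) V.
Proof.
move=> [S0 DS0] Ddir DS; elim: N => [|N [V DV VS]]; first by exists S0.
have [V' [DV' VV' SV']] := Ddir _ _ DV (DS N).
exists V' => // i; rewrite ltnS leq_eqVlt => /predU1P[->//|iN] h.
exact: le_trans (VS i iN h) (VV' h).
Qed.

(** The least upper bound of a bounded set of diagonal operators is taken
    coordinatewise, so it suffices to approximate finitely many coordinates by
    one element of the directed set. *)
Lemma dtr_normal (D : set (H -> H)) T :
  D !=set0 -> (forall S, D S -> dM S /\ positive_op S) ->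
  (forall S S', D S -> D S' -> exists V, [/\ D V, op_le S V & op_le S' V]) ->
  dM T -> (forall S, D S -> op_le S T) ->
  (forall V, dM V -> (forall S, D S -> op_le S V) -> op_le T V) ->
  Re (dtr T) = sup [set Re (dtr S) | S in D].
Proof.
move=> D0 Dpos Ddir [f [bf _ ->]] DT Tlub.
pose sy S i := Re (co (S (basis i)) i).
have symb S : D S -> [/\ bdd (fun i => (sy S i)%:C), forall i, 0 <= sy S i &
    S = mulf (fun i => (sy S i)%:C)].
  move=> /Dpos[[f' [bf' _ Sf']]]; rewrite Sf' positive_mulf // => /mulf_pos_real[r r0 fr].
  have -> : sy (mulf f') = r.
    apply/funext => i; rewrite /sy mulf_basis // coZ basisE eqxx mulr1 fr //.
  by rewrite -fr.
have [S0 DS0] := D0.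
have f_ge0 : forall i, 0 <= f i.
  have [b0 p0 e0] := symb _ DS0; have := DT _ DS0; rewrite e0 op_le_mulf // => le i.
  by apply: le_trans (le i); rewrite ler0c.
have [r r0 fr] := mulf_pos_real f_ge0; rewrite {}fr in bf DT Tlub *; move: f_ge0 => _.
have le_r S i : D S -> sy S i <= r i.
  move=> DS; have [b0 p0 e0] := symb _ DS; have := DT _ DS.
  by rewrite {1}e0 op_le_mulf // => /(_ i); rewrite lecR.
pose F i := sup [set sy S i | S in D].
have hsF i : has_sup [set sy S i | S in D].
  split; first by exists (sy S0 i); exists S0.
  by exists (r i) => _ [S DS <-]; exact: le_r.
have F_ge S i : D S -> sy S i <= F i.
  by move=> DS; apply: ub_le_sup; [exact: (proj2 (hsF i))|exists S].
have F_ge0 i : 0 <= F i by apply: le_trans (F_ge S0 i DS0); have [_ + _] := symb _ DS0.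
have F_le i : F i <= r i.
  by apply: ge_sup; [exact: (proj1 (hsF i))|move=> _ [S DS <-]; exact: le_r].
have bF : bdd (fun i => (F i)%:C).
  have [B rB] := bf; exists B => i; apply: le_trans (rB i).
  by rewrite !n2C ler_pXn2r ?nnegrE.
have r_le i : r i <= F i.
  have := Tlub _ (dM_mulf bF); rewrite op_le_mulf // => H0.
  have := H0 _ i; rewrite lecR; apply=> S DS.
  by have [b0 p0 e0] := symb _ DS; rewrite e0 op_le_mulf // => j; rewrite lecR F_ge.
have rF i : r i = F i by apply/eqP; rewrite eq_le r_le F_le.
have trS S : D S -> Re (dtr S) = rsum (fun i => w i * sy S i).
  by move=> DS; have [b0 p0 e0] := symb _ DS; rewrite {1}e0 dtr_real.
rewrite dtr_real //=.
have swr := asummable_wr bf.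
have ubS : ubound [set Re (dtr S) | S in D] (rsum (fun i => w i * r i)).
  move=> _ [S DS <-]; rewrite trS //; apply: rsum_le => //.
    by apply: asummable_wr; have [] := symb _ DS.
  by move=> k; rewrite ler_pM2l //; exact: le_r.
apply/eqP; rewrite eq_le; apply/andP; split; last first.
  by apply: ge_sup => //; exists (Re (dtr S0)); exists S0.
apply/ler_addgt0Pr => e e0.
apply: rsum_le_bound => // n.
have pick i : exists S, D S /\ r i - e <= sy S i.
  have [_ [S DS <-] lt] := sup_adherent e0 (hsF i).
  by exists S; split=> //; rewrite rF ltW.
have [S SP] := choice pick.
(* A single element of D nearly attains the supremum on the first n coordinates. *)
have [V DV VS] := directed_fin n D0 Ddir (fun i => proj1 (SP i)).
have [bV V0 eV] := symb _ DV.
apply: (@le_trans _ _ (Re (dtr V) + e)); last first.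
  by rewrite lerD2r; apply: ub_le_sup; [eexists; exact: ubS|exists V].
rewrite trS // -[e in leRHS]mul1r -w_1 mulrC -rsumZ // -rsumD; [|exact: asummable_wr|exact: asummableZ].
have sV : asummable (fun k => w k * sy V k + e * w k).
  by apply: asummableD; [exact: asummable_wr|exact: asummableZ].
have ge0 k : 0 <= w k * sy V k + e * w k.
  by rewrite addr_ge0 ?mulr_ge0 // ?ltW.
apply: le_trans (rsum_ge_part n sV ge0); apply: ler_sum => k _.
rewrite (mulrC e) -mulrDr ler_pM2l // -lerBlDr.
apply: le_trans (proj2 (SP k)) _.
have [bS S0' eS] := symb _ (proj1 (SP k)).
have := VS k (ltn_ord k); rewrite eV eS op_le_mulf // => /(_ k); rewrite lecR.
by rewrite -eS -eV.
Qed.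

Definition diag_vna : finite_vna R :=
  @FiniteVNA R H dM dtr (diag_alg_vna H id) dtr_linear dtr_cyclic dtr_pos
    dtr_faithful dtr_normal dtr_unit.

End DiagonalTrace.

(** * Spectral measures of diagonal operators *)

Section NonnegSeries.
Variable R : realType.
Implicit Types (u : nat -> R).

Lemma nneseries_rsum u : asummable u ->
  (\sum_(0 <= i <oo) (u i)%:E = (rsum u)%:E)%E.
Proof.
move=> su; rewrite /rsum -EFin_lim; last exact: asummable_cvg.
by congr (limn _); apply/funext => n /=; rewrite -sumEFin.
Qed.

Lemma nneseries_asummable u : (forall i, 0 <= u i) ->
  (\sum_(0 <= i <oo) (u i)%:E < +oo)%E -> asummable u.
Proof.
move=> u0; have sge0 : (0 <= \sum_(0 <= i <oo) (u i)%:E)%E.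
  by apply: nneseries_ge0 => i _ _; rewrite lee_fin.
case E : (\sum_(0 <= i <oo) (u i)%:E)%E sge0 => [r| |] // _ _.
exists r => n; under eq_bigr do rewrite ger0_norm //.
rewrite -lee_fin -E -sumEFin -(big_mkord xpredT (fun i => (u i)%:E)).
by apply: nneseries_lim_ge => i _; rewrite lee_fin.
Qed.
End NonnegSeries.

Section SpectralDiagonal.
Variables (R : realType) (H : l2_model R).
Local Notation C := R[i].
Local Notation Re := (@complex.Re R).
Variable a : nat -> R.
Hypothesis a_ge0 : forall i, 0 <= a i.
Implicit Types (h g : H) (B : set R).

Definition spec_proj (B : set R) : H -> H := mulf (fun i => (a i \in B)%:R).
Lemma bdd_spec B : bdd (fun i => (a i \in B)%:R : C).
Proof. exact: (bdd_ind (fun i => a i \in B)). Qed.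

Definition spec_atom (h : H) (i : nat) : {measure set R -> \bar R} :=
  mscale (NngNum (n2_ge0 (co h i))) (\d_(a i)).
Definition spec_nu (h : H) : {measure set R -> \bar R} := mseries (spec_atom h) 0.

Lemma spec_nu_int h (g : R -> R) : (forall s, 0 <= g s) -> measurable_fun setT g ->
  (\int[spec_nu h]_s (g s)%:E = \sum_(0 <= i <oo) (n2 (co h i) * g (a i))%:E)%E.
Proof.
move=> g0 mg; rewrite ge0_integral_measure_series //; last 2 first.
- by move=> t _; rewrite lee_fin.
- exact/measurable_EFinP.
apply: eq_eseriesr => i _.
rewrite ge0_integral_mscale //; last 2 first.
- exact/measurable_EFinP.
- by move=> x _; rewrite lee_fin.
rewrite integral_dirac //; last exact/measurable_EFinP.
by rewrite diracT mul1e.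
Qed.

(** The spectral measure of a diagonal operator is atomic: h has mass
    |h_i|^2 at the i-th eigenvalue. *)
Lemma spec_exists : spectral_measure (dg (fun i => (a i)%:C) : op H) spec_proj.
Proof.
split.
- move=> B mB; split; first by apply: mulf_bounded; exact: bdd_spec.
    have := mulf_adj (H := H) (bdd_spec B); congr is_adjoint.
    by congr mulf; apply/funext => i; rewrite conjc_nat.
  move=> h; apply: co_ext => i; rewrite !mulfE; try exact: bdd_spec.
  by case: (_ \in _); rewrite ?mul1r ?mul0r.
- apply/funext => h; apply: co_ext => i; rewrite mulfE; last exact: bdd_spec.
  by rewrite mem_set // mul1r.
exists spec_nu; split.
- move=> h B mB.
  have <- : (\int[spec_nu h]_s (\1_B s)%:E)%E = spec_nu h B.
    by rewrite integral_indic // setIT.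
  rewrite spec_nu_int //.
  have E i : co (spec_proj B h) i = (a i \in B)%:R * co h i.
    by rewrite mulfE //; exact: bdd_spec.
  rewrite dotHE (_ : (fun k => _) = (fun k => (n2 (co h k) * \1_B (a k))%:C)).
    rewrite csum_real /= nneseries_rsum //.
    apply: asummable_le (co_l2 h) => k /=; rewrite ger0_norm ?mulr_ge0 ?n2_ge0 //.
    by rewrite ler_piMr ?n2_ge0 // indicE; case: (_ \in _).
  apply/funext => k; rewrite E rmorphM /= n2E indicE.
  by case: (_ \in _) => /=; ring.
- move=> h; rewrite spec_nu_int; [|by move=> s; exact: sqr_ge0|exact: exprn_measurable].
  have sqge0 i : 0 <= n2 (co h i) * a i ^+ 2 by rewrite mulr_ge0 ?n2_ge0 ?sqr_ge0.
  split=> [[g hg]|/(nneseries_asummable sqge0) hs].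
    rewrite nneseries_rsum ?ltry //.
    apply: asummable_le (co_l2 g) => k /=; rewrite ger0_norm // (hg k) /=.
    by rewrite n2M n2C mulrC.
  exists (mk (fun i => (a i)%:C * co h i)) => i /=; rewrite mkE //.
  apply: asummable_le hs => k /=.
  by rewrite ger0_norm ?n2_ge0 // n2M n2C mulrC.
move=> h g hg; rewrite dotHE.
have sm : asummable (fun i => n2 (co h i) * a i).
  apply: asummable_le (asummableD (co_l2 h) (co_l2 g)) => i /=.
  rewrite (hg i) /= n2M n2C ger0_norm ?mulr_ge0 ?n2_ge0 //.
  by rewrite mulrC mul_le_sqr ?n2_ge0.
rewrite (_ : (fun k => _) = (fun k => (n2 (co h k) * a k)%:C)); last first.
  by apply/funext => k; rewrite (hg k) /= rmorphM /= n2E; ring.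
rewrite csum_real; congr (_ %:C); rewrite /Rintegral integralE.
have mid : measurable_fun setT (id : R -> R) by exact: measurable_id.
have pE s : ((EFin \o (id : R -> R))^\+ s = (Num.max s 0)%:E)%E.
  by rewrite funeposE /= EFin_max.
have nE s : ((EFin \o (id : R -> R))^\- s = (Num.max (- s) 0)%:E)%E.
  by rewrite funenegE /= EFin_max.
rewrite (eq_integral _ _ (fun s _ => pE s)) (eq_integral _ _ (fun s _ => nE s)).
rewrite !spec_nu_int; try by (move=> s; rewrite le_max lexx orbT).
- rewrite [X in (_ - X)%E]eseries0 ?sube0; last first.
    by move=> i _ _; rewrite /= max_r ?mulr0 // oppr_le0.
  under eq_eseriesr => i _ do rewrite max_l //.
  by rewrite nneseries_rsum.
- by apply: measurable_maxr => //; exact: measurableT_comp.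
- exact: measurable_maxr.
Qed.

End SpectralDiagonal.

Section SpectralUnique.
Variables (R : realType) (H : l2_model R).
Local Notation C := R[i].
Local Notation Re := (@complex.Re R).
Implicit Types (h g u v : H) (B : set R).

Lemma dDl u v h : dot H (u + v) h = dot H u h + dot H v h. Proof. exact: linearDl. Qed.
Lemma dDr u v h : dot H h (u + v) = dot H h u + dot H h v. Proof. exact: linearDr. Qed.
Lemma dZl (c : C) u h : dot H (c *: u) h = c * dot H u h. Proof. exact: linearZl_LR. Qed.
Lemma dC u v : dot H u v = (dot H v u)^*%C.
Proof.
rewrite !dotHE -csumJ; last by apply: csummable_dot; exact: co_l2.
by congr csum; apply/funext => k; rewrite conjcM conjcK mulrC.
Qed.
Lemma Re_conj (z : C) : Re z^*%C = Re z. Proof. by case: z. Qed.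
Lemma ReD (z z' : C) : Re (z + z') = Re z + Re z'. Proof. by case: z z' => ? ? []. Qed.

(** Polarization at h and D h. *)
Lemma sym_form0 (D : H -> H) : linear D -> is_adjoint D D ->
  (forall h, Re (dot H (D h) h) = 0) -> forall h, D h = 0.
Proof.
move=> lD aD D0 h; apply: sq_eq0.
have DD x y : D (x + y) = D x + D y by have := lD 1 x y; rewrite !scale1r.
have := D0 (h + D h); rewrite DD dDl !dDr !ReD !D0 add0r addr0.
rewrite [dot H (D (D h)) h]aD !sq_dot /=; lra.
Qed.

Variables (a : op H) (P : set R -> H -> H).
Variable nu : H -> {measure set R -> \bar R}.
Hypothesis Pproj : forall B, measurable B -> projection_op (P B).
Hypothesis PT : P setT = id.
Hypothesis nuP : forall h B, measurable B -> nu h B = (Re (dot H (P B h) h))%:E.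

Lemma P_sq h B : measurable B -> nu h B = (sq (P B h))%:E.
Proof.
move=> mB; rewrite nuP //; have [_ aB idB] := Pproj mB.
by rewrite -{1}idB aB sq_dot.
Qed.

Lemma P_lin B : measurable B -> linear (P B).
Proof. by move=> mB; have [[]] := Pproj mB. Qed.

Lemma P_add B1 B2 h : measurable B1 -> measurable B2 -> [disjoint B1 & B2] ->
  P (B1 `|` B2) h = P B1 h + P B2 h.
Proof.
move=> m1 m2 d12; have m12 := measurableU _ _ m1 m2.
have [_ a1 _] := Pproj m1; have [_ a2 _] := Pproj m2; have [_ a12 _] := Pproj m12.
pose D x := P (B1 `|` B2) x + ((-1) *: P B1 x + (-1) *: P B2 x).
have dN (x y : H) : dot H x (-1 *: y) = - dot H x y.
  by rewrite dC dZl mulN1r raddfN /= -dC.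
suff : D h = 0 by rewrite /D !scaleN1r -opprD => /subr0_eq.
apply: sym_form0 => [c x y|x y|x]; rewrite /D.
- by rewrite !P_lin //; apply: co_ext => i; rewrite !(coD, coZ); ring.
- by rewrite !dDl !dDr !dZl !dN a1 a2 a12 !mulN1r.
rewrite !dDl !dZl !ReD !mulN1r.
have RN (z : C) : Re (- z) = - Re z by case: z.
rewrite !RN.
have : nu x (B1 `|` B2) = (nu x B1 + nu x B2)%E.
  by apply: measureU => //; exact/disj_set2P.
rewrite !nuP // -EFinD => -[->]; lra.
Qed.

Lemma P_contr B h : measurable B -> sq (P B h) <= sq h.
Proof.
move=> mB; rewrite -lee_fin -P_sq // (_ : sq h = sq (P setT h)); last by rewrite PT.
by rewrite -P_sq //; apply: le_measure; rewrite ?inE.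
Qed.

Lemma P_disj B1 B2 h : measurable B1 -> measurable B2 -> [disjoint B1 & B2] ->
  P B1 (P B2 h) = 0.
Proof.
move=> m1 m2 d12; apply: sq_eq0; apply/eqP; rewrite eq_le sq_ge0 andbT.
have m12 := measurableU _ _ m1 m2.
have := P_contr (P B2 h) m12.
set u := P B2 h; have : nu u (B1 `|` B2) = (nu u B1 + nu u B2)%E.
  by apply: measureU => //; exact/disj_set2P.
have [_ _ id2] := Pproj m2; rewrite !P_sq // /u id2 -EFinD => -[->]; lra.
Qed.

(** The scalar measures only give additivity; multiplicativity follows because two
    projections whose sum is a projection are orthogonal. *)
Lemma P_int B1 B2 h : measurable B1 -> measurable B2 ->
  P B1 (P B2 h) = P (B1 `&` B2) h.
Proof.
move=> m1 m2; have mI := measurableI _ _ m1 m2.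
have mD1 := measurableD m1 m2; have mD2 := measurableD m2 m1.
have d1 : [disjoint B1 `&` B2 & B1 `\` B2].
  by apply/disj_setPS => x [[_ ?] [_ ?]].
have d2 : [disjoint B2 `&` B1 & B2 `\` B1].
  by apply/disj_setPS => x [[_ ?] [_ ?]].
have d3 : [disjoint B1 `\` B2 & B2].
  by apply/disj_setPS => x [[_ ?] ?].
have d4 : [disjoint B1 `&` B2 & B2 `\` B1].
  by apply/disj_setPS => x [[? _] [_ ?]].
have {1}-> : B1 = (B1 `&` B2) `|` (B1 `\` B2) by rewrite setUIDK.
rewrite P_add // (P_disj _ mD1 m2 d3) addr0.
have {2}-> : B2 = (B2 `&` B1) `|` (B2 `\` B1) by rewrite setUIDK.
rewrite P_add //; last by rewrite setIC.
have [_ _ idI] := Pproj mI.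
have -> x y : P (B1 `&` B2) (x + y) = P (B1 `&` B2) x + P (B1 `&` B2) y.
  by have := P_lin mI 1 x y; rewrite !scale1r.
by rewrite (P_disj _ mI mD2 d4) addr0 (setIC B2) idI.
Qed.

Lemma nu_P B1 B2 h : measurable B1 -> measurable B2 ->
  nu (P B2 h) B1 = nu h (B1 `&` B2).
Proof. by move=> m1 m2; rewrite !P_sq ?P_int //; exact: measurableI. Qed.

Hypothesis nu_dom : forall h, (exists g, a (h, g)) <->
  (\int[nu h]_s (s ^+ 2)%:E < +oo)%E.
Hypothesis nu_form : forall h g, a (h, g) -> dot H g h = (\int[nu h]_s s)%:C.

Lemma P_setC B h : measurable B -> h = P B h + P (~` B) h.
Proof.
move=> mB; rewrite -P_add //; [by rewrite setUv PT|exact: measurableC|].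
by rewrite disj_set2E setICr.
Qed.

Lemma nu_split B h : measurable B ->
  forall D, measurable D -> nu h D = measure_add (nu (P B h)) (nu (P (~` B) h)) D.
Proof.
move=> mB D mD; have mC := measurableC mB.
rewrite measure_addE !nu_P // -measureU; [|exact: measurableI..|].
  by rewrite -setIUr setUv setIT.
by rewrite setIACA setICr setI0.
Qed.

Lemma nu_dom_split B h : measurable B -> (exists g, a (h, g)) ->
  (exists g, a (P B h, g)) /\ (exists g, a (P (~` B) h, g)).
Proof.
move=> mB /nu_dom; rewrite (eq_measure_integral _ (fun D mD _ => nu_split h mB mD)).
rewrite ge0_integral_measure_add //; last 2 first.
- by move=> x _; rewrite lee_fin sqr_ge0.
- by apply/measurable_EFinP; exact: exprn_measurable.
have p h' : (0 <= \int[nu h']_s (s ^+ 2)%:E)%E.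
  by apply: integral_ge0 => x _; rewrite lee_fin sqr_ge0.
rewrite !nu_dom => lt; split; apply: le_lt_trans lt.
  by rewrite leeDl.
by rewrite leeDr.
Qed.

Lemma nu_integrable h : (exists g, a (h, g)) ->
  (nu h).-integrable setT (EFin \o (id : R -> R)).
Proof.
move=> /nu_dom fin; apply/integrableP; split; first exact/measurable_EFinP/measurable_id.
apply: (@le_lt_trans _ _ (\int[nu h]_s (1%:E + (s ^+ 2)%:E))%E).
  apply: ge0_le_integral => //.
  - by apply/measurable_EFinP; exact: (@normr_measurable R setT).
  - by apply: emeasurable_funD => //; apply/measurable_EFinP; exact: exprn_measurable.
  move=> x _ /=; rewrite -EFinD lee_fin.
  have := sqr_ge0 (x - 1); have := sqr_ge0 (x + 1); rewrite ler_norml; nra.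
rewrite ge0_integralD //; last 2 first.
- by move=> x _; rewrite lee_fin sqr_ge0.
- by apply/measurable_EFinP; exact: exprn_measurable.
rewrite integral_cst // mul1e lte_add_pinfty //.
by rewrite P_sq // ltry.
Qed.

Lemma form_split B h g g1 g2 : measurable B -> a (h, g) -> a (P B h, g1) ->
  a (P (~` B) h, g2) ->
  Re (dot H g h) = Re (dot H g1 (P B h)) + Re (dot H g2 (P (~` B) h)).
Proof.
move=> mB hg hg1 hg2; rewrite !nu_form //= /Rintegral.
rewrite (eq_measure_integral _ (fun D mD _ => nu_split h mB mD)).
have i1 : (nu (P B h)).-integrable setT (EFin \o (id : R -> R)) by apply: nu_integrable; exists g1.
have i2 : (nu (P (~` B) h)).-integrable setT (EFin \o (id : R -> R)) by apply: nu_integrable; exists g2.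
by rewrite integral_measure_add // fineD //; exact: integrable_fin_num.
Qed.

Variable al : nat -> R.
Hypothesis a_dg : a = dg (fun i => (al i)%:C).

(** If e is an eigenvector for lam, the spectral measure of u = P B e is
    carried by B and has mean lam, because the cross terms between u and
    e - u cancel.  When B lies on one side of lam this measure vanishes. *)
Lemma P_basis0 B i : measurable B ->
  (forall s, B s -> al i < s) \/ (forall s, B s -> s < al i) -> P B (basis i) = 0.
Proof.
move=> mB Bal; set e : H := basis i; set lam := al i.
have mC := measurableC mB.
have dom_e : a (e, lam%:C *: e) by rewrite a_dg; exact: dg_basis.
have [[g1 hg1] [g2 hg2]] := nu_dom_split mB (ex_intro _ _ dom_e).
have := form_split mB dom_e hg1 hg2.
set u := P B e in hg1 *; set u' := P (~` B) e in hg2 *.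
have eu : e = u + u' by exact: P_setC.
(* Symmetry of a, which makes the cross terms equal. *)
have sym x y x' y' : a (x, y) -> a (x', y') -> dot H y x' = dot H x y'.
  rewrite a_dg => xy xy'; rewrite !dotHE; congr csum; apply/funext => k.
  by rewrite (xy k) (xy' k) /= conjcM conjc_real; ring.
have g12 : lam%:C *: e = g1 + g2.
  rewrite a_dg in dom_e hg1 hg2; apply: co_ext => k.
  by rewrite (dom_e k) coD (hg1 k) (hg2 k) /= -mulrDr -coD -eu.
have RlC (z : C) : Re (lam%:C * z) = lam * Re z by case: z => x y /=; rewrite mul0r subr0.
have ort : Re (dot H u u') = 0.
  have [_ aB _] := Pproj mB; rewrite /u aB /u' P_disj ?linear0r //.
  by rewrite disj_set2E setICr.
rewrite g12 {1}eu !dDl !dDr !ReD => cross.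
have e1 : Re (dot H (lam%:C *: e) u) = lam * sq u.
  by rewrite dZl eu dDl RlC ReD sq_dot (dC u' u) Re_conj ort addr0.
have cr : Re (dot H g2 u) = Re (dot H g1 u').
  by rewrite (sym _ _ _ _ hg2 hg1) dC Re_conj.
have key : Re (dot H g1 u) = lam * sq u.
  by rewrite -e1 g12 dDl ReD; move: cross cr; lra.
have int_u : (nu u).-integrable setT (EFin \o (id : R -> R)) by apply: nu_integrable; exists g1.
move: key; rewrite nu_form //= => key.
have nuC : nu u (~` B) = 0%E by rewrite /u nu_P // setICl measure0.
have nuT : nu u setT = (sq u)%:E by rewrite P_sq // PT.
have nuB : nu u B = (sq u)%:E.
  have : nu u (B `|` ~` B) = (nu u B + nu u (~` B))%E.
    by apply: measureU => //; rewrite setICr.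
  by rewrite setUv nuT nuC adde0.
have cst_int : (nu u).-integrable setT (EFin \o (cst lam : R -> R)).
  apply/integrableP; split; first exact/measurable_EFinP/measurable_cst.
  have := @integral_cst _ _ _ (nu u) setT measurableT (`|lam|%:E).
  by rewrite nuT -EFinM => ->; exact: ltry.
have mdiff : measurable_fun setT (fun s : R => s - lam) by exact: measurable_funB.
have idiff : (nu u).-integrable setT (fun s : R => (s - lam)%:E).
  have -> : (fun s : R => (s - lam)%:E) = ((EFin \o (id : R -> R)) \- (EFin \o cst lam))%E.
    by apply/funext => s; rewrite /= EFinB.
  exact: integrableB.
have int0 : (\int[nu u]_(s in B) (s - lam)%:E = 0)%E.
  have -> : (\int[nu u]_(s in B) (s - lam)%:E = \int[nu u]_s (s - lam)%:E)%E.
    by rewrite [RHS](@negligible_integral _ _ _ _ _ (~` B)) ?setTD ?setCK.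
  under eq_integral do rewrite EFinB.
  rewrite (integralB_EFin _ int_u cst_int) //.
  rewrite (@integral_cst _ _ _ (nu u) setT measurableT (lam%:E)) nuT.
  have -> : (\int[nu u]_s s%:E)%E = (lam * sq u)%:E.
    by rewrite -key /Rintegral fineK //; exact: integrable_fin_num.
  by rewrite -EFinM subee.
(* s - lam has constant sign on B. *)
have abs0 : (\int[nu u]_(s in B) `|(s - lam)%:E| = 0)%E.
  have mB' : measurable_fun B (fun s : R => (s - lam)%:E).
    by apply/measurable_EFinP; exact: measurable_funTS.
  case: Bal => Bal.
    rewrite -int0; apply: eq_integral => s /set_mem /Bal sl.
    by rewrite /= ger0_norm // subr_ge0 ltW.
  transitivity (\int[nu u]_(s in B) - (s - lam)%:E)%E.
    apply: eq_integral => s /set_mem /Bal sl; rewrite /= ler0_norm ?EFinN //.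
    by rewrite subr_le0 ltW.
  rewrite integralN ?int0 ?oppe0 //; apply: integrable_add_def => //.
  exact: integrableS idiff.
have /(ae_eq_integral_abs (nu u) mB) : measurable_fun B (fun s : R => (s - lam)%:E).
  by apply/measurable_EFinP; exact: measurable_funTS.
move=> /[dup] iff _; have [N [mN N0 BN]] := (proj1 iff) abs0.
have BsubN : B `<=` N.
  move=> s Bs; apply: BN => /(_ Bs) /= [] /eqP; rewrite subr_eq0 => /eqP sl.
  by case: Bal => /(_ s Bs); rewrite sl ltxx.
apply: sq_eq0; suff : nu u B = 0%E by rewrite nuB => -[].
by apply: (subset_measure0 _ mN) => //; exact: N0.
Qed.
End SpectralUnique.

(** * Distribution functions and rearrangements *)

Section Rearrangement.
Variable R : realType.
Implicit Types (f g : R -> R) (s t : R).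
Local Notation leb := (@lebesgue_measure R).

(** Distribution function of f on (0,1). *)
Definition dist f s : \bar R := leb (I01 `&` [set u | s < `|f u|]).

Lemma measurable_I01 : measurable (@I01 R). Proof. exact: measurable_itv. Qed.
Lemma leb_I01 : leb (@I01 R) = 1%E.
Proof. by rewrite /I01 lebesgue_measure_itv /= lte_fin ltr01 sube0. Qed.

Lemma measurable_dist f s : measurable_fun I01 f ->
  measurable (I01 `&` [set u | s < `|f u|]).
Proof.
move=> mf; have mn : measurable_fun I01 (fun u => `|f u|) by exact: measurableT_comp.
have := mn measurable_I01 _ (measurable_itv `]s, +oo[).
by congr (measurable (_ `&` _)); apply/seteqP; split=> x /=; rewrite in_itv /= andbT.
Qed.

Lemma dist_le1 f s : measurable_fun I01 f -> (dist f s <= 1)%E.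
Proof.
move=> mf; rewrite -leb_I01; apply: le_measure; rewrite ?inE; [exact: measurable_dist|
  exact: measurable_I01|by move=> x []].
Qed.
Lemma dist_ge0 f s : (0 <= dist f s)%E. Proof. exact: measure_ge0. Qed.
Lemma dist_fin f s : measurable_fun I01 f -> dist f s \is a fin_num.
Proof.
move=> mf; rewrite ge0_fin_numE ?dist_ge0 //.
by apply: le_lt_trans (dist_le1 s mf) _; rewrite ltry.
Qed.

Lemma dist_sub f g s t : measurable_fun I01 f -> measurable_fun I01 g ->
  (forall u, I01 u -> s < `|f u| -> t < `|g u|) -> (dist f s <= dist g t)%E.
Proof.
move=> mf mg fg; apply: le_measure; rewrite ?inE; try exact: measurable_dist.
by move=> u [Iu /= su]; split=> //=; exact: fg.
Qed.

Lemma dist_anti f s s' : measurable_fun I01 f -> s <= s' -> (dist f s' <= dist f s)%E.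
Proof.
by move=> mf ss; apply: dist_sub => // u _; exact: le_lt_trans.
Qed.

Lemma dist_right f s (b : \bar R) : measurable_fun I01 f ->
  (forall s', s < s' -> (dist f s' <= b)%E) -> (dist f s <= b)%E.
Proof.
move=> mf H.
pose F n := I01 `&` [set u | s + n.+1%:R^-1 < `|f u|].
have mF n : measurable (F n) by exact: measurable_dist.
have cF : leb (F n) @[n --> \oo] --> leb (\bigcup_n F n).
  apply: nondecreasing_cvg_mu => //; first exact: bigcupT_measurable.
  move=> m n mn; apply/subsetPset => x [Ix /= sx]; split=> //=.
  by apply: le_lt_trans sx; rewrite lerD2l lef_pV2 ?posrE // ler_nat.
have -> : dist f s = leb (\bigcup_n F n).
  congr (leb _); apply/seteqP; split=> [x [Ix /= sx]|x [n _ [Ix /= sx]]]; last first.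
    by split=> //=; apply: lt_trans sx; rewrite ltrDl invr_gt0.
  have d0 : 0 < `|f x| - s by rewrite subr_gt0.
  exists (Num.truncn (`|f x| - s)^-1) => //; split=> //=.
  rewrite -ltrBrDl invf_plt ?posrE //.
  by apply: truncnS_gt.
rewrite -(cvg_lim (@ereal_hausdorff R) cF); apply: lime_le.
  by apply/cvg_ex; eexists; exact: cF.
by near=> n; apply: H; rewrite ltrDl invr_gt0.
Unshelve. all: by end_near. Qed.

Lemma dist_infty f t : measurable_fun I01 f -> 0 < t ->
  exists2 s, 0 < s & (dist f s <= t%:E)%E.
Proof.
move=> mf t0.
pose F n := I01 `&` [set u | n%:R < `|f u|].
have mF n : measurable (F n) by exact: measurable_dist.
have cF : leb (F n) @[n --> \oo] --> leb (\bigcap_n F n).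
  apply: nonincreasing_cvg_mu => //.
  - by apply: le_lt_trans (dist_le1 0%:R mf) _; rewrite ltry.
  - exact: bigcapT_measurable.
  move=> m n mn; apply/subsetPset => x [Ix /= sx]; split=> //=.
  by apply: le_lt_trans sx; rewrite ler_nat.
have E0 : \bigcap_n F n = set0.
  rewrite -subset0 => x Fx; have [_ /=] := Fx (Num.truncn `|f x|).+1 I.
  by apply/negP; rewrite -leNgt ltW // truncnS_gt.
rewrite E0 measure0 in cF.
apply: contrapT => nex.
have ge n : (t%:E <= leb (F n.+1))%E.
  by rewrite leNgt; apply/negP => lt; apply: nex; exists n.+1%:R => //; exact: ltW.
have : (t%:E <= limn (leb \o F))%E.
  apply: lime_ge; first by apply/cvg_ex; eexists; exact: cF.
  by near=> n; rewrite /= -(@prednK n); [exact: ge|near: n; exists 1%N].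
by rewrite (cvg_lim (@ereal_hausdorff R) cF) lee_fin leNgt t0.
Unshelve. all: by end_near. Qed.

Definition rset f t := [set s : R | 0 < s /\
    (lebesgue_measure (I01 `&` [set u | (s < `|f u|)%R]) <= t%:E)%E].

Lemma rset_inf f t : measurable_fun I01 f -> 0 < t -> has_inf (rset f t).
Proof.
move=> mf t0; split; last by exists 0 => s [/ltW].
by have [s s0 st] := dist_infty mf t0; exists s.
Qed.

Lemma rearr_ge0 f t : 0 <= rearrangement f t.
Proof.
rewrite /rearrangement -/(rset f t).
have [->|/set0P ne] := eqVneq (rset f t) set0; first by rewrite inf0.
by apply: lb_le_inf => // s [/ltW].
Qed.

Lemma rearr_leP f s t : measurable_fun I01 f -> 0 <= s -> 0 < t ->
  (rearrangement f t <= s) <-> (dist f s <= t%:E)%E.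
Proof.
move=> mf s0 t0; split=> H.
  apply: dist_right => // s' ss'.
  have [r [r0 rt] rs'] := inf_lt (proj1 (rset_inf mf t0)) (le_lt_trans H ss').
  by apply: le_trans rt; apply: dist_anti => //; exact: ltW.
apply/ler_addgt0Pr => e e0; apply: ge_inf; first exact: (proj2 (rset_inf mf t0)).
split; first by rewrite ltr_wpDl.
by apply: le_trans H; apply: dist_anti => //; rewrite lerDl ltW.
Qed.

Lemma rearr_gtP f s t : measurable_fun I01 f -> 0 <= s -> 0 < t ->
  (s < rearrangement f t) <-> (t%:E < dist f s)%E.
Proof.
move=> mf s0 t0; split=> [lt|lt].
  by rewrite ltNge; apply/negP => /(rearr_leP mf s0 t0); rewrite leNgt lt.
by rewrite ltNge; apply/negP => /(rearr_leP mf s0 t0); rewrite leNgt lt.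
Qed.

Lemma rearr_anti f t t' : measurable_fun I01 f -> 0 < t -> t <= t' ->
  rearrangement f t' <= rearrangement f t.
Proof.
move=> mf t0 tt; apply/(rearr_leP mf (rearr_ge0 f t) (lt_le_trans t0 tt)).
by apply: (@le_trans _ _ t%:E); [apply/rearr_leP => //; exact: rearr_ge0|rewrite lee_fin].
Qed.

Lemma rearr_set f s : measurable_fun I01 f -> 0 <= s ->
  I01 `&` [set t | s < rearrangement f t] = [set` `]0, fine (dist f s)[].
Proof.
move=> mf s0; have fi := dist_fin s mf; set d := fine _.
have dE : dist f s = d%:E by rewrite fineK.
apply/seteqP; split=> t /=; rewrite /I01 /= !in_itv /=.
  by move=> [/andP[t0 t1] /(rearr_gtP mf s0 t0)]; rewrite dE lte_fin t0.
move=> /andP[t0 td]; split; last by apply/rearr_gtP; rewrite ?dE ?lte_fin.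
rewrite t0 /= -lte_fin; apply: lt_le_trans (dist_le1 s mf).
by rewrite dE lte_fin.
Qed.

Lemma dist_rearr f s : measurable_fun I01 f -> 0 <= s ->
  dist (rearrangement f) s = dist f s.
Proof.
move=> mf s0; rewrite {1}/dist.
under eq_set do rewrite ger0_norm ?rearr_ge0 //.
rewrite rearr_set // lebesgue_measure_itv /= lte_fin.
have fi := dist_fin s mf.
case: ifPn => [_|]; first by rewrite sube0 fineK.
rewrite -leNgt => le; have : (dist f s <= 0)%E by rewrite -(fineK fi) lee_fin.
by move=> le0; apply/eqP; rewrite eq_le dist_ge0 le0.
Qed.

Lemma measurable_rearr f : measurable_fun I01 f -> measurable_fun I01 (rearrangement f).
Proof.
move=> mf; apply: (measurability _ (RGenOInfty.measurableE R)) => _ [_ [s ->] <-].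
have [s0|s0] := leP 0 s.
  rewrite (_ : _ `&` _ = [set` `]0, fine (dist f s)[]); first exact: measurable_itv.
  rewrite -rearr_set //; apply/seteqP; split=> x [Ix /=]; rewrite in_itv /= andbT => sx;
    by split=> //=; rewrite in_itv /= andbT.
rewrite (_ : _ `&` _ = I01); first exact: measurable_I01.
apply/seteqP; split=> [x [] //|x Ix]; split=> //=; rewrite in_itv /= andbT.
exact: lt_le_trans (rearr_ge0 f x).
Qed.

Variable E : fspace R.
Hypothesis hE : symmetric_space E.

(** The order on rearrangements, through which the norm is monotone, is the
    order on distribution functions. *)
Lemma sym_dist f g : E g -> measurable_fun I01 f ->
  (forall s, 0 <= s -> (dist f s <= dist g s)%E) -> E f /\ fnorm E f <= fnorm E g.
Proof.
move=> Eg mf fg; apply: (sym_rearr hE) => // t t0.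
have mg := sym_meas hE Eg.
apply/rearr_leP => //; first exact: rearr_ge0.
apply: le_trans (fg _ (rearr_ge0 _ _)) _.
by apply/rearr_leP => //; exact: rearr_ge0.
Qed.

Lemma sym_dist_eq f g : measurable_fun I01 f -> measurable_fun I01 g ->
  (forall s, 0 <= s -> dist f s = dist g s) ->
  (E f <-> E g) /\ (E f -> fnorm E f = fnorm E g).
Proof.
move=> mf mg fg.
have A : E g -> E f /\ fnorm E f <= fnorm E g by move=> Eg; apply: sym_dist => // s s0; rewrite fg.
have B : E f -> E g /\ fnorm E g <= fnorm E f by move=> Ef; apply: sym_dist => // s s0; rewrite fg.
split; first by split=> [/B[]|/A[]].
move=> Ef; have [Eg le] := B Ef; have [_ le'] := A Eg.
by apply/eqP; rewrite eq_le le le'.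
Qed.

Lemma sym_norm_ge0 f : E f -> 0 <= fnorm E f.
Proof.
move=> Ef; have := sym_normD hE Ef (sym_scale hE (-1) Ef).
rewrite (sym_normZ hE) // normrN normr1 mul1r.
have -> : (fun u => f u + -1 * f u) = (fun u => 0 * f u).
  by apply/funext => u; rewrite mulN1r subrr mul0r.
by rewrite (sym_normZ hE) // normr0 mul0r => ?; lra.
Qed.

End Rearrangement.

(** * Sequences as step functions on (0,1) *)

Section Lift.
Variable R : realType.
Variable w : nat -> R.
Hypothesis w_gt0 : forall i, 0 < w i.
Hypothesis w_sum : asummable w.
Hypothesis w_1 : rsum w = 1.
Implicit Types (g : nat -> R) (Q : nat -> Prop) (s t : R).
Local Notation leb := (@lebesgue_measure R).

(** Distribution function of the sequence g for the weight w. *)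
Definition wdist g s : R := rsum (fun i => w i * (s < g i)%R%:R).

Lemma asummable_wb (b : nat -> bool) : asummable (fun i => w i * (b i)%:R).
Proof.
apply: asummable_le w_sum => k; have wk := ltW (w_gt0 k).
by rewrite ger0_norm ?mulr_ge0 ?ler0n // ler_piMr // lern1 leq_b1.
Qed.

Lemma asummable_wdist g s : asummable (fun i => w i * (s < g i)%R%:R).
Proof. exact: (asummable_wb (fun i => s < g i)). Qed.

Definition cum n := \sum_(k < n) w k.
Lemma cumS n : cum n.+1 = cum n + w n. Proof. by rewrite /cum big_ord_recr. Qed.
Lemma cum0 : cum 0 = 0. Proof. by rewrite /cum big_ord0. Qed.
Lemma cum_mono m n : (m <= n)%N -> cum m <= cum n.
Proof.
move=> /subnK <-; elim: (n - m)%N => [|k IH]; first by rewrite add0n.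
by rewrite addSn cumS; apply: le_trans IH _; rewrite lerDl ltW.
Qed.
Lemma cum_lt1 n : cum n < 1.
Proof.
apply: (@lt_le_trans _ _ (cum n.+1)); first by rewrite cumS ltrDl.
by rewrite -w_1; apply: rsum_ge_part => // k; exact: ltW.
Qed.
Definition tailw n := 1 - cum n.
Lemma tailw_gt0 n : 0 < tailw n. Proof. by rewrite subr_gt0 cum_lt1. Qed.
Lemma tailw0 : tailw 0 = 1. Proof. by rewrite /tailw cum0 subr0. Qed.
Lemma tailw_le m n : (m <= n)%N -> tailw n <= tailw m.
Proof. by move=> mn; rewrite lerB // cum_mono. Qed.

(** The intervals are placed from right to left, so that nondecreasing
    sequences become nonincreasing functions. *)
Definition cell k : set R := [set` `[tailw k.+1, tailw k[].
Definition pick_cell t : nat := xget 0%N [set k | cell k t].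

Lemma cell_uniq j k t : cell j t -> cell k t -> j = k.
Proof.
rewrite /cell /= !in_itv /= => /andP[jt tj] /andP[kt tk].
have [jk|kj|//] := ltngtP j k.
  by have := lt_le_trans tk (le_trans (tailw_le jk) jt); rewrite ltxx.
by have := lt_le_trans tj (le_trans (tailw_le kj) kt); rewrite ltxx.
Qed.

Lemma cell_ex t : I01 t -> exists k, cell k t.
Proof.
rewrite /I01 /= in_itv /= => /andP[t0 t1].
have ex : exists n, tailw n <= t.
  apply: contrapT => nex.
  have : rsum w <= 1 - t.
    apply: rsum_le_bound => // n; rewrite lerBrDr -lerBrDl; apply: ltW.
    by rewrite ltNge; apply/negP => le; apply: nex; exists n.
  by rewrite w_1; lra.
case: (ex_minnP ex) => -[|n tn min]; first by rewrite tailw0 leNgt t1.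
exists n; rewrite /cell /= in_itv /= tn /= ltNge; apply/negP => /min.
by rewrite ltnn.
Qed.

Lemma cell_I01 k t : cell k t -> I01 t.
Proof.
rewrite /cell /I01 /= !in_itv /= => /andP[kt tk].
by rewrite (lt_le_trans (tailw_gt0 _) kt) (lt_le_trans tk) // -tailw0 tailw_le.
Qed.

Lemma pick_cellE t k : cell k t -> pick_cell t = k.
Proof.
move=> kt; have := @xgetPex _ 0%N [set k | cell k t] (ex_intro _ k kt) => /= /cell_uniq.
exact.
Qed.

Lemma pick_set Q : I01 `&` [set t | Q (pick_cell t)] =
  \bigcup_k (if `[< Q k >] then cell k else set0).
Proof.
apply/seteqP; split=> [t [/cell_ex[k kt] /= Qt]|t [k _]].
  by exists k => //; rewrite asboolT // -(pick_cellE kt).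
case: asboolP => // Qk kt; split; first exact: cell_I01 kt.
by rewrite /= (pick_cellE kt).
Qed.

Lemma measurable_pick Q : measurable (I01 `&` [set t | Q (pick_cell t)]).
Proof.
rewrite pick_set; apply: bigcupT_measurable => k; case: ifP => _ //.
exact: measurable_itv.
Qed.

Lemma leb_cell k : leb (cell k) = (w k)%:E.
Proof.
rewrite /cell lebesgue_measure_itv /= lte_fin /tailw cumS ltrD2l ltrN2 ltrDl w_gt0.
by rewrite -EFinB; congr EFin; ring.
Qed.

Lemma leb_pick (Q : nat -> bool) :
  leb (I01 `&` [set t | Q (pick_cell t)]) = (rsum (fun k => w k * (Q k)%:R))%:E.
Proof.
rewrite (pick_set (fun k => Q k)) measure_bigcup //; last 2 first.
- by move=> k _; case: ifP => _ //; exact: measurable_itv.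
- move=> i j _ _ [t []]; case: ifP => // _ it; case: ifP => // _ jt.
  exact: cell_uniq it jt.
rewrite -nneseries_rsum; last exact: asummable_wb.
rewrite [LHS](_ : _ = \sum_(0 <= k <oo) leb (if `[< Q k >] then cell k else set0))%E; last first.
  by apply: eq_eseriesl => k; rewrite in_setT.
apply: eq_eseriesr => k _; rewrite asboolb; case: (Q k); last by rewrite measure0 mulr0.
rewrite mulr1; exact: leb_cell.
Qed.

(** The step function with value g k on the k-th cell, of length w k. *)
Definition lift g : R -> R := g \o pick_cell.

Lemma measurable_lift g : measurable_fun I01 (lift g).
Proof. by move=> _ Y mY; exact: (measurable_pick (fun k => Y (g k))). Qed.

Lemma dist_lift g s : dist (lift g) s = (wdist (fun i => `|g i|) s)%:E.
Proof. exact: (leb_pick (fun k => s < `|g k|)). Qed.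

Lemma lift_cell g k t : cell k t -> lift g t = g k.
Proof. by move=> kt; rewrite /lift /= (pick_cellE kt). Qed.

Lemma I01_cells : @I01 R = \bigcup_k cell k.
Proof.
have := pick_set (fun=> True); rewrite (_ : _ `&` _ = I01).
  by move=> ->; apply: eq_bigcupr => k _; rewrite asboolT.
by apply/seteqP; split=> [t []|t].
Qed.

Lemma integral_lift (phi : R -> R) g : (forall i, 0 <= phi (g i)) ->
  measurable_fun I01 (phi \o lift g) -> asummable (fun i => w i * phi (g i)) ->
  (\int[leb]_(t in I01) (phi (lift g t))%:E = (rsum (fun i => w i * phi (g i)))%:E)%E.
Proof.
move=> g0 mg sg.
have tri : trivIset setT cell by move=> i j _ _ [t [it jt]]; exact: cell_uniq it jt.
rewrite I01_cells in mg *.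
rewrite ge0_integral_bigcup //; last 3 first.
- by move=> k; exact: measurable_itv.
- exact/measurable_EFinP.
- by move=> t _; rewrite lee_fin; exact: g0.
rewrite -nneseries_rsum //; apply: eq_eseriesr => k _.
rewrite (eq_integral (fun=> (phi (g k))%:E)) => [|t /set_mem kt]; last by rewrite (lift_cell g kt).
have mc : measurable (cell k) by exact: measurable_itv.
apply: etrans (@integral_cst _ _ _ leb _ mc (phi (g k))%:E) _.
apply: etrans (congr1 (fun z => (phi (g k))%:E * z)%E (leb_cell k)) _.
by rewrite -EFinM mulrC.
Qed.

Lemma wdist_ge0 g s : 0 <= wdist g s.
Proof.
apply: rsum_ge0 => [|k]; first exact: asummable_wdist.
by rewrite mulr_ge0 ?ler0n ?ltW.
Qed.

End Lift.

(** * Generalized singular values of diagonal operators *)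

Section DiagonalSpaces.
Variables (R : realType) (H : l2_model R).
Local Notation C := R[i].
Local Notation Re := (@complex.Re R).
Variable w : nat -> R.
Hypothesis w_gt0 : forall i, 0 < w i.
Hypothesis w_sum : asummable w.
Hypothesis w_1 : rsum w = 1.
Implicit Types (f : nat -> C) (E : fspace R) (x y : op H).

Local Notation M := (diag_vna H w_gt0 w_sum w_1).

Definition absf f : nat -> R := fun i => Num.sqrt (n2 (f i)).
(** The basis vectors are eigenvectors, so any spectral projection is diagonal
    with entries 0 and 1. *)
Lemma tr_spec f (a : op H) P s : is_abs (dg f) a -> spectral_measure a P ->
  Re (tr M (P [set` `]s, +oo[])) = wdist w (absf f) s.
Proof.
move=> /abs_dg aE [Pproj PT [nu [nuP nud nuf]]].
set B := [set` `]s, +oo[]; have mB : measurable B by exact: measurable_itv.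
have mC := measurableC mB.
rewrite /= /dtr /wdist /csum /=; congr rsum; apply/funext => i /=.
have [si|si] := ltP s (absf f i).
  have : P (~` B) (basis i) = 0.
    apply: (P_basis0 Pproj PT nuP nud nuf aE) => //; right => t.
    rewrite /B /= in_itv /= andbT => /negP; rewrite -leNgt => ts.
    exact: le_lt_trans si.
  move=> PC0; have := P_setC Pproj PT nuP (basis i) mB; rewrite PC0 addr0 => <-.
  by rewrite basisE eqxx /=; ring.
rewrite (P_basis0 Pproj PT nuP nud nuf aE) //; first by rewrite co0 /=; ring.
by left => t; rewrite /B /= in_itv /= andbT; exact: le_lt_trans.
Qed.

Lemma mu_dg f t : @mu R M (dg f) t = inf [set s | 0 < s /\ wdist w (absf f) s <= t].
Proof.
congr inf; apply/seteqP; split=> s [s0].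
  by move=> [a [P [ax sP +]]]; rewrite (tr_spec s ax sP).
have ax : is_abs (dg f : op H) (dg (fun i => (absf f i)%:C)) by apply/abs_dg.
have sP := @spec_exists R H (absf f) (fun i => sqrtr_ge0 _).
move=> le; split=> //; exists (dg (fun i => (absf f i)%:C)), (spec_proj (absf f)).
by split=> //; rewrite (tr_spec s ax sP).
Qed.

(** Sign change of one coordinate: a unitary of the commutant. *)
Definition flip (i : nat) : nat -> C := fun k => if k == i then -1 else 1.
Lemma bdd_flip i : bdd (flip i).
Proof.
exists 1 => k; rewrite /flip; case: ifP => _; rewrite ?n2N /n2 /=;
  by rewrite expr1n expr0n addr0.
Qed.

(** Invariance under the sign changes makes the graph stable under the
    coordinate projections; dense domain then gives the eigenvalues, and
    closedness the maximal domain. *)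
Lemma affiliated_diag x : affiliated (@dM R H) x -> exists f, x = dg f.
Proof.
move=> [[[x0 xlin] xfun xdense xclosed] xU].
have xproj i h g : x (h, g) -> x (co h i *: (basis i : H), co g i *: (basis i : H)).
  move=> hg.
  have bU := mulf_bounded H (bdd_flip i).
  have UU (u : H) : mulf (flip i) (mulf (flip i) u) = u.
    apply: co_ext => k; rewrite !mulfE; try exact: bdd_flip.
    by rewrite /flip; case: ifP => _; ring.
  have xUh : x (mulf (flip i) h, mulf (flip i) g).
    apply: xU => //.
    - split=> // S [f [bf _ ->]]; rewrite !mulf_comp //; try exact: bdd_flip.
      by congr mulf; apply/funext => k; rewrite mulrC.
    - split=> // [u v|g']; last by exists (mulf (flip i) g').
      rewrite !dotHE; congr csum; apply/funext => k; rewrite !mulfE; try exact: bdd_flip.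
      by rewrite /flip; case: ifP => _; rewrite ?mulN1r ?mul1r // rmorphN /= mulrNN.
  have := xlin (-1) _ _ _ _ xUh hg.
  move=> /(xlin (1/2) _ _ _ _)/(_ x0); congr (x (_, _)).
    rewrite addr0; apply: co_ext => k; rewrite coZ coD coZ mulfE ?coZ ?basisE /flip; last exact: bdd_flip.
    by case: eqP => [->|_] /=; field.
  rewrite addr0; apply: co_ext => k; rewrite coZ coD coZ mulfE ?coZ ?basisE /flip; last exact: bdd_flip.
  by case: eqP => [->|_] /=; field.
have ex i : exists c : C, x (basis i, c *: basis i).
  have : closure [set h | exists g, x (h, g)] (basis i : H) by rewrite xdense.
  move=> /clP/(_ 1 ltr01)[h [g hg] hi].
  have hi0 : co h i != 0.
    apply/eqP => h0; have := le_lt_trans (co_le _ i) hi.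
    by rewrite coB basisE eqxx h0 subr0 /n2 /= expr1n expr0n addr0 sqrtr1 ltxx.
  exists (co g i / co h i).
  have := xlin (co h i)^-1 _ _ _ _ (xproj i h g hg) x0.
  by rewrite !addr0 !scalerA mulVf // scale1r mulrC.
have [f fP] := choice ex; exists f; apply/seteqP; split=> -[h g].
  move=> hg i /=; have := xlin (- co h i) _ _ _ _ (fP i) (xproj i h g hg).
  rewrite scaleNr addNr scalerA -scalerDl => /(xfun _ _ _)/(_ x0).
  move=> /(congr1 (fun u => co u i)); rewrite coZ basisE eqxx mulr1 co0.
  by move=> /eqP; rewrite mulNr addrC subr_eq0 => /eqP ->; rewrite mulrC.
move=> hg; move/closure_id: (xclosed) => ->; apply/cl2P => e e0.
have [N NP] := cut_cvg h e0; have [N' NP'] := cut_cvg g e0.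
exists (cut (maxn N N') h), (cut (maxn N N') g); split; last 2 first.
- by apply: NP; rewrite leq_maxl.
- by apply: NP'; rewrite leq_maxr.
elim: (maxn N N') => [|n IH].
  suff [-> ->] : cut 0 h = 0 /\ cut 0 g = 0 by [].
  by split; apply: co_ext => i; rewrite cutE ltn0 mul0r co0.
have cS u : cut n.+1 u = co u n *: basis n + cut n u.
  apply: co_ext => i; rewrite coD coZ !cutE basisE ltnS leq_eqVlt.
  by case: eqP => [->|_] /=; rewrite ?ltnn /=; ring.
rewrite !cS; have := xlin (co h n) _ _ _ _ (fP n) IH.
by rewrite scalerA mulrC -(hg n).
Qed.

(** A unitary of the commutant preserves the coordinates supported by a class,
    on which the operator is scalar. *)
Lemma dg_affiliated cls f : (forall i j, cls i = cls j -> f i = f j) ->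
  affiliated (diag_alg (H := H) cls) (dg f).
Proof.
move=> fc; split; first exact: dg_densely_closed.
move=> U [bU Uc] _ h g hg i /=.
pose Q : H -> H := mulf (fun k => (cls k == cls i)%:R).
have bQ : bdd (fun k => (cls k == cls i)%:R : C) by exact: (bdd_ind (fun k => cls k == cls i)).
have AQ : diag_alg (H := H) cls Q by exists (fun k => (cls k == cls i)%:R); split=> // j k ->.
have UQ (u : H) : co (U u) i = co (U (Q u)) i.
  have := congr1 (fun T : H -> H => co (T u) i) (Uc _ AQ); rewrite /= => ->.
  by rewrite /Q mulfE // eqxx mul1r.
rewrite (UQ g) (UQ h).
have -> : Q g = f i *: Q h.
  apply: co_ext => k; rewrite coZ /Q !mulfE // (hg k) /=.
  by case: eqP => [/fc ->|_] /=; ring.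
by rewrite linearZ' ?coZ //; exact: (proj1 bU).
Qed.

Lemma L0_dg f : @L0 R M (dg f).
Proof. by apply: dg_affiliated => i j ->. Qed.

End DiagonalSpaces.

(** * The dyadic weights *)

Section DyadicWeights.
Variable R : realType.
Implicit Types (m n q j k : nat) (s : R).

(** The i-th block of 2^m points has total mass 2^-(i+1), shared equally between
    its points: this is the dyadic partition of (0,1) near 0, each interval being
    cut in 2^m equal parts. *)
Definition wt m k : R := (2^-1) ^+ (k %/ 2 ^ m + 1 + m).

Lemma half_gt0 : 0 < 2^-1 :> R. Proof. by rewrite invr_gt0. Qed.
Lemma halfX_gt0 n : 0 < (2^-1 : R) ^+ n. Proof. by rewrite exprn_gt0 ?half_gt0. Qed.
Lemma halfX_small (e : R) : 0 < e -> exists n, (2^-1) ^+ n <= e.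
Proof.
move=> e0; have : (2^-1 : R) ^+ n @[n --> \oo] --> 0.
  by apply: cvg_expr; rewrite ger0_norm ?invr_ge0 // invf_lt1 // ltr1n.
move=> /cvgrPdist_le/(_ e e0)[N _ /(_ N (leqnn N))] /=.
by rewrite sub0r normrN ger0_norm ?(ltW (halfX_gt0 _)) // => le; exists N.
Qed.
Lemma wt_gt0 m k : 0 < wt m k. Proof. exact: halfX_gt0. Qed.

Lemma sum_block (V : nmodType) (u : nat -> V) n b :
  \sum_(k < n * b) u k = \sum_(i < n) \sum_(j < b) u (i * b + j)%N.
Proof.
elim: n => [|n IH]; first by rewrite mul0n !big_ord0.
by rewrite mulSnr big_split_ord /= IH big_ord_recr.
Qed.

Lemma wt0E k : wt 0 k = (2^-1) ^+ k.+1.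
Proof. by rewrite /wt expn0 divn1 addn0 addn1. Qed.

Lemma half2 (x : R) : x = 2^-1 * x + 2^-1 * x.
Proof. by rewrite -mulrDl; lra. Qed.

Lemma sum_wt0 n : \sum_(k < n) wt 0 k = 1 - (2^-1) ^+ n.
Proof.
elim: n => [|n IH]; first by rewrite big_ord0 expr0 subrr.
by rewrite big_ord_recr /= IH wt0E exprS; have := half2 ((2^-1) ^+ n); lra.
Qed.

Lemma wt_block m n q j : (j < 2 ^ n)%N -> wt (m + n) (q * 2 ^ n + j) = wt m q * (2^-1) ^+ n.
Proof.
move=> jn; rewrite /wt expnD (mulnC (2 ^ m)%N) divnMA divnMDl ?expn_gt0 //.
by rewrite (divn_small jn) addn0 -exprD; congr (_ ^+ _); lia.
Qed.

Lemma halfX2 n : ((2 ^ n)%N)%:R * (2^-1 : R) ^+ n = 1.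
Proof. by rewrite natrX -exprMn divff ?expr1n // pnatr_eq0. Qed.

Lemma avg1 n : (2^-1 : R) ^+ n * \sum_(j < 2 ^ n) 1 = 1.
Proof. by rewrite sumr_const card_ord mulrC halfX2. Qed.

Lemma sum_wt_block m n q (u : nat -> R) :
  \sum_(j < 2 ^ n) wt (m + n) (q * 2 ^ n + j) * u j =
  wt m q * ((2^-1) ^+ n * \sum_(j < 2 ^ n) u j).
Proof.
rewrite !mulr_sumr; apply: eq_bigr => j _; rewrite wt_block //; ring.
Qed.

Lemma wt_asum m : asummable (wt m).
Proof.
exists 1 => n.
have -> : \sum_(k < n) `|wt m k| = \sum_(k < n) wt m k.
  by apply: eq_bigr => k _; rewrite ger0_norm // ltW // wt_gt0.
apply: (@le_trans _ _ (\sum_(k < n * 2 ^ m) wt m k)).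
  have nn : (n <= n * 2 ^ m)%N by rewrite leq_pmulr // expn_gt0.
  rewrite (big_ord_widen _ (wt m) nn) big_mkcond /=.
  by apply: ler_sum => k _; case: ifP => // _; rewrite ltW // wt_gt0.
rewrite sum_block (eq_bigr (fun i : 'I_n => wt 0 i)) => [|i _].
  by rewrite sum_wt0 lerBlDr lerDl ltW // halfX_gt0.
have := sum_wt_block 0 m i (fun=> 1); rewrite add0n.
under eq_bigr do rewrite mulr1.
by move=> ->; rewrite avg1 mulr1.
Qed.

Lemma rsum_block (u : nat -> R) b : (0 < b)%N -> asummable u ->
  rsum u = rsum (fun i => \sum_(j < b) u (i * b + j)%N) /\
  asummable (fun i => \sum_(j < b) u (i * b + j)%N).
Proof.
move=> b0 su; split.
  apply/esym/cvg_lim => //.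
  have -> : series (fun i => \sum_(j < b) u (i * b + j)%N) = series u \o (fun n => (n * b)%N).
    by apply/funext => n /=; rewrite !seriesE_ord sum_block.
  apply: (cvg_comp _ _ _ (asummable_rsum su)).
  by move=> A [N _ NA]; exists N => // n /= Nn; apply: NA; apply: leq_trans Nn _;
    rewrite leq_pmulr.
have [B uB] := su; exists B => n.
apply: le_trans (uB (n * b)%N); rewrite (sum_block (fun k => `|u k|)).
by apply: ler_sum => i _; exact: ler_norm_sum.
Qed.

Lemma wt0_1 : rsum (wt 0) = 1.
Proof.
apply/cvg_lim => //.
have -> : series (wt 0) = (fun n => 1 - (2^-1) ^+ n).
  by apply/funext => n; rewrite seriesE_ord sum_wt0.
rewrite -[X in _ --> X]subr0; apply: cvgB; first exact: cvg_cst.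
by apply: cvg_expr; rewrite ger0_norm ?invr_ge0 // invf_lt1 // ltr1n.
Qed.

Lemma rsum_tens m n (G : nat -> nat -> R) :
  asummable (fun k => wt (m + n) k * G (k %/ 2 ^ n)%N (k %% 2 ^ n)%N) ->
  rsum (fun k => wt (m + n) k * G (k %/ 2 ^ n)%N (k %% 2 ^ n)%N) =
  rsum (fun q => wt m q * ((2^-1) ^+ n * \sum_(j < 2 ^ n) G q j)).
Proof.
move=> su; have [-> _] := rsum_block (expn_gt0 2 n : (0 < 2 ^ n)%N) su.
congr rsum; apply/funext => q; rewrite -sum_wt_block; apply: eq_bigr => j _.
by rewrite divnMDl ?expn_gt0 // divn_small // addn0 modnMDl modn_small.
Qed.

Lemma wt_1 m : rsum (wt m) = 1.
Proof.
have := @rsum_tens 0 m (fun _ _ => 1); rewrite add0n.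
rewrite (_ : (fun k => wt m k * 1) = wt m); last by apply/funext => k; rewrite mulr1.
move=> -> //; last exact: wt_asum.
apply: etrans wt0_1; congr rsum; apply/funext => q.
by rewrite /= avg1 mulr1.
Qed.

Lemma asum_wtb m (b : nat -> bool) : asummable (fun k => wt m k * (b k)%:R).
Proof. by apply: asummable_wb; [exact: wt_gt0|exact: wt_asum]. Qed.

(** The quotient and the remainder by 2^n are independent, the latter being
    uniformly distributed. *)
Lemma wdist_tens m n (G : nat -> nat -> R) s :
  wdist (wt (m + n)) (fun k => G (k %/ 2 ^ n)%N (k %% 2 ^ n)%N) s =
  rsum (fun q => wt m q * ((2^-1) ^+ n * \sum_(j < 2 ^ n) (s < G q j)%R%:R)).
Proof.
rewrite /wdist (@rsum_tens m n (fun q j => (s < G q j)%R%:R)) //.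
exact: (@asum_wtb (m + n) (fun k => s < G (k %/ 2 ^ n)%N (k %% 2 ^ n)%N)).
Qed.

Lemma wdist_ev (g : nat -> R) v n s : (forall i, (n <= i)%N -> g i = v) ->
  wdist (wt 0) g s = \sum_(i < n) wt 0 i * (s < g i)%R%:R + (2^-1) ^+ n * (s < v)%R%:R.
Proof.
move=> gv; apply/cvg_lim => //.
apply: (@cvg_trans _ ((fun N => \sum_(i < n) wt 0 i * (s < g i)%R%:R +
   ((2^-1) ^+ n - (2^-1) ^+ N) * (s < v)%R%:R) @ \oo)).
  apply: near_eq_cvg; near=> N.
  have nN : (n <= N)%N by near: N; exact: nbhs_infty_ge.
  rewrite seriesE_ord -(subnK nN); elim: (N - n)%N => [|k IH].
    by rewrite add0n subrr mul0r addr0.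
  rewrite addSn big_ord_recr /= -IH (gv (k + n)%N) ?leq_addl // wt0E.
  rewrite exprS; have := half2 ((2^-1) ^+ (k + n)).
  by move: (2^-1 * _) => y ->; ring.
rewrite (_ : (2^-1) ^+ n * (s < v)%R%:R = ((2^-1) ^+ n - 0) * (s < v)%R%:R); last by rewrite subr0.
apply: cvgD; first exact: cvg_cst.
apply: cvgMl; apply: cvgB; first exact: cvg_cst.
by apply: cvg_expr; rewrite ger0_norm ?invr_ge0 // invf_lt1 // ltr1n.
Unshelve. all: by end_near. Qed.

Lemma wdist_le (w : nat -> R) (g g' : nat -> R) s s' : (forall k, 0 < w k) -> asummable w ->
  (forall k, s < g k -> s' < g' k) -> wdist w g s <= wdist w g' s'.
Proof.
move=> w0 sw gg; apply: rsum_le; try exact: asummable_wdist.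
move=> k; rewrite ler_pM2l // ler_nat; case: (ltP s (g k)) (gg k) => // _ -> //.
Qed.

Lemma wdist0_le (g : nat -> R) n s : (forall k, (k < n)%N -> g k <= s) ->
  wdist (wt 0) g s <= (2^-1) ^+ n.
Proof.
move=> gs; apply: (@le_trans _ _ (wdist (wt 0) (fun k => if (k < n)%N then s else s + 1) s)).
  apply: wdist_le; [exact: wt_gt0|exact: wt_asum|] => k.
  by case: ifP => [/gs|_ _]; [rewrite leNgt => /negP|rewrite ltrDl].
rewrite (@wdist_ev _ (s + 1) n) => [|i ni]; last by rewrite ltnNge ni.
rewrite big1 ?add0r => [|i _]; last by rewrite ltn_ord ltxx mulr0.
by rewrite ler_piMr ?lern1 ?leq_b1 // ltW // halfX_gt0.
Qed.

Lemma wdist0_ge (g : nat -> R) n s : (forall k, (n <= k)%N -> s < g k) ->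
  (2^-1) ^+ n <= wdist (wt 0) g s.
Proof.
move=> gs; apply: (@le_trans _ _ (wdist (wt 0) (fun k => if (k < n)%N then s else s + 1) s)).
  rewrite (@wdist_ev _ (s + 1) n) => [|i ni]; last by rewrite ltnNge ni.
  rewrite big1 ?add0r => [|i _]; last by rewrite ltn_ord ltxx mulr0.
  by rewrite ltrDl ltr01 mulr1.
apply: wdist_le; [exact: wt_gt0|exact: wt_asum|] => k.
by case: ltnP => [_|/gs //]; rewrite ltxx.
Qed.

End DyadicWeights.

(** * The norm of a symmetric space on sequences *)

Section SymmetricDyadic.
Variable R : realType.
Local Notation leb := (@lebesgue_measure R).
Variable E : fspace R.
Hypothesis hE : symmetric_space E.
Implicit Types (g c : nat -> R) (f : R -> R) (m n : nat).

Definition lm m g : R -> R := lift (wt R m) g.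
Definition Em m g : Prop := E (lm m g).
Definition Nm m g : R := fnorm E (lm m g).

Lemma mlm m g : measurable_fun I01 (lm m g).
Proof. exact: (measurable_lift (@wt_gt0 R m) (wt_asum R m) (wt_1 R m)). Qed.
Lemma dist_lm m g s : dist (lm m g) s = (wdist (wt R m) (fun i => `|g i|) s)%:E.
Proof. exact: (dist_lift (@wt_gt0 R m) (wt_asum R m) (wt_1 R m)). Qed.

Lemma Em_dist m f g : E f ->
  (forall s, 0 <= s -> ((wdist (wt R m) (fun i => `|g i|) s)%:E <= dist f s)%E) ->
  Em m g /\ Nm m g <= fnorm E f.
Proof.
by move=> Ef gf; apply: (sym_dist hE) => // [|s s0]; [exact: mlm|rewrite dist_lm; exact: gf].
Qed.

Lemma Em_mono m m' g g' : Em m' g' ->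
  (forall s, 0 <= s -> wdist (wt R m) (fun i => `|g i|) s <= wdist (wt R m') (fun i => `|g' i|) s) ->
  Em m g /\ Nm m g <= Nm m' g'.
Proof. by move=> Eg' gg; apply: Em_dist => // s s0; rewrite dist_lm lee_fin gg. Qed.

Lemma Em_le m g g' : Em m g' -> (forall k, `|g k| <= `|g' k|) ->
  Em m g /\ Nm m g <= Nm m g'.
Proof.
move=> Eg' gg; apply: Em_mono => // s s0.
apply: wdist_le; [exact: wt_gt0|exact: wt_asum|] => k sg.
exact: lt_le_trans sg (gg k).
Qed.

Lemma Em_add m g g' : Em m g -> Em m g' ->
  Em m (fun k => g k + g' k) /\ Nm m (fun k => g k + g' k) <= Nm m g + Nm m g'.
Proof. by move=> a b; split; [exact: (sym_add hE a b)|exact: (sym_normD hE a b)]. Qed.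

Lemma Em_scale m (a : R) g : Em m g ->
  Em m (fun k => a * g k) /\ Nm m (fun k => a * g k) = `|a| * Nm m g.
Proof. by move=> Eg; split; [exact: (sym_scale hE a Eg)|exact: (sym_normZ hE a Eg)]. Qed.

Lemma Nm_ge0 m g : Em m g -> 0 <= Nm m g.
Proof. exact: sym_norm_ge0. Qed.

Lemma Em_sum m n (G : nat -> nat -> R) : (0 < n)%N -> (forall j, (j < n)%N -> Em m (G j)) ->
  Em m (fun k => \sum_(j < n) G j k) /\
  Nm m (fun k => \sum_(j < n) G j k) <= \sum_(j < n) Nm m (G j).
Proof.
case: n => // n _; elim: n => [|n IH] EG.
  rewrite big_ord1; have -> : (fun k => \sum_(j < 1) G j k) = G 0%N.
    by apply/funext => k; rewrite big_ord1.
  by split=> //; exact: EG.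
have [a b] := IH (fun j jn => EG j (ltnW jn)).
have [c d] := Em_add a (EG n.+1 (ltnSn _)).
have -> : (fun k => \sum_(j < n.+2) G j k) = (fun k => \sum_(j < n.+1) G j k + G n.+1 k).
  by apply/funext => k; rewrite big_ord_recr.
by split=> //; apply: le_trans d _; rewrite [leRHS]big_ord_recr /= lerD2r.
Qed.

(** A nonzero function dominates a multiple of the indicator of a set of
    measure 2^-n, and 2^n disjoint copies of that set cover the interval. *)
Lemma Em_one : Em 0 (fun=> 1).
Proof.
have [f Ef f0] := sym_nontriv hE; have mf := sym_meas hE Ef.
have [s s0 ds] : exists2 s, 0 < s & (0 < dist f s)%E.
  apply: contrapT => nex; apply: f0.
  have d0 s : 0 < s -> dist f s = 0%E.
    move=> s0; apply/eqP; rewrite eq_le dist_ge0 andbT leNgt; apply/negP => lt.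
    by apply: nex; exists s.
  have D0 : (dist f 0 <= 0)%E by apply: dist_right => // s s0; rewrite d0.
  exists (I01 `&` [set u | 0 < `|f u|]); split.
  - exact: measurable_dist.
  - by apply/eqP; rewrite eq_le measure_ge0 andbT.
  move=> u /= /not_implyP[Iu fu]; split=> //=.
  by rewrite normr_gt0; apply/eqP => e; apply: fu.
pose d := fine (dist f s); have dE : dist f s = d%:E by rewrite fineK // dist_fin.
have d_gt0 : 0 < d by rewrite -lte_fin -dE.
have [n nd] := halfX_small d_gt0.
pose G j k : R := (k %% 2 ^ n == j)%N%:R.
have EG j : Em n (G j).
  suff [] : Em n (fun k => s * G j k) /\ Nm n (fun k => s * G j k) <= fnorm E f.
    move=> /(sym_scale hE s^-1) + _; rewrite /Em; congr (E _).
    by apply/funext => u /=; rewrite mulrA mulVf ?mul1r // gt_eqF.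
  apply: Em_dist => // t t0.
  have [ts|ts] := ltP t s; last first.
    rewrite [X in (X%:E <= _)%E](_ : _ = 0) ?dist_ge0 // /wdist.
    rewrite (_ : (fun _ => _) = (fun=> 0)) ?rsum0 //; apply/funext => k.
    rewrite [(t < _)%R]le_gtF ?mulr0 //; apply: le_trans ts.
    rewrite /G; case: eqP => _; rewrite ?mulr1 ?mulr0 ?normr0 ?gtr0_norm //; exact: ltW.
  apply: (@le_trans _ _ d%:E); last by rewrite -dE; apply: dist_anti => //; exact: ltW.
  rewrite lee_fin; apply: le_trans nd.
  have := @wdist_tens R 0 n (fun _ i => `|s * (i == j)%:R|) t; rewrite add0n => ->.
  have sum_le q : wt R 0 q * ((2^-1) ^+ n * \sum_(i < 2 ^ n) (t < `|s * (i == j :> nat)%:R|)%R%:R)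
      <= (2^-1) ^+ n * wt R 0 q.
    rewrite mulrC; apply: ler_wpM2r; first exact: ltW (wt_gt0 _ _ _).
    rewrite ler_piMr // ?(ltW (halfX_gt0 _ _)) //.
    have [jn|jn] := ltnP j (2 ^ n); last first.
      rewrite big1 ?ler01 // => i _; rewrite ltn_eqF ?mulr0 ?normr0 ?(le_gtF t0) //.
      exact: leq_trans (ltn_ord i) jn.
    rewrite (bigD1 (Ordinal jn)) //= big1 ?addr0 ?lern1 ?leq_b1 // => i ij.
    by rewrite (negbTE (_ : (i != j :> nat))) ?mulr0 ?normr0 ?(le_gtF t0).
  apply: (@le_trans _ _ (rsum (fun q => (2^-1) ^+ n * wt R 0 q))); last first.
    by rewrite rsumZ ?wt0_1 ?mulr1 //; exact: wt_asum.
  apply: rsum_le; [|by apply: asummableZ; exact: wt_asum|exact: sum_le].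
  apply: asummable_le (asummableZ ((2^-1) ^+ n) (wt_asum R 0)) => q.
  rewrite ger0_norm //; apply: mulr_ge0; first exact: ltW (wt_gt0 _ _ _).
  by apply: mulr_ge0; [exact: ltW (halfX_gt0 _ _)|apply: sumr_ge0 => i _; rewrite ler0n].
have [E1 _] := Em_sum (expn_gt0 2 n : (0 < 2 ^ n)%N) (fun j _ => EG j).
have [] // := @Em_mono 0 n (fun=> 1) _ E1 => t t0.
rewrite (_ : (fun i => `|\sum_(j < 2 ^ n) G j i|) = (fun=> `|1|)); last first.
  apply/funext => k; congr (`| _ |).
  rewrite (bigD1 (Ordinal (ltn_pmod k (expn_gt0 2 n : (0 < 2 ^ n)%N)))) //= /G eqxx.
  by rewrite big1 ?addr0 // => i ik; rewrite eq_sym (negbTE (_ : (i != k %% 2 ^ n :> nat)%N)).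
rewrite /wdist; set b := (_ < _)%R.
have e m : rsum (fun i => wt R m i * b%:R) = b%:R.
  rewrite (_ : (fun _ => _) = (fun i => b%:R * wt R m i)); last by apply/funext => k; rewrite mulrC.
  by rewrite rsumZ ?wt_1 ?mulr1 //; exact: wt_asum.
by rewrite !e.
Qed.

Lemma Nm_one_gt0 : 0 < Nm 0 (fun=> 1).
Proof.
rewrite lt_def Nm_ge0 ?andbT; last exact: Em_one.
apply/eqP => /(sym_norm_eq0 hE Em_one)[A [mA A0 subA]].
have : (leb (@I01 R) <= leb A)%E.
  apply: le_measure; rewrite ?inE //; first exact: measurable_I01.
  by move=> u Iu; apply: subA => /= /(_ Iu) /eqP; rewrite /lm /lift /= oner_eq0.
by rewrite leb_I01 A0 lee_fin leNgt ltr01.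
Qed.

End SymmetricDyadic.

(** * The dyadic majorant of a function *)

Section DyadicMajorant.
Variable R : realType.
Local Notation leb := (@lebesgue_measure R).
Variable E : fspace R.
Hypothesis hE : symmetric_space E.
Implicit Types (g c : nat -> R) (f : R -> R) (m n : nat).

Lemma eq_ler (x y : R) : x = y -> x <= y. Proof. by move=> ->. Qed.

Definition nondec c := (forall i, 0 <= c i) /\ (forall i j, (i <= j)%N -> c i <= c j).

Lemma nondec_norm c : nondec c -> (fun i => `|c i|) = c.
Proof. by move=> [c0 _]; apply/funext => i; rewrite ger0_norm. Qed.

Lemma wdist0_nondec c s : nondec c ->
  (forall i, c i <= s) \/ exists n, wdist (wt R 0) c s = (2^-1) ^+ n /\ s < c n.
Proof.
move=> [c0 cm]; have [ex|nex] := pselect (exists n, s < c n); last first.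
  by left => i; rewrite leNgt; apply/negP => lt; apply: nex; exists i.
right; case: (ex_minnP ex) => n sn min; exists n; split=> //.
apply/eqP; rewrite eq_le wdist0_le ?wdist0_ge // => k.
  by move=> nk; apply: lt_le_trans sn (cm _ _ nk).
by move=> kn; rewrite leNgt; apply/negP => /min; rewrite leqNgt kn.
Qed.

Lemma wdist_none (w g : nat -> R) s : (forall i, g i <= s) -> wdist w g s = 0.
Proof.
move=> gs; rewrite /wdist (_ : (fun _ => _) = (fun=> 0)) ?rsum0 //.
by apply/funext => i; rewrite (le_gtF (gs i)) mulr0.
Qed.

(** Values of the rearrangement of f at the left ends of the dyadic intervals
    [2^-(i+1), 2^-i[. *)
Definition dyadic f : nat -> R := fun i => rearrangement f ((2^-1) ^+ i.+1).

Lemma halfX_anti i j : (i <= j)%N -> (2^-1 : R) ^+ j <= (2^-1) ^+ i.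
Proof.
move=> ij; rewrite -(subnK ij) exprD ler_piMl ?(ltW (halfX_gt0 _ _)) //.
by rewrite exprn_ile1 ?(ltW (half_gt0 _)) // invf_le1 ?ler1n.
Qed.

Lemma dyadic_nondec f : measurable_fun I01 f -> nondec (dyadic f).
Proof.
move=> mf; split=> [i|i j ij]; first exact: rearr_ge0.
by apply: rearr_anti; [|exact: halfX_gt0|exact: halfX_anti].
Qed.

(** The restrictions of the majorant to the left and right halves of the dyadic
    intervals are both dominated by f in distribution, which costs the factor 2. *)
Lemma dyadic_Em f : E f -> Em E 0 (dyadic f) /\ Nm E 0 (dyadic f) <= 2 * fnorm E f.
Proof.
move=> Ef; have mf := sym_meas hE Ef; have nd := dyadic_nondec mf.
pose G j k : R := dyadic f (k %/ 2 ^ 1) * (k %% 2 ^ 1 == j)%N%:R.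
have EG j : (j < 2)%N -> Em E 1 (G j) /\ Nm E 1 (G j) <= fnorm E f.
  move=> j2; apply: Em_dist => // s s0.
  have := @wdist_tens R 0 1 (fun q i => `|dyadic f q * (i == j)%:R|) s.
  rewrite add0n => ->.
  have e q : (2^-1) ^+ 1 * \sum_(i < 2 ^ 1) (s < `|dyadic f q * (i == j :> nat)%:R|)%R%:R
      = 2^-1 * (s < dyadic f q)%R%:R :> R.
    rewrite expr1; congr (_ * _); rewrite (bigD1 (Ordinal (j2 : (j < 2 ^ 1)%N))) //= eqxx mulr1.
    rewrite ger0_norm ?(proj1 nd) // big1 ?addr0 // => i ij.
    by rewrite (negbTE (_ : (i != j :> nat))) ?mulr0 ?normr0 ?(le_gtF s0).
  rewrite (_ : (fun q => _) = (fun q => 2^-1 * (wt R 0 q * (s < dyadic f q)%R%:R))); last first.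
    by apply/funext => q; rewrite e; ring.
  rewrite rsumZ; last exact: asum_wtb.
  have [le|[n [dn sn]]] := wdist0_nondec s nd.
    have -> : rsum (fun q => wt R 0 q * (s < dyadic f q)%R%:R) = 0 by exact: wdist_none.
    by rewrite mulr0 dist_ge0.
  have -> : rsum (fun q => wt R 0 q * (s < dyadic f q)%R%:R) = (2^-1) ^+ n by [].
  rewrite -exprS; apply: ltW; apply/rearr_gtP => //; exact: halfX_gt0.
have [E1 N1] := Em_sum hE (isT : (0 < 2)%N) (fun j j2 => proj1 (EG j j2)).
have [Ed Nd] : Em E 0 (dyadic f) /\
    Nm E 0 (dyadic f) <= Nm E 1 (fun k => \sum_(j < 2) G j k).
  apply: Em_mono => // s s0.
  rewrite (_ : (fun i => `|\sum_(j < 2) G j i|) = (fun k => (fun q _ => `|dyadic f q|) (k %/ 2 ^ 1)%N (k %% 2 ^ 1)%N)); last first.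
    apply/funext => k; congr (`| _ |); rewrite !big_ord_recr big_ord0 /= add0r /G.
    have := ltn_pmod k (isT : (0 < 2 ^ 1)%N).
    by case: (k %% 2 ^ 1)%N => [|[|//]] _ /=; rewrite !(mulr0, mulr1) ?addr0 ?add0r.
  have := @wdist_tens R 0 1 (fun q i => `|dyadic f q|) s; rewrite add0n => ->.
  apply: rsum_le.
  - exact: asum_wtb.
  - apply: eq_asummable (@asum_wtb R 0 (fun q => s < `|dyadic f q|)) => q.
    by rewrite expr1 !big_ord_recr big_ord0 /=; field.
  - by move=> q; rewrite expr1 !big_ord_recr big_ord0 /= le_eqVlt; apply/orP; left; apply/eqP; field.
split=> //; apply: le_trans Nd _; apply: le_trans N1 _.
rewrite !big_ord_recr big_ord0 /= add0r.
by have [_ a] := EG 0%N isT; have [_ b] := EG 1%N isT; lra.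
Qed.

Lemma tailw_wt0 n : tailw (wt R 0) n = (2^-1) ^+ n.
Proof. by rewrite /tailw /cum sum_wt0; ring. Qed.

Lemma lm0_cell c t : I01 t -> exists i, [/\ lm 0 c t = c i, (2^-1) ^+ i.+1 <= t & t < (2^-1) ^+ i].
Proof.
move=> /(cell_ex (wt_asum R 0) (wt_1 R 0))[i it]; exists i.
move: (it); rewrite /cell /= in_itv /= !tailw_wt0 => /andP[a b]; split=> //.
exact: (lift_cell (@wt_gt0 R 0) c it).
Qed.

Lemma rearr_le_lm f c t : measurable_fun I01 f -> nondec c ->
  (forall s, 0 <= s -> (dist f s <= (wdist (wt R 0) c s)%:E)%E) -> I01 t ->
  rearrangement f t <= lm 0 c t.
Proof.
move=> mf [c0 cm] fc It; have [i [-> it ti]] := lm0_cell c It.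
have t0 : 0 < t by apply: lt_le_trans it; exact: halfX_gt0.
apply/rearr_leP => //; apply: le_trans (fc _ (c0 i)) _; rewrite lee_fin.
apply: le_trans it; apply: wdist0_le => k ki; exact: cm.
Qed.

Lemma rearr_le_dyadic f t : measurable_fun I01 f -> I01 t ->
  rearrangement f t <= lm 0 (dyadic f) t.
Proof.
move=> mf It; have [i [-> it ti]] := lm0_cell (dyadic f) It.
by apply: rearr_anti => //; exact: halfX_gt0.
Qed.

Lemma dist_le_dyadic f s : measurable_fun I01 f -> 0 <= s ->
  (dist f s <= (wdist (wt R 0) (dyadic f) s)%:E)%E.
Proof.
move=> mf s0; rewrite -(nondec_norm (dyadic_nondec mf)) -dist_lm -dist_rearr //.
apply: dist_sub => //; [exact: measurable_rearr|exact: mlm|move=> u Iu su].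
apply: lt_le_trans su _.
rewrite ger0_norm ?rearr_ge0 //; apply: le_trans (rearr_le_dyadic mf Iu) _.
exact: ler_norm.
Qed.

Lemma fnorm_le_dyadic f : measurable_fun I01 f -> Em E 0 (dyadic f) ->
  E f /\ fnorm E f <= Nm E 0 (dyadic f).
Proof.
move=> mf Ed; apply: (sym_dist hE) => // s s0.
rewrite dist_lm (nondec_norm (dyadic_nondec mf)); exact: dist_le_dyadic.
Qed.

Definition evc n (b : nat -> R) (t : R) : nat -> R := fun i => if (i < n)%N then b i else t.

(** Exchanging the value at n with the tail, which has the same mass, gives an
    equidistributed sequence; the average of the two is constant from n on. *)
Lemma Nm_evc n b t : (forall i, 0 <= b i) -> 0 <= t -> Em E 0 (evc n.+1 b t) ->
  Em E 0 (evc n b (2^-1 * (b n + t))) /\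
  Nm E 0 (evc n b (2^-1 * (b n + t))) <= Nm E 0 (evc n.+1 b t).
Proof.
move=> b0 t0 Eb.
pose b' i := if i == n then t else b i.
have e_ge0 m (u : nat -> R) v i : (forall i, 0 <= u i) -> 0 <= v -> 0 <= evc m u v i.
  by move=> u0 v0; rewrite /evc; case: ifP.
have b'0 i : 0 <= b' i by rewrite /b'; case: ifP.
have nrm m (u : nat -> R) v : (forall i, 0 <= u i) -> 0 <= v -> (fun i => `|evc m u v i|) = evc m u v.
  by move=> u0 v0; apply/funext => i; rewrite ger0_norm ?e_ge0.
have [E' N'] : Em E 0 (evc n.+1 b' (b n)) /\ Nm E 0 (evc n.+1 b' (b n)) <= Nm E 0 (evc n.+1 b t).
  apply: Em_mono => // s s0; rewrite !nrm //.
  have ev m (u : nat -> R) v i : (m <= i)%N -> evc m u v i = v by rewrite /evc ltnNge => ->.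
  rewrite (@wdist_ev _ (evc n.+1 b' (b n)) (b n) n.+1 s (ev _ _ _)).
  rewrite (@wdist_ev _ (evc n.+1 b t) t n.+1 s (ev _ _ _)).
  rewrite !big_ord_recr /= /evc ltnSn /b' eqxx wt0E.
  have -> : \sum_(i < n) wt R 0 i * (s < if (i < n.+1)%N then if (i == n :> nat) then t else b i else b n)%R%:R
      = \sum_(i < n) wt R 0 i * (s < if (i < n.+1)%N then b i else t)%R%:R.
    by apply: eq_bigr => i _; rewrite ltnS (ltnW (ltn_ord i)) ltn_eqF.
  by lra.
have [Es Ns] := Em_add hE Eb E'.
have [Eh Nh] := Em_scale hE 2^-1 Es.
have -> : evc n b (2^-1 * (b n + t)) = (fun k => 2^-1 * (evc n.+1 b t k + evc n.+1 b' (b n) k)).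
  apply/funext => k; rewrite /evc /b' ltnS.
  by case: (ltngtP k n) => /= kn; rewrite ?kn; field.
split; first exact: Eh.
by rewrite Nh ger0_norm ?invr_ge0 //; lra.
Qed.

Lemma Em_L1_part n b t : (forall i, 0 <= b i) -> 0 <= t -> Em E 0 (evc n b t) ->
  (\sum_(i < n) wt R 0 i * b i + (2^-1) ^+ n * t) * Nm E 0 (fun=> 1) <= Nm E 0 (evc n b t).
Proof.
move=> b0; elim: n t => [|n IH] t t0 Eb.
  rewrite big_ord0 add0r expr0 mul1r.
  have [_] := Em_scale hE t (Em_one hE); rewrite ger0_norm // => <-.
  by apply: eq_ler; congr (Nm E 0 _); apply/funext => k; rewrite mulr1.
have [E' N'] := Nm_evc b0 t0 Eb.
apply: le_trans N'; apply: le_trans (IH _ _ E'); last first.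
  by rewrite mulr_ge0 ?invr_ge0 // addr_ge0.
by rewrite big_ord_recr /= wt0E exprSr; apply: eq_ler; congr (_ * _); ring.
Qed.

(** E is contained in L_1: iterating the previous averaging from the tail to
    the head replaces a truncation by its mean. *)
Lemma Em_L1 c : nondec c -> Em E 0 c -> asummable (fun i => wt R 0 i * c i).
Proof.
move=> [c0 cm] Ec; exists (Nm E 0 c / Nm E 0 (fun=> 1)) => n.
rewrite ler_pdivlMr ?Nm_one_gt0 //.
have [E' N'] : Em E 0 (evc n c 0) /\ Nm E 0 (evc n c 0) <= Nm E 0 c.
  apply: Em_le => // k; rewrite /evc; case: ifP => // _.
  by rewrite normr0 normr_ge0.
apply: le_trans N'; apply: le_trans (Em_L1_part c0 (lexx 0) E').
rewrite mulr0 addr0 ler_wpM2r ?Nm_ge0 //; first exact: Em_one.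
by apply: ler_sum => i _; rewrite ger0_norm ?mulr_ge0 // ltW // wt_gt0.
Qed.

End DyadicMajorant.

Section L1Rearrangement.
Variable R : realType.
Local Notation leb := (@lebesgue_measure R).
Implicit Types (c : nat -> R) (f : R -> R).

Lemma Lnorm1_I01 f : 'N[leb]_1[EFin \o (f \_ I01)]%E = (\int[leb]_(t in I01) `|f t|%:E)%E.
Proof.
rewrite Lnorm1 [RHS]integral_mkcond; apply: eq_integral => t _ /=.
by rewrite /patch; case: ifP => _ /=; rewrite ?normr0.
Qed.

(** Domination in distribution by a step function bounds the L_1 norm, the
    rearrangement being pointwise below the step function. *)
Lemma L1_rearr f c : measurable_fun I01 f -> nondec c -> asummable (fun i => wt R 0 i * c i) ->
  (forall s, 0 <= s -> (dist f s <= (wdist (wt R 0) c s)%:E)%E) ->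
  Lp01 1 (rearrangement f) /\ fnorm (Lp01 1) (rearrangement f) <= rsum (fun i => wt R 0 i * c i).
Proof.
move=> mf nc sc fc; have mr := measurable_rearr mf.
have c0 := proj1 nc.
have le : ('N[leb]_1[EFin \o (rearrangement f \_ I01)] <= (rsum (fun i => wt R 0 i * c i))%:E)%E.
  rewrite Lnorm1_I01 -(@integral_lift R (wt R 0) (@wt_gt0 R 0) (wt_asum R 0) (wt_1 R 0) id) //; last exact: mlm.
  apply: ge0_le_integral.
  - exact: measurable_I01.
  - by move=> t _; rewrite lee_fin.
  - by apply/measurable_EFinP; exact: measurableT_comp.
  - by apply/measurable_EFinP; exact: mlm.
  move=> t It; rewrite lee_fin ger0_norm ?rearr_ge0 //; exact: rearr_le_lm.
have ge0 : (0 <= 'N[leb]_1[EFin \o (rearrangement f \_ I01)])%E by exact: Lnorm_ge0.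
split; first by split=> //; apply: le_lt_trans le _; rewrite ltry.
rewrite /= -lee_fin fineK // ge0_fin_numE //.
by apply: le_lt_trans le _; rewrite ltry.
Qed.

Lemma L1_eq0 f : measurable_fun I01 f -> Lp01 1 (rearrangement f) ->
  fnorm (Lp01 1) (rearrangement f) = 0 -> forall s, 0 <= s -> dist f s = 0%E.
Proof.
move=> mf [mr fin] N0 s s0; rewrite -dist_rearr //.
have ge0 : (0 <= 'N[leb]_1[EFin \o (rearrangement f \_ I01)])%E by exact: Lnorm_ge0.
have {N0} : 'N[leb]_1[EFin \o (rearrangement f \_ I01)]%E = 0%E.
  by move: N0; rewrite /= => N0; rewrite -[LHS]fineK ?ge0_fin_numE // N0.
rewrite Lnorm1_I01 => int0.
have /(ae_eq_integral_abs leb (@measurable_I01 R)) [ae _] : measurable_fun I01 (EFin \o rearrangement f).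
  exact/measurable_EFinP.
have [N [mN N0 subN]] := ae int0.
apply: (subset_measure0 _ mN) => //; first exact: measurable_dist.
move=> t [It /= st]; apply: subN => /= /(_ It) [] e.
by move: st; rewrite e normr0 ltNge s0.
Qed.

End L1Rearrangement.

(** * Norms of diagonal operators and of their sums *)

Section DiagonalNorms.
Variables (R : realType) (H : l2_model R) (m : nat).
Local Notation C := R[i].
Local Notation Re := (@complex.Re R).
Local Notation M := (diag_vna H (@wt_gt0 R m) (wt_asum R m) (wt_1 R m)).
Implicit Types (f : nat -> C) (E : fspace R) (x y : op H) (c : nat -> R).

Lemma absf_ge0 f i : 0 <= absf f i. Proof. exact: sqrtr_ge0. Qed.
Lemma absf_real (g : nat -> R) : absf (fun i => (g i)%:C) = (fun i => `|g i|).
Proof. by apply/funext => i; rewrite /absf n2C sqrtr_sqr. Qed.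

Lemma mu_rearr f : @mu R M (dg f) = rearrangement (lm m (absf f)).
Proof.
apply/funext => t; rewrite mu_dg /rearrangement; congr inf; apply/seteqP.
have e s : lebesgue_measure (I01 `&` [set u | s < `|lm m (absf f) u|]) =
    (wdist (wt R m) (absf f) s)%:E.
  have := dist_lm m (absf f) s; rewrite /dist => ->; congr (wdist _ _ _)%:E.
  by apply/funext => i; rewrite ger0_norm ?absf_ge0.
by split=> s [s0 le]; split=> //; move: le; rewrite e lee_fin.
Qed.

Lemma rearr_lm E f : symmetric_space E ->
  (E (rearrangement (lm m (absf f))) <-> Em E m (absf f)) /\
  (Em E m (absf f) -> fnorm E (rearrangement (lm m (absf f))) = Nm E m (absf f)).
Proof.
move=> hE; have [a b] := sym_dist_eq hE (mlm m (absf f)) (measurable_rearr (mlm m (absf f)))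
  (fun s s0 => esym (dist_rearr (mlm m (absf f)) s0)).
by split; [split; apply a|move=> /b].
Qed.

Lemma in_space_dg E f : symmetric_space E -> @in_space R M E (dg f) <-> Em E m (absf f).
Proof.
move=> hE; rewrite /in_space mu_rearr; have [a _] := rearr_lm f hE.
by split=> [[_ /a]|/a ?] //; split=> //; exact: L0_dg.
Qed.

Lemma enorm_dg E f : symmetric_space E -> Em E m (absf f) ->
  @enorm R M E (dg f) = (Nm E m (absf f))%:E.
Proof.
move=> hE Ef; rewrite /enorm asboolT; last exact/in_space_dg.
by rewrite mu_rearr (proj2 (rearr_lm f hE)).
Qed.

Lemma enorm_lt f E : symmetric_space E -> (@enorm R M E (dg f) < +oo)%E -> Em E m (absf f).
Proof.
by move=> hE; rewrite /enorm; case: asboolP => // /in_space_dg - /(_ hE).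
Qed.

Lemma wdist_block (c : nat -> R) s :
  wdist (wt R m) (fun k => c (k %/ 2 ^ m)%N) s = wdist (wt R 0) c s.
Proof.
have := @wdist_tens R 0 m (fun q _ => c q) s; rewrite add0n => ->.
congr rsum; apply/funext => q; congr (_ * _).
have -> : \sum_(j < 2 ^ m) (s < c q)%R%:R = (s < c q)%R%:R * \sum_(j < 2 ^ m) 1 :> R.
  by rewrite mulr_sumr; apply: eq_bigr => j _; rewrite mulr1.
by rewrite mulrCA avg1 mulr1.
Qed.

Lemma L1_dom f c : nondec c -> asummable (fun i => wt R 0 i * c i) ->
  (forall k, absf f k <= c (k %/ 2 ^ m)%N) ->
  @in_space R M (Lp01 1) (dg f) /\
  (@enorm R M (Lp01 1) (dg f) <= (rsum (fun i => wt R 0 i * c i))%:E)%E.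
Proof.
move=> nc sc fc.
have [a b] : Lp01 1 (rearrangement (lm m (absf f))) /\
    fnorm (Lp01 1) (rearrangement (lm m (absf f))) <= rsum (fun i => wt R 0 i * c i).
  apply: L1_rearr => //; first exact: mlm.
  move=> s s0; rewrite dist_lm lee_fin -wdist_block.
  apply: wdist_le; [exact: wt_gt0|exact: wt_asum|] => k.
  by rewrite ger0_norm ?absf_ge0 // => /lt_le_trans; apply.
have i1 : @in_space R M (Lp01 1) (dg f) by split; [exact: L0_dg|rewrite mu_rearr].
split=> //; rewrite /enorm asboolT // lee_fin mu_rearr //.
Qed.

Lemma L1_norm_ge0 x : (0 <= @enorm R M (Lp01 1) x)%E.
Proof.
rewrite /enorm; case: ifP => // _; rewrite lee_fin /=.
by rewrite fine_ge0 // Lnorm_ge0.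
Qed.

Lemma L1_norm_eq0 f : @enorm R M (Lp01 1) (dg f) = 0%E -> f = (fun=> 0).
Proof.
rewrite /enorm; case: asboolP => // -[_]; rewrite mu_rearr => a /eqP.
rewrite eqe => /eqP b.
have d0 : wdist (wt R m) (fun i => `|absf f i|) 0 = 0.
  apply: EFin_inj; rewrite -dist_lm.
  exact: (L1_eq0 (mlm m (absf f)) a b (lexx 0)).
apply/funext => k; apply: n2_eq0; apply/eqP; rewrite eq_le n2_ge0 andbT -sqrtr_eq0 -?leNgt.
have u0 i : 0 <= wt R m i * (0 < `|absf f i|)%R%:R.
  by rewrite mulr_ge0 ?ler0n // ltW // wt_gt0.
have := rsum_eq0 (@asum_wtb R m (fun i => 0 < `|absf f i|)) u0 d0 k; move/eqP.
by rewrite mulf_eq0 gt_eqF ?wt_gt0 //= pnatr_eq0 eqb0 normr_gt0 negbK.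
Qed.

Lemma add_opp_dg f f' : op_add (dg f) (op_opp (dg f')) = dg (fun i => f i - f' i) :> op H.
Proof. by rewrite op_opp_dg op_add_dg. Qed.

Lemma psum_dg (X : nat -> nat -> C) N :
  op_psum (fun k => dg (X k)) N = dg (fun i => \sum_(k < N) X k i) :> op H.
Proof.
rewrite /op_psum; elim: (index_enum _) => [|k r IH].
  by rewrite big_nil op0_dg; congr dg; apply/funext => i; rewrite big_nil.
rewrite big_cons IH op_add_dg; congr dg; apply/funext => i.
by rewrite big_cons.
Qed.

Lemma L1_dg0 : @enorm R M (Lp01 1) (dg (fun=> 0)) = 0%E.
Proof.
have nz : nondec (fun=> 0 : R) by split.
have s0 : asummable (fun i => wt R 0 i * 0).
  by apply: eq_asummable (@asummable0 R) => i; rewrite mulr0.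
have [|_ le] := @L1_dom (fun=> 0) (fun=> 0) nz s0.
  by move=> k; rewrite /absf n2_0 sqrtr0.
apply/eqP; rewrite eq_le L1_norm_ge0 andbT; apply: le_trans le _.
rewrite (_ : (fun i => _) = (fun=> 0)) ?rsum0 //.
by apply/funext => i; rewrite mulr0.
Qed.

Lemma L1_cvg_ev (X : nat -> op H) f N : (forall k, (N <= k)%N -> X k = dg f) ->
  @L1_cvg R M X (dg f).
Proof.
move=> Xf; apply: cvg_near_cst; near=> k.
rewrite Xf; last by near: k; exact: nbhs_infty_ge.
rewrite add_opp_dg (_ : (fun i => _) = (fun=> 0)) ?L1_dg0 //.
by apply/funext => i; rewrite subrr.
Unshelve. all: by end_near. Qed.

(** An L_1 limit is unique, so the norm of a finite sum is that of its symbol. *)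
Lemma sum_norm_dg E (X : nat -> nat -> C) N :
  (forall k i, (N <= k)%N -> X k i = 0) ->
  @in_space R M (Lp01 1) (dg (fun i => \sum_(k < N) X k i)) ->
  @sum_norm R M E (fun k => dg (X k)) = @enorm R M E (dg (fun i => \sum_(k < N) X k i)).
Proof.
pose S := (fun i => \sum_(k < N) X k i) : nat -> C.
move=> X0; rewrite -/S => i1.
have psumE n : (N <= n)%N -> op_psum (fun k => dg (X k)) n = dg S :> op H.
  move=> Nn; rewrite psum_dg; congr dg; apply/funext => i.
  rewrite /S (big_ord_widen n (X^~ i) Nn) [RHS]big_mkcond /=; apply: eq_bigr => k _.
  by case: ltnP => // /X0.
have cvgS : @L1_cvg R M (op_psum (fun k => dg (X k))) (dg S) by exact: L1_cvg_ev psumE.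
rewrite /sum_norm (_ : [set _ | s in _] = [set @enorm R M E (dg S)]) ?ereal_inf1 //.
apply/seteqP; split=> [_ [s [[Ls sin] sc] <-]|_ ->]; last by exists (dg S).
have [f sf] := affiliated_diag Ls; congr enorm; rewrite sf in sc *.
have cc : (fun n => @enorm R M (Lp01 1) (op_add (op_psum (fun k => dg (X k)) n) (op_opp (dg f)))) @ \oo
    --> @enorm R M (Lp01 1) (dg (fun i => S i - f i)).
  apply: cvg_near_cst; near=> k.
  by rewrite psumE ?add_opp_dg //; near: k; exact: nbhs_infty_ge.
have e0 : @enorm R M (Lp01 1) (dg (fun i => S i - f i)) = 0%E.
  exact: (cvg_unique (@ereal_hausdorff R) cc sc).
have Sf := L1_norm_eq0 e0.
congr dg; apply/funext => i; apply/eqP; rewrite eq_sym -subr_eq0.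
by have := congr1 (fun u => u i) Sf => /= ->.
Unshelve. all: by end_near. Qed.

End DiagonalNorms.

(** * Square functions of diagonal operators *)

Section SquareFunctions.
Variables (R : realType) (H : l2_model R) (m : nat).
Local Notation C := R[i].
Local Notation Re := (@complex.Re R).
Local Notation M := (diag_vna H (@wt_gt0 R m) (wt_asum R m) (wt_1 R m)).
Implicit Types (f : nat -> C) (E : fspace R) (y : nat -> nat -> C).

Lemma tr_real (r : nat -> R) : bdd (fun i => (r i)%:C) ->
  tr M (mulf (fun i => (r i)%:C)) = (rsum (fun i => wt R m i * r i))%:C.
Proof. by move=> br; apply: dtr_real => //; exact: wt_asum. Qed.

(** A projection of trace close to 1 contains a given atom. *)
Lemma measure_nbhs_pt e d f i : 0 < e -> d < wt R m i ->
  @measure_nbhs R M e d (dg f) -> absf f i <= e.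
Proof.
move=> e0 dw [p [[pi [bpi _ pE]] [_ _ pp] trp hp]].
have pi2 j : pi j * pi j = pi j.
  have := congr1 (fun h => co h j) (pp (basis j)).
  by rewrite pE mulf_basis // !mulfE // coZ basisE eqxx mulr1.
have piE : pi i = 1.
  apply/eqP; rewrite -subr_eq0; apply/negPn/negP => pi1.
  have pi01 j : pi j = 0 \/ pi j = 1.
    have : pi j * (pi j - 1) = 0 by rewrite mulrBr mulr1 pi2 subrr.
    by move=> /eqP; rewrite mulf_eq0 => /orP[/eqP|/eqP/subr0_eq]; [left|right].
  have pi0 : pi i = 0 by case: (pi01 i) => // e1; rewrite e1 subrr eqxx in pi1.
  pose b j := pi j == 0.
  have E1 : (fun h : H => h - p h) = mulf (fun j => ((b j)%:R : R)%:C).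
    have bb : bdd (fun j => ((b j)%:R : R)%:C).
      by exists 1 => j; rewrite n2C; case: (b j); rewrite ?expr1n ?expr0n /=.
    apply/funext => h; apply: co_ext => j; rewrite coB pE !mulfE // /b.
    case: (pi01 j) => ->; first by rewrite eqxx mul0r subr0 mul1r.
    by rewrite oner_eq0 mul1r subrr mul0r.
  have bb : bdd (fun j => ((b j)%:R : R)%:C).
    by exists 1 => j; rewrite n2C; case: (b j); rewrite ?expr1n ?expr0n /=.
  move: trp; rewrite E1 tr_real //= leNgt; apply/negP/negPn.
  apply: lt_le_trans dw _.
  have u0 k : 0 <= wt R m k * (b k)%:R by rewrite mulr_ge0 ?ler0n // ltW // wt_gt0.
  apply: le_trans (rsum_ge_part i.+1 (@asum_wtb R m b) u0).
  by rewrite big_ord_recr /= {2}/b pi0 eqxx mulr1 lerDr sumr_ge0.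
have [g gP le] := hp (basis i).
have gi : co g i = f i.
  by have := gP i; rewrite /= pE mulfE // piE basisE eqxx !mulr1.
rewrite /absf -gi; apply: le_trans (co_le g i) _.
move: le; rewrite !nrmE -rmorphM lecR.
rewrite nrm_basis.
by rewrite mulr1.
Qed.

Lemma measure_cvg_pt (P : nat -> nat -> C) f i :
  @measure_cvg R M (fun n => dg (P n)) (dg f) ->
  forall e : R, 0 < e -> exists N, forall n, (N <= n)%N -> absf (fun i => P n i - f i) i <= e.
Proof.
move=> cv e e0; have w0 := wt_gt0 R m i.
have d0 : 0 < wt R m i / 2 by rewrite divr_gt0.
have [N _ NP] := cv _ _ e0 d0; exists N => n Nn.
have := NP n Nn; rewrite add_opp_dg.
by apply: measure_nbhs_pt => //; rewrite ltr_pdivrMr // ltr_pMr // ltr1n.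
Qed.

Lemma real_limit (u : nat -> R) (z : C) :
  (forall e : R, 0 < e -> exists N, forall n, (N <= n)%N -> Num.sqrt (n2 ((u n)%:C - z)) <= e) ->
  u @ \oo --> Re z /\ complex.Im z = 0.
Proof.
move=> uz; split.
  apply/cvgrPdist_le => e /uz[N NP]; exists N => // n /= Nn.
  rewrite distrC; apply: le_trans (NP n Nn).
  by have := Re_le_sqrtn2 ((u n)%:C - z); case: z {uz NP} => a b.
apply/eqP; rewrite -normr_eq0 eq_le normr_ge0 andbT; apply/ler_addgt0Pr => e e0.
rewrite add0r; have [N /(_ N (leqnn N))] := uz e e0; apply: le_trans.
by have := Im_le_sqrtn2 ((u N)%:C - z); case: z {uz} => a b /=; rewrite sub0r normrN.
Qed.

Definition sqpart y n i : R := \sum_(k < n) n2 (y k i).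

Lemma psum_sq y n : op_psum (fun k => abs_sq (dg (y k))) n =
  dg (fun i => (sqpart y n i)%:C) :> op H.
Proof.
rewrite (_ : (fun k => _) = (fun k => dg (fun i => (n2 (y k i))%:C))); last first.
  by apply/funext => k; rewrite abs_sq_dg.
by rewrite psum_dg; congr dg; apply/funext => i; rewrite /sqpart rmorph_sum.
Qed.

(** Convergence in measure implies convergence at each atom, and the square
    root is unique. *)
Lemma square_norm_elem y (s r : op H) : @L0 R M s ->
  @measure_cvg R M (op_psum (fun k => abs_sq (dg (y k)))) s -> is_sqrt s r ->
  exists g : nat -> R, [/\ forall i, 0 <= g i, r = dg (fun i => (g i)%:C) &
    forall i, sqpart y n i @[n --> \oo] --> g i ^+ 2].
Proof.
move=> /affiliated_diag[f ->] cv sr.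
have cv' i : sqpart y n i @[n --> \oo] --> Re (f i) /\ complex.Im (f i) = 0.
  apply: real_limit => e e0.
  have cvf : @measure_cvg R M (fun n => dg (fun i => (sqpart y n i)%:C)) (dg f).
    by move: cv; congr (measure_cvg _ _); apply/funext => n; rewrite psum_sq.
  exact: measure_cvg_pt cvf e e0.
have f0 i : 0 <= Re (f i).
  rewrite -(cvg_lim (@Rhausdorff R) (proj1 (cv' i))); apply: limr_ge.
    by apply/cvg_ex; eexists; exact: (proj1 (cv' i)).
  by near=> n; apply: sumr_ge0 => k _; exact: n2_ge0.
have fE : f = (fun i => (Num.sqrt (Re (f i)) ^+ 2)%:C).
  apply/funext => i; rewrite sqr_sqrtr //; have [_] := cv' i.
  by case: (f i) => a b /= ->.
exists (fun i => Num.sqrt (Re (f i))); split=> [i||i]; first exact: sqrtr_ge0.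
  by apply: sqrt_dg_unique => [i|]; [exact: sqrtr_ge0|rewrite -fE].
by rewrite sqr_sqrtr //; exact: (proj1 (cv' i)).
Unshelve. all: by end_near. Qed.

Lemma sqpart_mono y n n' i : (n <= n')%N -> sqpart y n i <= sqpart y n' i.
Proof.
move=> nn; rewrite /sqpart (big_ord_widen n' (fun k => n2 (y k i)) nn) [leLHS]big_mkcond /=.
by apply: ler_sum => k _; case: ifP => // _; exact: n2_ge0.
Qed.

(** The infimum defining the norm is over at most one operator; its symbol
    dominates the partial sums. *)
Lemma square_norm_lt E y : symmetric_space E ->
  (@square_norm R M E (fun k => dg (y k)) < +oo)%E ->
  exists g : nat -> R, [/\ forall i, 0 <= g i, forall n i, sqpart y n i <= g i ^+ 2,
    Em E m g & @square_norm R M E (fun k => dg (y k)) = (Nm E m g)%:E].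
Proof.
move=> hE; rewrite /square_norm; set S := (X in ereal_inf X).
have uniq v v' : S v -> S v' -> v = v'.
  move=> [r [s [Ls cs sr]] <-] [r' [s' [Ls' cs' sr']] <-].
  have [g [g0 -> gc]] := square_norm_elem Ls cs sr.
  have [g' [g'0 -> gc']] := square_norm_elem Ls' cs' sr'.
  congr (@enorm R M E _); congr (@dg R H _); apply/funext => i; congr (_ %:C).
  have e : g i ^+ 2 = g' i ^+ 2 by exact: (cvg_unique (@Rhausdorff R) (gc i) (gc' i)).
  by apply/eqP; rewrite -(@eqrXn2 _ 2) // e.
have [->|/set0P[v Sv]] := eqVneq S set0; first by rewrite ereal_inf0 ltxx.
have -> : S = [set v] by apply/seteqP; split=> [u Su|u ->] //; exact: uniq.
rewrite ereal_inf1; case: Sv => r [s [Ls cs sr]] <-.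
have [g [g0 rg gc]] := square_norm_elem Ls cs sr; rewrite rg => fin.
have gn : (fun i => `|g i|) = g by apply/funext => i; rewrite ger0_norm.
have Eg : Em E m g by have := enorm_lt hE fin; rewrite absf_real gn.
exists g; split; [by []|move=> n i|by []|]; last first.
  by rewrite enorm_dg // absf_real gn.
rewrite -(cvg_lim (@Rhausdorff R) (gc i)).
apply: limr_ge; first by apply/cvg_ex; eexists; exact: (gc i).
by near=> k; apply: sqpart_mono; near: k; exact: nbhs_infty_ge.
Unshelve. all: by end_near. Qed.

Lemma measure_cvg_ev (X : nat -> op H) f N : (forall k, (N <= k)%N -> X k = dg f) ->
  @measure_cvg R M X (dg f).
Proof.
move=> Xf e d e0 d0; exists N => // k /= Nk; rewrite Xf // add_opp_dg.
have b1 : bdd (fun=> (1 : R)%:C) by exact: bdd_cst.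
have idE : (id : H -> H) = mulf (fun=> (1 : R)%:C).
  by apply/funext => h; apply: co_ext => i; rewrite mulfE // mul1r.
exists id; split.
- by rewrite idE; exact: dM_mulf.
- by split=> //; rewrite idE; exact: mulf_bounded.
- have b0 : bdd (fun=> (0 : R)%:C) by exact: bdd_cst.
  rewrite (_ : (fun h => _) = mulf (fun=> (0 : R)%:C)); last first.
    by apply/funext => h; apply: co_ext => i; rewrite mulfE // mul0r subrr co0.
  rewrite tr_real //= (_ : (fun i => _) = (fun=> 0)) ?rsum0 ?ltW //.
  by apply/funext => i; rewrite mulr0.
move=> h; exists 0; last by rewrite normr0 mulr_ge0 // ler0c ltW.
by move=> i /=; rewrite subrr mul0r co0.
Qed.

Lemma square_norm_le E y N : symmetric_space E ->
  (forall k i, (N <= k)%N -> y k i = 0) ->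
  Em E m (fun i => Num.sqrt (sqpart y N i)) ->
  (@square_norm R M E (fun k => dg (y k)) <= (Nm E m (fun i => Num.sqrt (sqpart y N i)))%:E)%E.
Proof.
move=> hE y0 Eg; set g := (fun i => Num.sqrt _) in Eg *.
have gn : (fun i => `|g i|) = g by apply/funext => i; rewrite ger0_norm ?sqrtr_ge0.
have sq0 n i : 0 <= sqpart y n i by apply: sumr_ge0 => k _; exact: n2_ge0.
apply: ereal_inf_lbound; exists (dg (fun i => (g i)%:C)); last first.
  by rewrite enorm_dg // absf_real gn.
exists (dg (fun i => (sqpart y N i)%:C)); split; first exact: L0_dg.
  apply: (@measure_cvg_ev _ _ N) => k Nk; rewrite psum_sq; congr dg; apply/funext => i.
  congr (_ %:C); rewrite /sqpart (big_ord_widen k (fun k => n2 (y k i)) Nk) [RHS]big_mkcond /=.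
  by apply: eq_bigr => j _; case: ltnP => // /y0 ->; rewrite n2_0.
rewrite (_ : (fun i => _) = (fun i => (g i ^+ 2)%:C)); last first.
  by apply/funext => i; rewrite /g sqr_sqrtr.
by apply: sqrt_dg => i; exact: sqrtr_ge0.
Qed.

End SquareFunctions.

(** * Dyadic filtrations and conditional expectations *)

Section BlockExpectation.
Variables (R : realType) (H : l2_model R) (m : nat).
Local Notation C := R[i].
Local Notation Re := (@complex.Re R).
Local Notation Im := (@complex.Im R).
Local Notation M := (diag_vna H (@wt_gt0 R m) (wt_asum R m) (wt_1 R m)).
Implicit Types (f : nat -> C) (b k : nat).

Definition blk b k := (k %/ 2 ^ b)%N.
Definition avg b f k : C :=
  ((2^-1) ^+ b)%:C * \sum_(j < 2 ^ b) f (blk b k * 2 ^ b + j)%N.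

Lemma avg_blk b f k k' : blk b k = blk b k' -> avg b f k = avg b f k'.
Proof. by rewrite /avg => ->. Qed.

Lemma blk_in b k j : (j < 2 ^ b)%N -> blk b (blk b k * 2 ^ b + j) = blk b k.
Proof. by move=> jb; rewrite /blk divnMDl ?expn_gt0 // (divn_small jb) addn0. Qed.

Lemma avg_id b f : (forall i j, blk b i = blk b j -> f i = f j) -> avg b f = f.
Proof.
move=> fc; apply/funext => k; rewrite /avg.
rewrite (eq_bigr (fun=> f k * (1 : R)%:C)) => [|j _]; last by rewrite mulr1; apply: fc; rewrite blk_in.
by rewrite -mulr_sumr -rmorph_sum mulrCA -rmorphM avg1 mulr1.
Qed.

Lemma sqrtn2_sum (I : finType) (F : I -> C) (K : R) :
  (forall i, Num.sqrt (n2 (F i)) <= K) -> Num.sqrt (n2 (\sum_i F i)) <= \sum_(i : I) K.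
Proof.
move=> FK; elim/big_ind2: _ => [|x1 x2 y1 y2 le1 le2|i _]; last exact: FK.
  by rewrite n2_0 sqrtr0.
by apply: le_trans (sqrtn2D _ _) _; exact: lerD.
Qed.

Lemma bdd_avg b f : bdd f -> bdd (avg b f).
Proof.
move=> [B fB]; exists ((\sum_(j < 2 ^ b) Num.sqrt B) ^+ 2) => k.
rewrite /avg n2M n2C -[leRHS]mul1r; apply: ler_pM; rewrite ?n2_ge0 ?sqr_ge0 //.
  have h1 : (2^-1 : R) ^+ b <= 1 by rewrite exprn_ile1 ?(ltW (half_gt0 _)) // invf_le1 ?ler1n.
  by rewrite exprn_ile1 // ltW // halfX_gt0.
rewrite -[leLHS]sqr_sqrtr ?n2_ge0 // ler_pXn2r ?nnegrE ?sqrtr_ge0 //.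
  by apply: sqrtn2_sum => j; rewrite ler_wsqrtr.
by apply: sumr_ge0 => j _; exact: sqrtr_ge0.
Qed.

Lemma avgZD b (c : C) f f' : avg b (fun k => c * f k + f' k) = (fun k => c * avg b f k + avg b f' k).
Proof.
apply/funext => k; rewrite /avg big_split /= -mulr_sumr; ring.
Qed.

Lemma avg_mod b s f v : (forall i j, blk b i = blk b j -> s i = s j) ->
  (forall i j, blk b i = blk b j -> v i = v j) ->
  avg b (fun k => s k * f k * v k) = (fun k => s k * avg b f k * v k).
Proof.
move=> sc vc; apply/funext => k; rewrite /avg.
rewrite (eq_bigr (fun j : 'I_(2 ^ b) => s k * v k * f (blk b k * 2 ^ b + j)%N)) => [|j _].
  by rewrite -mulr_sumr; ring.
rewrite (sc _ k) ?blk_in // (vc (_ + _)%N k) ?blk_in //; ring.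
Qed.

Lemma rsum_avg b (u v : nat -> R) : (b <= m)%N ->
  asummable (fun k => wt R m k * u k) -> asummable (fun k => wt R m k * v k) ->
  (forall k, v k = (2^-1) ^+ b * \sum_(j < 2 ^ b) u (blk b k * 2 ^ b + j)%N) ->
  rsum (fun k => wt R m k * v k) = rsum (fun k => wt R m k * u k).
Proof.
move=> bm su sv vE; have e := subnK bm; rewrite -e in su sv *.
have [-> _] := rsum_block (expn_gt0 2 b : (0 < 2 ^ b)%N) su.
have [-> _] := rsum_block (expn_gt0 2 b : (0 < 2 ^ b)%N) sv.
congr rsum; apply/funext => q.
rewrite (sum_wt_block (m - b) b q (fun j => u (q * 2 ^ b + j)%N)).
rewrite (sum_wt_block (m - b) b q (fun j => v (q * 2 ^ b + j)%N)).
congr (_ * (_ * _)); set U := (\sum_(j < _) u _).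
rewrite (eq_bigr (fun=> U * ((2^-1) ^+ b * 1))) => [|j _].
  by rewrite -mulr_sumr -mulr_sumr avg1 mulr1.
by rewrite mulr1 vE mulrC /blk divnMDl ?expn_gt0 // divn_small // addn0.
Qed.

Lemma Re_sum (I : finType) (F : I -> C) : Re (\sum_i F i) = \sum_i Re (F i).
Proof. by elim/big_rec2: _ => // i x y _ <-; case: (F i) y => a1 a2 []. Qed.
Lemma Im_sum (I : finType) (F : I -> C) : Im (\sum_i F i) = \sum_i Im (F i).
Proof. by elim/big_rec2: _ => // i x y _ <-; case: (F i) y => a1 a2 []. Qed.

Lemma tr_avg b f : (b <= m)%N -> bdd f -> tr M (mulf (avg b f)) = tr M (mulf f).
Proof.
move=> bm bf; have ba := bdd_avg b bf.
have trE f' : bdd f' -> tr M (mulf f') = csum (fun i => (wt R m i)%:C * f' i).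
  by move=> bf'; apply: dtr_mulf.
rewrite !trE // /csum.
have [sR sI] := csummable_w (@wt_gt0 R m) (wt_asum R m) bf; have [aR aI] := csummable_w (@wt_gt0 R m) (wt_asum R m) ba.
have RE f' : Re \o (fun i => (wt R m i)%:C * f' i) = (fun i => wt R m i * Re (f' i)).
  by apply/funext => i /=; case: (f' i) => x y /=; rewrite mul0r subr0.
have IE f' : Im \o (fun i => (wt R m i)%:C * f' i) = (fun i => wt R m i * Im (f' i)).
  by apply/funext => i /=; case: (f' i) => x y /=; rewrite mul0r addr0.
rewrite !RE !IE in sR sI aR aI *; congr (_ +i* _); apply: (@rsum_avg b) => // k; rewrite /avg.
  by rewrite -Re_sum; case: (\sum_(j < _) _) => x y /=; rewrite mul0r subr0.
by rewrite -Im_sum; case: (\sum_(j < _) _) => x y /=; rewrite mul0r addr0.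
Qed.

Definition symb (T : H -> H) : nat -> C := fun i => co (T (basis i)) i.
Lemma symb_mulf f : bdd f -> symb (mulf f : H -> H) = f.
Proof.
by move=> bf; apply/funext => i; rewrite /symb mulf_basis // coZ basisE eqxx mulr1.
Qed.

Definition blk_exp b (T : H -> H) : H -> H := mulf (avg b (symb T)).

Lemma blk_expE b f : bdd f -> blk_exp b (mulf f) = mulf (avg b f).
Proof. by move=> bf; rewrite /blk_exp symb_mulf. Qed.

(** Averaging over blocks preserves the trace because the weight is constant on
    blocks of length at most 2^m. *)
Lemma blk_cond_exp b : (b <= m)%N ->
  @cond_expectation R M (diag_alg (H := H) (blk b)) (blk_exp b).
Proof.
move=> bm; split.
- move=> T [f [bf _ ->]]; rewrite blk_expE //; exists (avg b f); split=> //.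
    exact: bdd_avg.
  by move=> i j; exact: avg_blk.
- move=> c S T [f [bf _ ->]] [f' [bf' _ ->]].
  have bl : bdd (fun i => c * f i + f' i) by apply: bddD => //; apply: bddM => //; exact: bdd_cst.
  have -> : (fun h : H => c *: mulf f h + mulf f' h) = mulf (fun i => c * f i + f' i).
    by apply/funext => h; apply: co_ext => i; rewrite coD coZ !mulfE //; ring.
  rewrite !blk_expE // avgZD; apply/funext => h; apply: co_ext => i.
  have ba := bdd_avg b bf; have ba' := bdd_avg b bf'.
  rewrite coD coZ !mulfE //; first ring.
  by apply: bddD => //; apply: bddM => //; exact: bdd_cst.
- by move=> T [f [bf fc ->]]; rewrite blk_expE // avg_id.
- move=> T [f [bf _ ->]]; rewrite blk_expE // !positive_mulf //; last exact: bdd_avg.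
  move=> f0 i; rewrite /avg mulr_ge0 //; last by apply: sumr_ge0 => j _; exact: f0.
  by rewrite ler0c ltW // halfX_gt0.
- move=> S T V [s [bs sc ->]] [f [bf _ ->]] [v [bv vc ->]].
  have bsf := bddM bs bf; have bsfv := bddM bsf bv; have ba := bdd_avg b bf.
  have bsa := bddM bs ba.
  have E u : bdd u -> (mulf s : H -> H) \o mulf u \o mulf v = mulf (fun k => s k * u k * v k).
    move=> bu; have bsu := bddM bs bu; have bsuv := bddM bsu bv.
    by apply/funext => h; apply: co_ext => i; rewrite /= !mulfE //; ring.
  by rewrite E // !blk_expE // E // avg_mod.
by move=> T [f [bf _ ->]]; rewrite blk_expE // tr_avg.
Qed.

(** The filtration is stationary from the index n on, where it is the whole
    algebra; this makes its union dense. *)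
Definition blk_filt n l : set (H -> H) := diag_alg (H := H) (blk (n - l)).

Lemma blk_filtration n : @filtration R M (blk_filt n).
Proof.
split.
- by move=> k; exact: diag_alg_vna.
- by move=> k T [f [bf _ ->]]; exact: dM_mulf.
- move=> k T [f [bf fc ->]]; exists f; split=> // i j ij; apply: fc.
  move: ij; have [le|lt] := leqP n k.
    have -> : (n - k.+1 = 0)%N by apply/eqP; rewrite subn_eq0 leqW.
    by have -> : (n - k = 0)%N by apply/eqP; rewrite subn_eq0.
  have -> : (n - k = (n - k.+1).+1)%N by rewrite subnSK.
  by rewrite /blk expnSr !divnMA => ->.
move=> T [f [bf _ ->]] N h g hg e e0; exists (mulf f).
  exists n => //; exists f; split=> // i j; rewrite /blk subnn expn0 !divn1.
  by move=> ->.
move=> i; near=> k; rewrite big1 ?normr0 // => j _.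
by rewrite subrr; exact: linear0l.
Unshelve. all: by end_near. Qed.

End BlockExpectation.

(** * The scalar form of the hypothesis *)

Section ScalarMartingales.
Variables (R : realType) (E : fspace R).
Hypothesis hE : symmetric_space E.
Implicit Types (c : nat -> R).

(** The differences are dominated by an element c of E, constant on the blocks of
    length 2^m, so that all the sums below belong to E; c need not be bounded. *)
Definition square_function_equiv (C : R) : Prop :=
  forall m n (x : nat -> nat -> R) c, (n <= m)%N -> nondec c -> Em E 0 c ->
    (forall l k, `|x l k| <= c (blk m k)) ->
    (forall l i j, blk (n - l) i = blk (n - l) j -> x l i = x l j) ->
    (forall l k, (l < n)%N ->
       \sum_(j < 2 ^ (n - l)) x l.+1 (blk (n - l) k * 2 ^ (n - l) + j)%N = 0) ->
    (forall l k, (n < l)%N -> x l k = 0) ->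
    let S k := \sum_(l < n.+1) x l k in
    let Q k := Num.sqrt (\sum_(l < n.+1) x l k ^+ 2) in
    [/\ Em E m S, Em E m Q, Nm E m S <= C * Nm E m Q & Nm E m Q <= C * Nm E m S].

Lemma Em_dom m c g (a : R) : Em E 0 c -> (forall i, 0 <= c i) ->
  (forall k, `|g k| <= a * c (blk m k)) -> Em E m g.
Proof.
move=> Ec c0 gc.
have [Eb _] : Em E m (fun k => c (blk m k)) /\ Nm E m (fun k => c (blk m k)) <= Nm E 0 c.
  apply: Em_mono => // s s0.
  by rewrite (wdist_block m (fun i => `|c i|)).
have [Ea _] := Em_scale hE a Eb.
have [] // := Em_le hE Ea (g := g) => k.
by apply: le_trans (gc k) _; exact: ler_norm.
Qed.

Section Fixed.
Variables (H : l2_model R) (m n : nat).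
Hypothesis nm : (n <= m)%N.
Local Notation C := R[i].
Local Notation M := (diag_vna H (@wt_gt0 R m) (wt_asum R m) (wt_1 R m)).
Local Notation rdg g := (dg (fun k => (g k : R)%:C) : op H).

Lemma graph_mulf (f : nat -> C) : bdd f -> graph_op (mulf f) = dg f :> op H.
Proof.
move=> bf; apply/seteqP; split=> -[h g] /=.
  by rewrite /graph_op /= => -> i /=; rewrite mulfE.
by move=> hg; apply: co_ext => i; rewrite mulfE // (hg i).
Qed.

Lemma blk_coarse b i : (b <= m)%N -> blk m i = blk (m - b) (blk b i).
Proof. by move=> bm; rewrite /blk -divnMA -expnD subnKC. Qed.

(** The extension of the conditional expectation to L_1 is defined by bounded
    approximants: the truncations to the first N blocks are bounded since c is
    nondecreasing, they have average 0 like x, and the L_1 norm of the rest is a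
    tail of the series of c. *)
Lemma martingale_dg (x : nat -> nat -> R) c :
  nondec c -> asummable (fun i => wt R 0 i * c i) ->
  (forall l k, `|x l k| <= c (blk m k)) ->
  (forall l i j, blk (n - l) i = blk (n - l) j -> x l i = x l j) ->
  (forall l k, \sum_(j < 2 ^ (n - l)) x l.+1 (blk (n - l) k * 2 ^ (n - l) + j)%N = 0) ->
  @martingale_differences R M (@blk_filt R H n) (fun l => rdg (x l)).
Proof.
move=> nc sc xc xa xz.
have c0 := proj1 nc.
split=> l.
  split; last by apply: dg_affiliated => i j ij; rewrite (xa l i j ij).
  apply: (proj1 (@L1_dom R H m (fun k => (x l k)%:C) c nc sc _)) => k.
  by rewrite (absf_real (x l)).
set b := (n - l)%N; have bm : (b <= m)%N by exact: leq_trans (leq_subr _ _) nm.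
pose t N k := if (blk m k < N)%N then x l.+1 k else 0.
have bt N : bdd (fun k => (t N k)%:C).
  exists (c N ^+ 2) => k; rewrite n2C /t; case: ifP => [kN|_]; last by rewrite expr0n sqr_ge0.
  rewrite -[leLHS]real_normK ?num_real // ler_pXn2r ?nnegrE ?normr_ge0 //.
  by apply: le_trans (xc _ _) _; apply: (proj2 nc); exact: ltnW.
exists (blk_exp b), (fun N => mulf (fun k => (t N k)%:C)); split.
- exact: blk_cond_exp.
- by move=> N; exact: dM_mulf.
- pose cN N i := if (i < N)%N then 0 else c i.
  have ncN N : nondec (cN N).
    split=> [i|i j ij]; rewrite /cN; first by case: ifP.
    case: ltnP => iN; case: ltnP => jN //; last exact: (proj2 nc).
    by have := leq_ltn_trans (leq_trans iN ij) jN; rewrite ltnn.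
  have scN N : asummable (fun i => wt R 0 i * cN N i).
    apply: asummable_le sc => i; rewrite /cN; case: ifP => _; last first.
      by rewrite ger0_norm ?mulr_ge0 // ltW // wt_gt0.
    by rewrite mulr0 normr0 mulr_ge0 // ltW // wt_gt0.
  have tail N : rsum (fun i => wt R 0 i * cN N i) =
      rsum (fun i => wt R 0 i * c i) - series (fun i => wt R 0 i * c i) N.
    have hd0 k : (N <= k)%N -> wt R 0 k * (if (k < N)%N then c k else 0) = 0.
      by rewrite ltnNge => ->; rewrite mulr0.
    rewrite seriesE_ord [X in _ - X](_ : _ = rsum (fun i => wt R 0 i * (if (i < N)%N then c i else 0))).
      rewrite -rsumN; last exact: asummable_fin hd0.
      rewrite -rsumD //; last by apply: asummableN; exact: asummable_fin hd0.
      congr rsum; apply/funext => i; rewrite /cN; case: ifP => _; ring.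
    by rewrite (rsum_fin hd0); apply: eq_bigr => i _; rewrite ltn_ord.
  have tail0 : rsum (fun i => wt R 0 i * cN N i) @[N --> \oo] --> 0.
    rewrite (_ : (fun N => _) = (fun N => rsum (fun i => wt R 0 i * c i) - series (fun i => wt R 0 i * c i) N)); last first.
      by apply/funext => N; exact: tail.
    rewrite -(subrr (rsum (fun i => wt R 0 i * c i))).
    by apply: cvgB; [exact: cvg_cst|exact: asummable_rsum].
  have tail0E : (rsum (fun i => wt R 0 i * cN N i))%:E @[N --> \oo] --> 0%:E.
    exact: (cvg_comp _ _ tail0).
  apply: (squeeze_cvge _ (@cvg_cst _ _ _ _ _) tail0E); near=> N.
  rewrite L1_norm_ge0 /= graph_mulf // add_opp_dg.
  apply: (proj2 (@L1_dom R H m (fun k => (t N k)%:C - (x l.+1 k)%:C) (cN N) (ncN N) (scN N) _)) => k.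
  rewrite /absf -rmorphB n2C sqrtr_sqr /t /cN -[(k %/ _)%N]/(blk m k).
  by case: ifP => _; rewrite ?subrr ?normr0 // sub0r normrN.
have avg0 N : avg b (fun k => (t N k)%:C) = (fun=> 0).
  apply/funext => k; rewrite /avg.
  have -> : \sum_(j < 2 ^ b) (t N (blk b k * 2 ^ b + j)%N)%:C =
      ((if (blk m k < N)%N then \sum_(j < 2 ^ b) x l.+1 (blk b k * 2 ^ b + j)%N else 0))%:C :> C.
    rewrite /t; case: ifP => kN; last first.
      by rewrite big1 // => j _; rewrite (blk_coarse _ bm) blk_in // -blk_coarse // kN.
    rewrite rmorph_sum; apply: eq_bigr => j _.
    by rewrite (blk_coarse _ bm) blk_in // -blk_coarse // kN.
  by case: ifP => _; rewrite ?(xz l k) mulr0.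
rewrite op0_dg; apply: (@L1_cvg_ev _ _ _ _ _ 0) => N _.
by rewrite blk_expE // avg0 graph_mulf //; exact: bdd_cst.
Unshelve. all: by end_near. Qed.

End Fixed.
End ScalarMartingales.

Section ScalarConsequence.
Variables (R : realType) (E : fspace R).
Hypothesis hE : symmetric_space E.
Local Notation C := R[i].

Lemma adj_real (g : nat -> R) (H : l2_model R) :
  adj (dg (fun k => (g k)%:C)) = dg (fun k => (g k)%:C) :> op H.
Proof. by rewrite adj_dg; congr dg; apply/funext => i; rewrite conjc_real. Qed.

Lemma enorm_ge0 (M : finite_vna R) (x : op M) : (0 <= enorm E x)%E.
Proof.
rewrite /enorm; case: asboolP => // -[_ Ex]; rewrite lee_fin.
exact: sym_norm_ge0 hE _ Ex.
Qed.

Lemma square_norm_ge0 (M : finite_vna R) (x : nat -> op M) : (0 <= square_norm E x)%E.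
Proof. by apply: le_ereal_inf_tmp => _ [r _ <-]; exact: enorm_ge0. Qed.

Lemma n2J (z : C) : n2 z^*%C = n2 z.
Proof. by case: z => a b; rewrite /n2 /= sqrrN. Qed.

Section Fixed.
Variables (m n : nat) (x : nat -> nat -> R) (c : nat -> R).
Hypothesis nm : (n <= m)%N.
Hypothesis nc : nondec c.
Hypothesis Ec : Em E 0 c.
Hypothesis xc : forall l k, `|x l k| <= c (blk m k).
Hypothesis xa : forall l i j, blk (n - l) i = blk (n - l) j -> x l i = x l j.
Hypothesis xz : forall l k, (l < n)%N ->
  \sum_(j < 2 ^ (n - l)) x l.+1 (blk (n - l) k * 2 ^ (n - l) + j)%N = 0.
Hypothesis x0 : forall l k, (n < l)%N -> x l k = 0.

Let H := ell2_model R.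
Let M := diag_vna H (@wt_gt0 R m) (wt_asum R m) (wt_1 R m).
Let X (l : nat) : op H := dg (fun k => (x l k)%:C).
Let S k := \sum_(l < n.+1) x l k.
Let Q k := Num.sqrt (\sum_(l < n.+1) x l k ^+ 2).

Lemma bg_filtration : @filtration R M (@blk_filt R H n).
Proof. exact: blk_filtration. Qed.

Lemma bg_martingale : @martingale_differences R M (@blk_filt R H n) X.
Proof.
apply: (martingale_dg H nm nc (Em_L1 hE nc Ec) xc xa) => l k.
have [ln|nl] := ltnP l n; first exact: xz.
by rewrite big1 // => j _; rewrite x0.
Qed.

Lemma bg_x_in k : @in_space R M E (X k).
Proof.
apply/in_space_dg => //; rewrite (absf_real (x k)).
by apply: (Em_dom hE Ec (proj1 nc) (a := 1)) => j; rewrite mul1r normr_id.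
Qed.

Lemma bg_S_bound k : `|S k| <= n.+1%:R * c (blk m k).
Proof.
apply: le_trans (ler_norm_sum _ _ _) _.
apply: (@le_trans _ _ (\sum_(l < n.+1) c (blk m k))); first by apply: ler_sum.
by rewrite sumr_const card_ord mulr_natl.
Qed.

Lemma bg_S_Em : Em E m S.
Proof. exact: (Em_dom hE Ec (proj1 nc) bg_S_bound). Qed.

Lemma bg_Q_Em : Em E m Q.
Proof.
apply: (Em_dom hE Ec (proj1 nc) (a := n.+1%:R)) => k.
have c0 := proj1 nc (blk m k).
rewrite ger0_norm ?sqrtr_ge0 // -[leRHS]ger0_norm ?mulr_ge0 // -sqrtr_sqr ler_wsqrtr //.
apply: (@le_trans _ _ (\sum_(l < n.+1) c (blk m k) ^+ 2)).
  apply: ler_sum => l _; rewrite -[leLHS]real_normK ?num_real //.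
  by rewrite ler_pXn2r ?nnegrE ?normr_ge0.
rewrite sumr_const card_ord exprMn -[leLHS]mulr_natl ler_wpM2r ?sqr_ge0 //.
by rewrite -natrX ler_nat expnS expn1 leq_pmull.
Qed.

Lemma bg_sqpart k : sqpart (fun l k => (x l k)%:C) n.+1 k = \sum_(l < n.+1) x l k ^+ 2.
Proof. by apply: eq_bigr => l _; rewrite n2C. Qed.

Lemma bg_sum_norm : @sum_norm R M E X = (Nm E m S)%:E.
Proof.
have SE : (fun k => \sum_(l < n.+1) (x l k)%:C) = (fun k => (S k)%:C).
  by apply/funext => k; rewrite rmorph_sum.
rewrite /X (@sum_norm_dg R H m E (fun l k => (x l k)%:C) n.+1).
- rewrite SE enorm_dg //; last by rewrite (absf_real S); have [] := Em_le hE bg_S_Em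
    (g := fun k => `|S k|) (fun k => eq_ler (normr_id _)).
  congr EFin; rewrite (absf_real S).
  apply/eqP; rewrite eq_le; apply/andP; split.
    by have [] := Em_le hE bg_S_Em (g := fun k => `|S k|) (fun k => eq_ler (normr_id _)).
  have [E1 _] := Em_le hE bg_S_Em (g := fun k => `|S k|) (fun k => eq_ler (normr_id _)).
  by have [] := Em_le hE E1 (g := S) (fun k => eq_ler (esym (normr_id _))).
- by move=> l k nl; rewrite x0.
rewrite SE; apply: (proj1 (@L1_dom R H m (fun k => (S k)%:C) (fun i => n.+1%:R * c i) _ _ _)).
- split=> [i|i j ij]; first by rewrite mulr_ge0 // (proj1 nc).
  by rewrite ler_wpM2l // (proj2 nc).
- apply: eq_asummable (asummableZ n.+1%:R (Em_L1 hE nc Ec)) => i; ring.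
by move=> k; rewrite (absf_real S); exact: bg_S_bound.
Qed.

Lemma bg_column_le : (@column_norm R M E X <= (Nm E m Q)%:E)%E.
Proof.
have e : Q = (fun k => Num.sqrt (sqpart (fun l k => (x l k)%:C) n.+1 k)).
  by apply/funext => k; rewrite bg_sqpart.
rewrite e; apply: square_norm_le => //; last by rewrite -e; exact: bg_Q_Em.
by move=> l k nl; rewrite x0.
Qed.

Lemma bg_row : @row_norm R M E X = @column_norm R M E X.
Proof. by rewrite /row_norm /column_norm; congr square_norm; apply/funext => l; exact: adj_real. Qed.

Lemma bg_column_ge : ((Nm E m Q)%:E <= @column_norm R M E X)%E.
Proof.
have fin : (@square_norm R M E (fun l => dg (fun k => (x l k)%:C) : op H) < +oo)%E.
  by apply: le_lt_trans bg_column_le _; rewrite ltry.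
have [g [g0 gs Eg gE]] := square_norm_lt hE fin.
rewrite /column_norm /X gE lee_fin.
have [] // := Em_le hE Eg (g := Q) => k.
rewrite !ger0_norm ?sqrtr_ge0 // /Q -bg_sqpart.
by rewrite -[leRHS]ger0_norm // -sqrtr_sqr ler_wsqrtr.
Qed.

Lemma bg_max_case : forall C0 : R, 0 < C0 ->
  equiv_up_to C0 (@sum_norm R M E X) (Order.max (@column_norm R M E X) (@row_norm R M E X)) ->
  Nm E m S <= C0 * Nm E m Q /\ Nm E m Q <= C0 * Nm E m S.
Proof.
move=> C0 C00; rewrite bg_row maxxx bg_sum_norm.
have -> : @column_norm R M E X = (Nm E m Q)%:E.
  by apply/eqP; rewrite eq_le bg_column_le bg_column_ge.
by move=> []; rewrite -!EFinM !lee_fin.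
Qed.

Lemma row_zero : (@row_norm R M E (fun=> dg (fun=> 0%:C) : op H) <= 0)%E.
Proof.
rewrite /row_norm (_ : (fun k => _) = (fun=> dg (fun=> 0%:C) : op H)); last first.
  by apply/funext => k; rewrite (adj_real (fun=> 0)).
have e : (fun i : nat => Num.sqrt (sqpart (fun _ _ => 0%:C : C) 0 i)) = (fun i => 0 * 1).
  by apply/funext => i; rewrite /sqpart big_ord0 sqrtr0 mul0r.
have E1 : Em E m (fun=> 1).
  apply: (Em_dom hE (Em_one hE) (a := 1)) => // k; rewrite mulr1 normr1 //.
have [E0 N0] := Em_scale hE 0 E1.
apply: le_trans (@square_norm_le R H m E (fun _ _ => 0%:C) 0 hE _ _) _ => //; rewrite e //.
by rewrite N0 normr0 mul0r.
Qed.

(** The decomposition x = x + 0. *)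
Lemma bg_decomposition_le : (@decomposition_norm R M E (@blk_filt R H n) X <= (Nm E m Q)%:E)%E.
Proof.
pose Z (l : nat) : op H := dg (fun=> 0%:C).
apply: (@le_trans _ _ (@column_norm R M E X + @row_norm R M E Z)%E).
  apply: ereal_inf_lbound; exists X, Z; split=> //; first exact: bg_martingale.
    apply: (martingale_dg (x := fun _ _ => 0) H nm nc (Em_L1 hE nc Ec)) => //.
    - by move=> l k; rewrite normr0; exact: (proj1 nc).
    - by move=> l k; rewrite big1.
  by move=> k; rewrite op_add_dg; congr dg; apply/funext => i; rewrite addr0.
rewrite -[leRHS]adde0; apply: leeD; [exact: bg_column_le|exact: row_zero].
Qed.

(** Pointwise |y + z|^2 <= 2 |y|^2 + 2 |z|^2, and the row and column square
    functions agree up to conjugation for diagonal operators. *)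
Lemma bg_decomposition_ge :
  ((2^-1 * Nm E m Q)%:E <= @decomposition_norm R M E (@blk_filt R H n) X)%E.
Proof.
apply: le_ereal_inf_tmp => _ [y [z [[my _] [mz _] xyz ->]]].
have diag (u : nat -> op H) : (forall k, @in_space R M (Lp01 1) (u k) /\
    affiliated (@blk_filt R H n k) (u k)) -> exists f : nat -> nat -> C, u = (fun k => dg (f k)).
  move=> mu; have ex k : exists f : nat -> C, u k = dg f.
    by have [[Lu _] _] := mu k; exact: affiliated_diag Lu.
  by have [f fP] := choice ex; exists f; apply/funext.
have [fy yE] := diag y my; have [fz zE] := diag z mz.
rewrite {}yE {}zE in my mz xyz *.
have xf l k : (x l k)%:C = fy l k + fz l k.
  have xl : (dg (fun k => (x l k)%:C) : op H) = dg (fun i => fy l i + fz l i).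
    by rewrite -op_add_dg; exact: xyz.
  exact: (congr1 (fun u => u k) (dg_inj xl)).
rewrite /column_norm /row_norm.
rewrite (_ : (fun k => adj (dg (fz k))) = (fun k => dg (fun i => (fz k i)^*%C) : op H)); last first.
  by apply/funext => k; rewrite adj_dg.
set a := @square_norm R M E _; set b := @square_norm R M E _.
have a0 : (0 <= a)%E by exact: square_norm_ge0.
have b0 : (0 <= b)%E by exact: square_norm_ge0.
have [afin|] := ltP a +oo%E; last first.
  by rewrite leye_eq => /eqP ->; rewrite addye ?leey // gt_eqF // (lt_le_trans _ b0) // ltNye.
have [bfin|] := ltP b +oo%E; last first.
  by rewrite leye_eq => /eqP ->; rewrite addey ?leey // gt_eqF // (lt_le_trans _ a0) // ltNye.
have [g [g0 gs Eg aE]] := square_norm_lt hE afin.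
have [g' [g'0 gs' Eg' bE]] := square_norm_lt hE bfin.
have -> : a = (Nm E m g)%:E by exact: aE.
have -> : b = (Nm E m g')%:E by exact: bE.
have [E1 N1] := Em_add hE Eg Eg'.
have [E2 N2] := Em_scale hE 2 E1.
have [_ N3] : Em E m Q /\ Nm E m Q <= Nm E m (fun k => 2 * (g k + g' k)).
  apply: Em_le => // k; rewrite !ger0_norm ?sqrtr_ge0 ?mulr_ge0 ?addr_ge0 //.
  rewrite /Q -[leRHS]ger0_norm ?mulr_ge0 ?addr_ge0 // -sqrtr_sqr ler_wsqrtr //.
  apply: (@le_trans _ _ (2 * sqpart fy n.+1 k + 2 * sqpart (fun l k => (fz l k)^*%C) n.+1 k)).
    rewrite /sqpart !mulr_sumr -big_split /=; apply: ler_sum => l _.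
    by rewrite -n2C xf n2J; exact: n2D.
  have := gs n.+1 k; have := gs' n.+1 k; have := mulr_ge0 (g0 k) (g'0 k).
  have := sqr_ge0 (g k); have := sqr_ge0 (g' k).
  by rewrite exprMn sqrrD; lra.
rewrite -EFinD lee_fin; move: N3; rewrite N2 ger0_norm //; lra.
Qed.

Lemma bg_decomposition_case : forall C0 : R, 0 < C0 ->
  equiv_up_to C0 (@sum_norm R M E X) (@decomposition_norm R M E (@blk_filt R H n) X) ->
  Nm E m S <= (2 * C0) * Nm E m Q /\ Nm E m Q <= (2 * C0) * Nm E m S.
Proof.
move=> C0 C00; rewrite bg_sum_norm => -[up dn].
have NQ := Nm_ge0 hE bg_Q_Em; have NS := Nm_ge0 hE bg_S_Em.
split.
  have C0N : 0 <= C0 * Nm E m Q by rewrite mulr_ge0 // ltW.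
  have : ((Nm E m S)%:E <= (C0 * Nm E m Q)%:E)%E.
    apply: le_trans up _; rewrite EFinM; apply: lee_wpmul2l; first by rewrite lee_fin ltW.
    exact: bg_decomposition_le.
  rewrite lee_fin; move: (C0 * _) C0N (mulrA 2 C0 (Nm E m Q)) => t t0 <-; lra.
have : ((2^-1 * Nm E m Q)%:E <= (C0 * Nm E m S)%:E)%E.
  by apply: le_trans bg_decomposition_ge _; rewrite EFinM.
rewrite lee_fin -(mulrA 2); move: (C0 * _) => t; lra.
Qed.

End Fixed.

(** For diagonal operators with real symbols the row and column norms both are the
    norm of the square function, and the infimum over all decompositions is
    between one half of that norm and the norm itself. *)
Lemma square_function_of_BG :
  BG_decomposition_equivalence E \/ BG_max_equivalence E ->
  exists2 C0 : R, 0 < C0 & square_function_equiv E C0.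
Proof.
case=> [[C0 C00 bg]|[C0 C00 bg]].
  exists (2 * C0); first by rewrite mulr_gt0.
  move=> m n x c nm nc Ec xc xa xz x0 S Q.
  have [a b] := bg_decomposition_case nm nc Ec xc xa xz x0 C00
    (bg _ _ _ (bg_filtration m n) (bg_martingale nm nc Ec xc xa xz x0) (bg_x_in nc Ec xc)).
  by split=> //; [exact: bg_S_Em nc Ec xc|exact: bg_Q_Em nc Ec xc].
exists C0 => // m n x c nm nc Ec xc xa xz x0 S Q.
have [a b] := bg_max_case nc Ec xc x0 C00
    (bg _ _ _ (bg_filtration m n) (bg_martingale nm nc Ec xc xa xz x0) (bg_x_in nc Ec xc)).
by split=> //; [exact: bg_S_Em nc Ec xc|exact: bg_Q_Em nc Ec xc].
Qed.

End ScalarConsequence.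

(** * Dilations of nondecreasing sequences *)

Section Shifts.
Variables (R : realType) (E : fspace R).
Hypothesis hE : symmetric_space E.
Implicit Types (c g phi : nat -> R).

(** On the step functions of nondecreasing sequences, shifting to the right is the
    compression t |-> 2^j t and shifting to the left is the dilation
    t |-> 2^-j t. *)
Definition shiftr j c : nat -> R := fun i => if (i < j)%N then 0 else c (i - j)%N.
Definition shiftl j c : nat -> R := fun i => c (i + j)%N.

Lemma shiftr_nondec j c : nondec c -> nondec (shiftr j c).
Proof.
move=> [c0 cm]; split=> [i|i k ik]; rewrite /shiftr; first by case: ifP.
case: ltnP => ij; case: ltnP => kj //; last by apply: cm; rewrite leq_sub2r.
by have := leq_ltn_trans (leq_trans ij ik) kj; rewrite ltnn.
Qed.

Lemma shiftl_nondec j c : nondec c -> nondec (shiftl j c).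
Proof. by move=> [c0 cm]; split=> [i|i k ik]; [exact: c0|apply: cm; rewrite leq_add2r]. Qed.

Lemma shiftr_add i j c : shiftr i (shiftr j c) = shiftr (i + j) c.
Proof.
apply/funext => k; rewrite /shiftr; case: ltnP => ki; first by rewrite ltn_addr.
by rewrite ltn_subLR // subnDA.
Qed.

Lemma wdist_shiftr j c s : nondec c -> 0 <= s ->
  wdist (wt R 0) (shiftr j c) s = (2^-1) ^+ j * wdist (wt R 0) c s.
Proof.
move=> nc s0; have [c0 cm] := nc.
have [ex|nex] := pselect (exists n, s < c n); last first.
  have cs i : c i <= s by rewrite leNgt; apply/negP => lt; apply: nex; exists i.
  rewrite !wdist_none ?mulr0 // => i; rewrite /shiftr; case: ifP => //.
case: (ex_minnP ex) => n sn min.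
have lo k : (k < n)%N -> c k <= s.
  by move=> kn; rewrite leNgt; apply/negP => /min; rewrite leqNgt kn.
have -> : wdist (wt R 0) c s = (2^-1) ^+ n.
  apply/eqP; rewrite eq_le wdist0_le // wdist0_ge // => k nk.
  exact: lt_le_trans sn (cm _ _ nk).
rewrite -exprD; apply/eqP; rewrite eq_le wdist0_le ?wdist0_ge // => k jk; rewrite /shiftr.
  have jk' : (j <= k)%N := leq_trans (leq_addr _ _) jk.
  rewrite ltnNge jk' /=; apply: lt_le_trans sn (cm _ _ _).
  by rewrite leq_subRL.
by case: ltnP => // kj; apply: lo; rewrite ltn_subLR.
Qed.

(** The tensor product of g and phi: every atom is cut in 2^n equal parts, on
    which the value of g is multiplied by the values of phi. *)
Definition tn n g phi k : R := g (blk n k) * phi (k %% 2 ^ n)%N.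

Lemma wdist_tn n c phi s : wdist (wt R n) (tn n c phi) s =
  rsum (fun q => wt R 0 q * ((2^-1) ^+ n * \sum_(j < 2 ^ n) (s < c q * phi j)%R%:R)).
Proof.
by have := @wdist_tens R 0 n (fun q j => c q * phi j) s; rewrite add0n.
Qed.

Lemma wdist_tn2 n c phi psi s : wdist (wt R (n + n)) (tn n (tn n c phi) psi) s =
  rsum (fun q => wt R 0 q * ((2^-1) ^+ n * \sum_(i < 2 ^ n)
    ((2^-1) ^+ n * \sum_(j < 2 ^ n) (s < c q * phi i * psi j)%R%:R))).
Proof.
have := @wdist_tens R n n (fun q j => tn n c phi q * psi j) s => ->.
pose G q i := (2^-1) ^+ n * \sum_(j < 2 ^ n) (s < c q * phi i * psi j)%R%:R : R.
have := @rsum_tens R 0 n G; rewrite add0n => <- //.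
have hG q i : 0 <= G q i <= 1.
  rewrite mulr_ge0 ?(ltW (halfX_gt0 _ _)) ?sumr_ge0 //= -(avg1 R n).
  rewrite ler_wpM2l ?(ltW (halfX_gt0 _ _)) //; apply: ler_sum => j _.
  by rewrite lern1 leq_b1.
apply: asummable_le (wt_asum R n) => k; have /andP[G0 G1] := hG (k %/ 2 ^ n)%N (k %% 2 ^ n)%N.
have w0 := ltW (wt_gt0 R n k).
by rewrite ger0_norm; [exact: ler_piMr|exact: mulr_ge0].
Qed.

Lemma sum_indicator n (P : pred nat) (F : nat -> bool) :
  (forall j, (j < n)%N -> P j -> F j) ->
  (\sum_(j < n) (P j : nat))%N%:R <= \sum_(j < n) (F j)%:R :> R.
Proof.
move=> PF; rewrite natr_sum; apply: ler_sum => j _; rewrite ler_nat.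
by case: (P j) (PF j (ltn_ord j)) => //= ->.
Qed.

Lemma norm_tn n c phi : (forall i, 0 <= c i) -> (forall i, 0 <= phi i) ->
  (fun k => `|tn n c phi k|) = tn n c phi.
Proof. by move=> c0 p0; apply/funext => k; rewrite ger0_norm // mulr_ge0. Qed.

Definition spike : nat -> R := fun j => (j == 0%N)%:R.
Lemma spike_ge0 j : 0 <= spike j. Proof. exact: ler0n. Qed.

Lemma sum_spike n (a s : R) : 0 <= s ->
  \sum_(j < 2 ^ n) (s < a * spike j)%R%:R = (s < a)%R%:R :> R.
Proof.
move=> s0; rewrite (bigD1 (Ordinal (expn_gt0 2 n : (0 < 2 ^ n)%N))) //= /spike eqxx mulr1.
rewrite big1 ?addr0 // => i i0.
by rewrite (negbTE (_ : (i != 0 :> nat)%N)) ?mulr0 ?(le_gtF s0).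
Qed.

Lemma shiftr_Em n c : nondec c -> Em E 0 c -> Em E 0 (shiftr n c) /\ Nm E 0 (shiftr n c) <= Nm E 0 c.
Proof.
move=> nc Ec; apply: Em_mono => // s s0.
rewrite !nondec_norm //; last exact: shiftr_nondec.
rewrite wdist_shiftr // ler_piMl ?wdist_ge0 //; [exact: wt_gt0|exact: wt_asum|].
by rewrite exprn_ile1 ?(ltW (half_gt0 _)) // invf_le1 ?ler1n.
Qed.

(** Keeping one part out of 2^n is compression by 2^n. *)
Lemma tn_spike n c : nondec c -> Em E 0 c ->
  Em E n (tn n c spike) /\ Nm E n (tn n c spike) = Nm E 0 (shiftr n c).
Proof.
move=> nc Ec; have [c0 cm] := nc; have nS := shiftr_nondec n nc.
have [ES _] := shiftr_Em n nc Ec.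
have eqd s : 0 <= s -> wdist (wt R n) (fun k => `|tn n c spike k|) s =
    wdist (wt R 0) (fun k => `|shiftr n c k|) s.
  move=> s0; rewrite (norm_tn _ c0 spike_ge0).
  rewrite (nondec_norm nS) wdist_shiftr // wdist_tn -rsumZ; last exact: asum_wtb.
  by congr rsum; apply/funext => q; rewrite sum_spike //; ring.
have [E1 N1] := Em_mono hE ES (fun s s0 => eq_ler (eqd s s0)).
have [_ N2] := Em_mono hE E1 (fun s s0 => eq_ler (esym (eqd s s0))).
by split=> //; apply/eqP; rewrite eq_le N1 N2.
Qed.

End Shifts.

(** * Compression: a Rademacher martingale *)

Section Rademacher.
Variables (R : realType) (E : fspace R).
Hypothesis hE : symmetric_space E.
Variable C : R.
Hypothesis C_gt0 : 0 < C.
Hypothesis sfe : square_function_equiv E C.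
Implicit Types (c g phi : nat -> R).

Lemma nondec_scale (a : R) c : 0 <= a -> nondec c -> nondec (fun i => a * c i).
Proof.
by move=> a0 [c0 cm]; split=> [i|i j ij]; [rewrite mulr_ge0|rewrite ler_wpM2l // cm].
Qed.

Lemma blk_blk a b k : blk a (blk b k) = blk (b + a) k.
Proof. by rewrite /blk -divnMA -expnD. Qed.

Lemma blk_mulD b q j : (j < 2 ^ b)%N -> blk b (q * 2 ^ b + j) = q.
Proof. by move=> jb; rewrite /blk divnMDl ?expn_gt0 // divn_small // addn0. Qed.

(** The l-th binary digit of the position in the block, as a sign. *)
Definition rade n l k : R := (-1) ^+ odd (blk (n - l) k).

Lemma sum_rade b q : \sum_(j < 2 ^ b.+1) (-1) ^+ odd (blk b (q * 2 ^ b.+1 + j)) = 0 :> R.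
Proof.
rewrite expnS (sum_block (fun j => (-1) ^+ odd (blk b (q * (2 * 2 ^ b) + j))%N)).
rewrite !big_ord_recr big_ord0 /= add0r.
have e i : \sum_(j < 2 ^ b) (-1) ^+ odd (blk b (q * (2 * 2 ^ b) + (i * 2 ^ b + j))%N) =
    \sum_(j < 2 ^ b) (-1) ^+ odd i :> R.
  apply: eq_bigr => j _; rewrite mulnA addnA -mulnDl blk_mulD //.
  by rewrite oddD oddM andbF.
by rewrite !e /= expr0 expr1 -big_split /= big1 // => j _; rewrite subrr.
Qed.

(** The differences are c r_l; on one part out of 2^n all signs are 1 and their
    sum is n c. *)
Lemma rademacher_shift n c : (0 < n)%N -> nondec c -> Em E 0 c ->
  n%:R * Nm E 0 (shiftr n c) <= C * (Num.sqrt n%:R * Nm E 0 c).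
Proof.
move=> n0 nc Ec; have [c0 cm] := nc.
pose x l k := if (0 < l <= n)%N then c (blk n k) * rade n l k else 0.
have xc l k : `|x l k| <= c (blk n k).
  rewrite /x; case: ifP => _; last by rewrite normr0.
  by rewrite normrM normrX normrN1 expr1n mulr1 ger0_norm.
have xa l i j : blk (n - l) i = blk (n - l) j -> x l i = x l j.
  move=> ij; rewrite /x /rade ij; case: ifP => // /andP[_ ln].
  by have e k : blk n k = blk l (blk (n - l) k); [rewrite blk_blk subnK|rewrite !e ij].
have xz l k : (l < n)%N ->
    \sum_(j < 2 ^ (n - l)) x l.+1 (blk (n - l) k * 2 ^ (n - l) + j)%N = 0.
  move=> ln; rewrite /x ln /=.
  have nl : (n - l = (n - l.+1).+1)%N by rewrite subnSK.
  rewrite (eq_bigr (fun j : 'I_(2 ^ (n - l)) => c (blk n k) *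
      rade n l.+1 (blk (n - l) k * 2 ^ (n - l) + j)%N)) => [|j _].
    by rewrite -mulr_sumr /rade nl sum_rade mulr0.
  congr (c _ * _); have e i : blk n i = blk l (blk (n - l) i) by rewrite blk_blk subnK // ltnW.
  by rewrite !e blk_mulD.
have x0 l k : (n < l)%N -> x l k = 0.
  by move=> nl; rewrite /x (leqNgt l n) nl andbF.
have [ES _ SQ _] := sfe (leqnn n) nc Ec xc xa xz x0.
have sumx k : \sum_(l < n.+1) x l k = c (blk n k) * \sum_(l < n) rade n l.+1 k.
  rewrite big_ord_recl /= {1}/x ltnn /= add0r mulr_sumr; apply: eq_bigr => l _.
  by rewrite /x /bump /= add1n ltn_ord.
have sumq k : Num.sqrt (\sum_(l < n.+1) x l k ^+ 2) = Num.sqrt n%:R * c (blk n k).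
  rewrite big_ord_recl /= {1}/x ltnn /= expr0n add0r.
  rewrite (eq_bigr (fun=> c (blk n k) ^+ 2)) => [|l _].
    by rewrite sumr_const card_ord -(mulr_natl (c (blk n k) ^+ 2)) sqrtrM ?ler0n // sqrtr_sqr ger0_norm.
  by rewrite /x /bump /= add1n ltn_ord exprMn /rade -exprM mulnC exprM sqrrN !expr1n mulr1.
have [EP NP] := tn_spike hE n nc Ec.
have [EP' NP'] := Em_scale hE n%:R EP.
rewrite -NP; apply: (@le_trans _ _ (Nm E n (fun k => \sum_(l < n.+1) x l k))).
  rewrite -[n%:R]ger0_norm // -NP'.
  have [] // := Em_le hE ES (g := fun k => n%:R * tn n c (@spike R) k) => k.
  rewrite sumx normrM /tn normrM mulrCA (normrM (c _)) ler_wpM2l // /spike.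
  have [k0|k0] := eqVneq (k %% 2 ^ n)%N 0%N; last by rewrite normr0 mulr0.
  rewrite normr1 mulr1 (eq_bigr (fun=> 1)) => [|l _]; first by rewrite sumr_const card_ord.
  rewrite /rade (_ : odd _ = false) ?expr0 // (divn_eq k (2 ^ n)) k0 addn0.
  have e : (2 ^ n = 2 ^ l.+1 * 2 ^ (n - l.+1))%N by rewrite -expnD subnKC.
  by rewrite {2}e mulnA -[(_ * _)%N]addn0 blk_mulD ?expn_gt0 // oddM expnS oddM /= andbF.
apply: le_trans SQ _; rewrite ler_pM2l //.
have [Eb Nb] : Em E n (fun k => c (blk n k)) /\ Nm E n (fun k => c (blk n k)) <= Nm E 0 c.
  by apply: Em_mono => // s s0; rewrite (wdist_block n (fun i => `|c i|)).
have [Es Ns] := Em_scale hE (Num.sqrt n%:R) Eb.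
rewrite (_ : (fun k => Num.sqrt _) = (fun k => Num.sqrt n%:R * c (blk n k))); last first.
  by apply/funext.
by rewrite Ns ger0_norm ?sqrtr_ge0 // ler_wpM2l ?sqrtr_ge0.
Qed.

(** Taking n with 2 C <= sqrt n. *)
Lemma compress_half : exists2 n, (0 < n)%N &
  forall c, nondec c -> Em E 0 c -> Nm E 0 (shiftr n c) <= 2^-1 * Nm E 0 c.
Proof.
pose n := (Num.truncn (4 * C ^+ 2)).+1; exists n => // c nc Ec.
have nC : 4 * C ^+ 2 < n%:R by exact: truncnS_gt.
have n0 : 0 < n%:R :> R by rewrite ltr0n.
have s0 : 0 < Num.sqrt n%:R :> R by rewrite sqrtr_gt0.
have := rademacher_shift (isT : (0 < n)%N) nc Ec.
have nn : n%:R = Num.sqrt n%:R * Num.sqrt n%:R :> R by rewrite -expr2 sqr_sqrtr // ltW.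
rewrite [X in X * _ <= _]nn -mulrA (mulrCA C) ler_pM2l // => le.
have N0 : 0 <= Nm E 0 (shiftr n c).
  by have [? <-] := tn_spike hE n nc Ec; exact: Nm_ge0.
have C2 : 2 * C <= Num.sqrt n%:R.
  rewrite -[leLHS]ger0_norm ?mulr_ge0 ?(ltW C_gt0) // -sqrtr_sqr ler_wsqrtr // exprMn.
  by apply: ltW; apply: le_lt_trans nC; rewrite ler_wpM2r ?sqr_ge0 //; lra.
have : 2 * C * Nm E 0 (shiftr n c) <= C * Nm E 0 c.
  by apply: le_trans le; rewrite ler_wpM2r.
rewrite -mulrA mulrCA ler_pM2l // => le2; lra.
Qed.

End Rademacher.

(** * Dilation: a multiplicative cascade *)

Section Cascade.
Variables (R : realType) (E : fspace R).
Hypothesis hE : symmetric_space E.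
Variable C : R.
Hypothesis C_gt0 : 0 < C.
Hypothesis sfe : square_function_equiv E C.
Implicit Types (c g phi : nat -> R).

(** A lower bound for the square function of the cascade at the position j; the
    division makes it 0 at j = 0, where the cascade concentrates. *)
Definition hyp n j : R := 2 ^+ n.-1 / j%:R.
Lemma hyp_ge0 n j : 0 <= hyp n j.
Proof. by rewrite divr_ge0 ?exprn_ge0. Qed.

(** The density 2^l of the first 2^(n-l) positions of each block of length 2^n,
    multiplied by g. *)
Definition casc n g l k : R := g (blk n k) * (2 ^+ l * (blk (n - l) k %% 2 ^ l == 0)%N%:R).

Lemma casc_step n g l k : (l < n)%N ->
  \sum_(j < 2 ^ (n - l)) casc n g l.+1 (blk (n - l) k * 2 ^ (n - l) + j)%N =
  \sum_(j < 2 ^ (n - l)) casc n g l k.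
Proof.
move=> ln; have nl : (n - l = (n - l.+1).+1)%N by rewrite subnSK.
set b := (n - l.+1)%N in nl *; set q := blk (n - l) k.
have gE j : (j < 2 ^ (n - l))%N -> g (blk n (q * 2 ^ (n - l) + j)%N) = g (blk n k).
  move=> jb; congr g; have e i : blk n i = blk l (blk (n - l) i) by rewrite blk_blk subnK // ltnW.
  by rewrite !e blk_mulD.
rewrite (eq_bigr (fun j : 'I_(2 ^ (n - l)) => g (blk n k) * (2 ^+ l.+1 *
    (blk b (q * 2 ^ (n - l) + j) %% 2 ^ l.+1 == 0)%N%:R))) => [|j _]; last first.
  by rewrite /casc gE.
rewrite -!mulr_sumr /casc sumr_const card_ord -/q nl [in LHS]expnS.
rewrite (sum_block (fun j => ((blk b (q * (2 * 2 ^ b) + j) %% 2 ^ l.+1 == 0)%N%:R : R))).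
rewrite !big_ord_recr big_ord0 /= add0r.
have e i : (i < 2)%N -> \sum_(j < 2 ^ b) ((blk b (q * (2 * 2 ^ b) + (i * 2 ^ b + j)) %% 2 ^ l.+1 == 0)%N%:R : R) =
    (2 ^ b)%N%:R * ((i == 0)%N && (q %% 2 ^ l == 0)%N)%:R.
  move=> i2; rewrite (eq_bigr (fun=> ((i == 0)%N && (q %% 2 ^ l == 0)%N)%:R)) => [|j _].
    by rewrite sumr_const card_ord mulr_natl.
  congr (_%:R); rewrite mulnA addnA -mulnDl blk_mulD //; congr nat_of_bool.
  rewrite -!/(dvdn _ _); case: i i2 => [|[|//]] _ /=.
    by rewrite addn0 mulnC expnS dvdn_pmul2l.
  apply/negP => d; have : (2 %| q * 2 + 1)%N by apply: dvdn_trans d; rewrite expnS dvdn_mulr.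
  by rewrite dvdn_addr ?dvdn_mull.
rewrite !e //= mulr0 addr0 -(mulr_natl (((_ == _) : bool)%:R)) [in RHS]expnS natrM exprS; ring.
Qed.

Lemma casc_atom n g l k : (l <= n)%N ->
  casc n g l k = g (blk n k) * (2 ^+ l * (k %% 2 ^ n < 2 ^ (n - l))%N%:R).
Proof.
move=> ln; congr (_ * (_ * _)); congr (_%:R); congr nat_of_bool.
rewrite /blk modn_divl -expnD subnKC //.
rewrite -leqn0 leqNgt divn_gt0 ?expn_gt0 //; by rewrite -ltnNge.
Qed.

(** The cascade stopped at n is 2^n times the spike.  At the position r with
    2^t <= r < 2^(t+1) the difference of index n - t is minus the last nonzero
    value of the cascade, namely 2^(n-t-1) >= 2^(n-1) / r. *)
Lemma cascade_bound p n g c (a : R) : (0 < n)%N -> nondec c -> Em E 0 c -> 0 <= a ->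
  (forall k, 0 <= g k) -> (forall k, g k <= a * c (blk p k)) ->
  Em E (p + n) (tn n g (hyp n)) /\
  Nm E (p + n) (tn n g (hyp n)) <= C * (2 ^+ n * Nm E (p + n) (tn n g (@spike R))).
Proof.
move=> n0 nc Ec a0 g0 gc; have [c0 cm] := nc.
pose x l k := if (l <= n)%N then casc n g l k - (if l is l'.+1 then casc n g l' k else 0) else 0.
pose A : R := 2 ^+ n * a.
have A0 : 0 <= A by rewrite mulr_ge0 ?exprn_ge0.
have cascb l k : (l <= n)%N -> 0 <= casc n g l k <= A * c (blk (p + n) k).
  move=> ln; have bE : blk (p + n) k = blk p (blk n k) by rewrite blk_blk addnC.
  pose z : R := 2 ^+ l * (blk (n - l) k %% 2 ^ l == 0)%N%:R.
  have z0 : 0 <= z by rewrite /z mulr_ge0 ?exprn_ge0.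
  have zn : z <= 2 ^+ n.
    apply: (@le_trans _ _ (2 ^+ l)); first by rewrite /z ler_piMr ?exprn_ge0 // lern1 leq_b1.
    by rewrite ler_eXn2l // ltr1n.
  rewrite /casc -/z; apply/andP; split; first by rewrite mulr_ge0.
  rewrite bE /A -mulrA mulrC; apply: ler_pM => //; exact: gc.
have nA := nondec_scale A0 nc; have [EA _] := Em_scale hE A Ec.
have xc l k : `|x l k| <= A * c (blk (p + n) k).
  rewrite /x; case: ifP => ln; last by rewrite normr0 mulr_ge0.
  have /andP[u0 uA] := cascb l k ln; case: l ln u0 uA => [|l] ln u0 uA.
    by rewrite subr0 ger0_norm.
  have /andP[v0 vA] := cascb l k (ltnW ln).
  by rewrite ler_norml; apply/andP; split; lra.
have gadapt l i j : (l <= n)%N -> blk (n - l) i = blk (n - l) j -> casc n g l i = casc n g l j.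
  move=> ln ij; have e k : blk n k = blk l (blk (n - l) k) by rewrite blk_blk subnK.
  by rewrite /casc !e ij.
have xa l i j : blk (n - l) i = blk (n - l) j -> x l i = x l j.
  move=> ij; rewrite /x; case: ifP => // ln; rewrite (gadapt l i j ln ij).
  case: l ln ij => [//|l] ln ij; congr (_ - _); apply: gadapt => //; first exact: ltnW.
  have -> : (n - l = n - l.+1 + 1)%N by rewrite addn1 subnSK.
  by rewrite -!blk_blk ij.
have xz l k : (l < n)%N ->
    \sum_(j < 2 ^ (n - l)) x l.+1 (blk (n - l) k * 2 ^ (n - l) + j)%N = 0.
  move=> ln; rewrite /x ln sumrB casc_step // -sumrB big1 // => j _.
  rewrite (gadapt l (blk (n - l) k * 2 ^ (n - l) + j)%N k) ?subrr //; first exact: ltnW.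
  by rewrite blk_mulD.
have x0 l k : (n < l)%N -> x l k = 0 by move=> nl; rewrite /x (leqNgt l n) nl.
have [ES EQ _ QS] := sfe (leq_addl p n) nA EA xc xa xz x0.
have sumx k : \sum_(l < n.+1) x l k = 2 ^+ n * tn n g (@spike R) k.
  have tele N : (N <= n)%N -> \sum_(l < N.+1) x l k = casc n g N k.
    elim: N => [|N IH] Nn; first by rewrite big_ord1 /x /= subr0.
    by rewrite big_ord_recr /= IH ?(ltnW Nn) // /x Nn addrC subrK.
  rewrite tele // casc_atom // subnn expn0 ltnS leqn0 /tn /spike; ring.
have qge k : tn n g (hyp n) k <= Num.sqrt (\sum_(l < n.+1) x l k ^+ 2).
  rewrite /tn; set r := (k %% 2 ^ n)%N.
  have [r0|r0] := posnP r; first by rewrite /hyp r0 invr0 !mulr0 sqrtr_ge0.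
  have rn : (r < 2 ^ n)%N by rewrite ltn_pmod // expn_gt0.
  have /andP[t1 t2] := trunc_log_bounds (isT : (1 < 2)%N) r0.
  set t := trunc_log 2 r in t1 t2.
  have tn : (t < n)%N by rewrite -(ltn_exp2l _ _ (isT : (1 < 2)%N)); exact: leq_ltn_trans t1 rn.
  pose l := (n - t)%N; have l0 : (0 < l)%N by rewrite subn_gt0.
  have ln : (l <= n)%N by exact: leq_subr.
  apply: (@le_trans _ _ (Num.sqrt (x l k ^+ 2))); last first.
    have lo : (l < n.+1)%N by rewrite ltnS.
    rewrite ler_wsqrtr // (bigD1 (Ordinal lo)) //= lerDl sumr_ge0 // => i _.
    exact: sqr_ge0.
  rewrite sqrtr_sqr /x ln; case El : l l0 ln => [//|l'] _ ln.
  have nl : (n - l'.+1 = t)%N by rewrite -El /l subKn // ltnW.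
  have nl' : (n - l' = t.+1)%N by rewrite -nl subnSK.
  rewrite !casc_atom ?(ltnW ln) // -/r nl nl' ltnNge t1 t2 /= mulr0 mulr0 sub0r normrN mulr1.
  rewrite ger0_norm ?mulr_ge0 ?exprn_ge0 // ler_wpM2l // /hyp ler_pdivrMr ?ltr0n //.
  have -> : n.-1 = (l' + t)%N.
    by have := nl'; have := ltnW ln; lia.
  by rewrite exprD ler_wpM2l ?exprn_ge0 // -natrX ler_nat.
have [EH NH] : Em E (p + n) (tn n g (hyp n)) /\ Nm E (p + n) (tn n g (hyp n)) <=
    Nm E (p + n) (fun k => Num.sqrt (\sum_(l < n.+1) x l k ^+ 2)).
  apply: Em_le => // k; rewrite !ger0_norm ?sqrtr_ge0 //.
  by rewrite mulr_ge0 // hyp_ge0.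
split=> //; apply: le_trans NH _; apply: le_trans QS _; rewrite ler_pM2l //.
have ge2 : 0 < 2 ^+ n :> R by rewrite exprn_gt0.
have SE : (fun k => \sum_(l < n.+1) x l k) = (fun k => 2 ^+ n * tn n g (@spike R) k) by apply/funext.
rewrite SE in ES *.
have Esp : Em E (p + n) (tn n g (@spike R)).
  have [+ _] := Em_scale hE (2 ^+ n)^-1 ES.
  suff -> : (fun k => (2 ^+ n)^-1 * (2 ^+ n * tn n g (@spike R) k)) = tn n g (@spike R) by [].
  by apply/funext => k; rewrite mulrA mulVf ?mul1r // gt_eqF.
by have [_ ->] := Em_scale hE (2 ^+ n) Esp; rewrite gtr0_norm.
Qed.

End Cascade.

(** * Two independent cascades *)

Section HyperbolicCount.

Lemma leq_sum_ord (F : nat -> nat) a b : (a <= b)%N ->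
  (\sum_(i < a) F i <= \sum_(i < b) F i)%N.
Proof.
move=> ab; rewrite (big_ord_widen b F ab) [leqLHS]big_mkcond /=.
by apply: leq_sum => i _; case: ifP.
Qed.

(** Dyadic decomposition of the positive integers below 2^m. *)
Lemma leq_sum_blocks (F : nat -> nat) m :
  (\sum_(l < m) \sum_(j < 2 ^ l) F (2 ^ l + j) <= \sum_(i < 2 ^ m) F i)%N.
Proof.
elim: m => [|m IH]; first by rewrite big_ord0.
rewrite big_ord_recr expnS mul2n -addnn big_split_ord /=.
by apply: leq_add => //; exact: IH.
Qed.

Lemma count_interval J M : (J < M)%N -> (J <= \sum_(j < M) ((0 < j <= J)%N : nat))%N.
Proof.
move=> JM; apply: leq_trans (leq_sum_ord (fun j => (0 < j <= J)%N : nat) JM).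
rewrite big_ord_recl /= add0n (eq_bigr (fun=> 1%N)) => [|i _].
  by rewrite sum_nat_const card_ord muln1.
by rewrite /bump /= add1n ltn_ord.
Qed.

(** For i in [2^l, 2^(l+1)[ all j <= 2^(N-1-l) are admissible; each of the N
    dyadic scales contributes 2^(N-1) pairs. *)
Lemma count_hyperbola N : (0 < N)%N ->
  (N * 2 ^ N.-1 <= \sum_(i < 2 ^ N.+1) \sum_(j < 2 ^ N.+1)
    ([&& 0 < i, 0 < j & i * j <= 2 ^ N]%N : nat))%N.
Proof.
move=> N0; pose F i := (\sum_(j < 2 ^ N.+1) ([&& 0 < i, 0 < j & i * j <= 2 ^ N]%N : nat))%N.
apply: leq_trans (leq_sum_blocks F N.+1).
rewrite big_ord_recr /=; apply: leq_trans (leq_addr _ _).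
rewrite -{1}[N]card_ord -sum_nat_const; apply: leq_sum => l _.
have lN : (l <= N.-1)%N by rewrite -ltnS prednK.
rewrite -(subnKC lN) expnD -{1}[(2 ^ l)%N]card_ord -sum_nat_const.
apply: leq_sum => i _; set J := (2 ^ (N.-1 - l))%N.
have JM : (J < 2 ^ N.+1)%N by rewrite ltn_exp2l //; lia.
apply: leq_trans (count_interval JM) _; rewrite /F; apply: leq_sum => j _.
case: andP => // -[j0 jJ]; rewrite j0 ltn_addr ?expn_gt0 //=.
suff -> : ((2 ^ l + i) * j <= 2 ^ N)%N by [].
have -> : (2 ^ N = 2 ^ l.+1 * J)%N by rewrite /J -expnD; congr (2 ^ _)%N; lia.
by apply: leq_mul => //; rewrite expnS mul2n -addnn leq_add2l ltnW.
Qed.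

End HyperbolicCount.

Section Expansion.
Variables (R : realType) (E : fspace R).
Hypothesis hE : symmetric_space E.
Variable C : R.
Hypothesis C_gt0 : 0 < C.
Hypothesis sfe : square_function_equiv E C.
Implicit Types (c g phi : nat -> R).

Lemma tn_ge0 n c phi : (forall i, 0 <= c i) -> (forall i, 0 <= phi i) -> forall i, 0 <= tn n c phi i.
Proof. by move=> c0 p0 i; rewrite mulr_ge0. Qed.

Lemma hyp_le n j : hyp R n j <= 2 ^+ n.-1.
Proof.
rewrite /hyp; case: j => [|j]; first by rewrite invr0 mulr0 exprn_ge0.
by rewrite ler_piMr ?exprn_ge0 // invf_le1 ?ler1n.
Qed.

(** The two coordinates play symmetric roles, so the cascade bound, which acts on
    the last coordinate, can be applied to each of them in turn. *)
Lemma wdist_tnC n c phi psi s :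
  wdist (wt R (n + n)) (tn n (tn n c phi) psi) s = wdist (wt R (n + n)) (tn n (tn n c psi) phi) s.
Proof.
rewrite !wdist_tn2; congr rsum; apply/funext => q; congr (_ * (_ * _)).
rewrite -!mulr_sumr exchange_big; congr (_ * _).
by apply: eq_bigr => i _; apply: eq_bigr => j _; rewrite mulrAC.
Qed.

(** The first cascade replaces the last hyperbola by a spike; after exchanging
    the coordinates, the second cascade does the same with the other one. *)
Lemma double_cascade n c : (0 < n)%N -> nondec c -> Em E 0 c ->
  Em E (n + n) (tn n (tn n c (hyp R n)) (hyp R n)) /\
  Nm E (n + n) (tn n (tn n c (hyp R n)) (hyp R n)) <=
    C ^+ 2 * (4 ^+ n * Nm E 0 (shiftr (n + n) c)).
Proof.
move=> n0 nc Ec; have [c0 cm] := nc.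
have h0 := @hyp_ge0 R n; have sp0 := @spike_ge0 R.
have spike1 j : spike R j <= 1 by rewrite /spike lern1 leq_b1.
have hc k : tn n c (hyp R n) k <= 2 ^+ n.-1 * c (blk n k).
  by rewrite /tn mulrC ler_wpM2r // hyp_le.
have sc k : tn n c (@spike R) k <= 1 * c (blk n k).
  by rewrite /tn mulrC ler_wpM2r.
have [E1 N1] := cascade_bound hE C_gt0 sfe n0 nc Ec (exprn_ge0 n.-1 (ler0n R 2)) (tn_ge0 n c0 h0) hc.
have [E2 N2] := cascade_bound hE C_gt0 sfe n0 nc Ec ler01 (tn_ge0 n c0 sp0) sc.
have nS := shiftr_nondec (n + n) nc.
have [ES _] := shiftr_Em hE (n + n) nc Ec.
have [_ N3] : Em E (n + n) (tn n (tn n c (hyp R n)) (@spike R)) /\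
    Nm E (n + n) (tn n (tn n c (hyp R n)) (@spike R)) <=
    Nm E (n + n) (tn n (tn n c (@spike R)) (hyp R n)).
  apply: Em_mono => // s s0; rewrite !norm_tn //; try exact: tn_ge0.
  by rewrite wdist_tnC.
have [_ N4] : Em E (n + n) (tn n (tn n c (@spike R)) (@spike R)) /\
    Nm E (n + n) (tn n (tn n c (@spike R)) (@spike R)) <= Nm E 0 (shiftr (n + n) c).
  apply: Em_mono => // s s0; rewrite !norm_tn //; try exact: tn_ge0.
  rewrite (nondec_norm nS) wdist_shiftr // wdist_tn2 -rsumZ; last exact: asum_wtb.
  apply: eq_ler; congr rsum; apply/funext => q.
  rewrite (eq_bigr (fun i : 'I_(2 ^ n) => (2^-1) ^+ n * (s < c q * spike R i)%R%:R)) => [|i _].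
    by rewrite -mulr_sumr sum_spike // exprD; ring.
  by rewrite sum_spike.
split=> //; apply: le_trans N1 _; rewrite expr2 -mulrA ler_pM2l //.
have -> : 4 ^+ n = 2 ^+ n * 2 ^+ n :> R by rewrite -exprMn -natrM.
have p0 : 0 < 2 ^+ n :> R by rewrite exprn_gt0.
rewrite -[X in _ <= C * X]mulrA mulrCA ler_pM2l //.
apply: le_trans N3 _; apply: le_trans N2 _.
by rewrite ler_pM2l // ler_pM2l.
Qed.

(** At the positions i, j with i j <= 2^(n-1) the product of the hyperbolas is at
    least 2^(n-1); by the previous count these positions have relative measure
    at least 2^-s. *)
Lemma hyperbola_lower n s c : (n.-1 * 2 ^ n.-2 * 2 ^ s = 4 ^ n)%N -> (1 < n)%N -> nondec c -> Em E 0 c ->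
  Em E (n + n) (tn n (tn n c (hyp R n)) (hyp R n)) ->
  2 ^+ n.-1 * Nm E 0 (shiftr s c) <= Nm E (n + n) (tn n (tn n c (hyp R n)) (hyp R n)).
Proof.
move=> ns n1 nc Ec Eh; have [c0 cm] := nc; have h0 := @hyp_ge0 R n.
have [ES _] := shiftr_Em hE s nc Ec; have nS := shiftr_nondec s nc.
have n0 : (0 < n)%N := ltnW n1.
pose A : R := 2 ^+ n.-1; have A0 : 0 < A by rewrite exprn_gt0.
have [_ NA] := Em_scale hE A ES; rewrite -/A -{1}(gtr0_norm A0) -NA.
suff [] : Em E 0 (fun k => A * shiftr s c k) /\ Nm E 0 (fun k => A * shiftr s c k) <=
  Nm E (n + n) (tn n (tn n c (hyp R n)) (hyp R n)) by [].
apply: Em_mono => // t t0; rewrite norm_tn //; last exact: tn_ge0.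
rewrite (nondec_norm (nondec_scale (ltW A0) nS)) wdist_tn2.
have -> : wdist (wt R 0) (fun k => A * shiftr s c k) t = wdist (wt R 0) (shiftr s c) (t / A).
  by rewrite /wdist; congr rsum; apply/funext => k; rewrite ltr_pdivrMr // (mulrC A).
rewrite wdist_shiftr ?divr_ge0 ?(ltW A0) // /wdist -rsumZ; last exact: asum_wtb.
pose T q : R := (2^-1) ^+ n * \sum_(i < 2 ^ n) ((2^-1) ^+ n * \sum_(j < 2 ^ n) (t < c q * hyp R n i * hyp R n j)%R%:R).
have T01 q : 0 <= T q <= 1.
  have bd (G : nat -> R) : (forall i, 0 <= G i <= 1) -> 0 <= (2^-1) ^+ n * \sum_(i < 2 ^ n) G i <= 1.
    move=> G01; rewrite mulr_ge0 ?(ltW (halfX_gt0 _ _)) ?sumr_ge0 //=; last first.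
      by move=> i _; case/andP: (G01 i).
    apply: le_trans (eq_ler (avg1 R n)); rewrite ler_wpM2l ?(ltW (halfX_gt0 _ _)) //.
    by apply: ler_sum => i _; case/andP: (G01 i).
  apply: (bd (fun i => (2^-1) ^+ n * \sum_(j < 2 ^ n) (t < c q * hyp R n i * hyp R n j)%R%:R)) => i.
  apply: (bd (fun j => (t < c q * hyp R n i * hyp R n j)%R%:R)) => j.
  by rewrite ler0n lern1 leq_b1.
have w0 q := ltW (wt_gt0 R 0 q).
apply: rsum_le.
- by apply: asummableZ; exact: asum_wtb.
- apply: asummable_le (wt_asum R 0) => q; have /andP[T0 T1] := T01 q.
  by rewrite -/(T q) ger0_norm; [exact: ler_piMr|exact: mulr_ge0].
move=> q; rewrite mulrCA ler_wpM2l // -/(T q).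
have [le|lt] := leP (c q) (t / A); first by rewrite mulr0; case/andP: (T01 q).
rewrite mulr1 /T -mulr_sumr mulrA -expr2 -exprM.
have lt' : t < c q * A by rewrite -ltr_pdivrMr.
have key : (n.-1 * 2 ^ n.-2)%N%:R <=
    \sum_(i < 2 ^ n) \sum_(j < 2 ^ n) (t < c q * hyp R n i * hyp R n j)%R%:R :> R.
  have n10 : (0 < n.-1)%N by rewrite -ltnS prednK.
  have := count_hyperbola n10; rewrite prednK // -(ler_nat R) => /le_trans; apply.
  rewrite natr_sum; apply: ler_sum => i _.
  apply: (@sum_indicator R (2 ^ n) (fun j => [&& 0 < i, 0 < j & i * j <= 2 ^ n.-1]%N)
     (fun j => t < c q * hyp R n i * hyp R n j)) => j jn /and3P[i0 j0 ij].
  apply: lt_le_trans lt' _; rewrite -mulrA ler_wpM2l // /hyp -/A mulrACA.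
  rewrite -invfM -natrM ler_pdivlMr ?ltr0n ?muln_gt0 ?i0 //.
  by rewrite ler_pM2l // /A -natrX ler_nat.
apply: le_trans (ler_wpM2l _ key); last exact: ltW (halfX_gt0 _ _).
rewrite -(ler_pM2r (_ : 0 < (2 ^ s)%N%:R)) ?ltr0n ?expn_gt0 //.
rewrite -mulrA -natrM ns natrX exprVn mulVf ?expf_neq0 ?pnatr_eq0 //.
rewrite natrX mulnC exprM -exprMn (_ : _ ^+ 2 * _ = 1) ?expr1n //; by field.
Qed.

(** With n = 2^a + 1 the two previous bounds compare the shifts by n + 2 - a and
    by 2 n with the constant 8 C^2 2^-a, relative to the trivial bound 2^r for
    the loss from a dilation by 2^r; a large a makes it less than 1/2. *)
Lemma expand_half : exists2 sr : nat * nat, (0 < sr.2)%N &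
  forall c, nondec c -> Em E 0 c ->
    Nm E 0 (shiftr sr.1 c) <= 2^-1 * (2 ^+ sr.2 * Nm E 0 (shiftr (sr.1 + sr.2) c)).
Proof.
pose a := (Num.truncn (16 * C ^+ 2)).+1.
have aC : 16 * C ^+ 2 <= 2 ^+ a.
  apply: ltW; apply: lt_le_trans (truncnS_gt _) _.
  by rewrite -natrX ler_nat ltnW // ltn_expl.
pose n := (2 ^ a).+1; have a1 : (1 < 2 ^ a)%N by rewrite -[1%N](expn0 2) ltn_exp2l.
have an : (a < n)%N by rewrite ltnS ltnW // ltn_expl.
have n1 : (1 < n)%N by rewrite ltnS ltnW.
have n2 : (2 < n)%N by rewrite ltnS.
exists ((n + 2 - a)%N, (n - 2 + a)%N) => [|c nc Ec] /=; first by lia.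
have [Eh Nh] := double_cascade (ltnW n1) nc Ec.
have ns : (n.-1 * 2 ^ n.-2 * 2 ^ (n + 2 - a) = 4 ^ n)%N.
  rewrite /n /= -!expnD -/n (_ : 4 = 2 ^ 2)%N // -expnM; congr (2 ^ _)%N; lia.
have := hyperbola_lower ns n1 nc Ec Eh.
have -> : (n + 2 - a + (n - 2 + a) = n + n)%N by lia.
have N0 : 0 <= Nm E 0 (shiftr (n + n) c) by apply: Nm_ge0; case: (shiftr_Em hE (n + n) nc Ec).
move: N0 Nh; set X := Nm E 0 (shiftr (n + n) c); set Y := Nm E 0 _.
set Z := Nm E (n + n) _ => X0 ZX YZ.
have p0 k : 0 < 2 ^+ k :> R by rewrite exprn_gt0.
rewrite -(ler_pM2l (p0 n.-1)); apply: le_trans YZ _; apply: le_trans ZX _.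
rewrite -(ler_pM2l (ltr0n R 2)).
have -> : 2 * (2 ^+ n.-1 * (2^-1 * (2 ^+ (n - 2 + a) * X))) = 2 ^+ (n.-1 + (n - 2)) * (2 ^+ a * X) :> R.
  by rewrite !exprD; field.
have -> : 4 ^+ n = 8 * 2 ^+ (n.-1 + (n - 2)) :> R.
  have -> : 4 = 2 ^+ 2 :> R by rewrite -natrX.
  have -> : 8 = 2 ^+ 3 :> R by rewrite -natrX.
  by rewrite -exprM -exprD; congr (2 ^+ _); lia.
have -> : 2 * (C ^+ 2 * (8 * 2 ^+ (n.-1 + (n - 2)) * X)) = 2 ^+ (n.-1 + (n - 2)) * (16 * C ^+ 2 * X) by ring.
by rewrite ler_pM2l // ler_wpM2r.
Qed.
End Expansion.

(** * Geometric bounds for dyadic dilations *)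

Section GeometricDecay.
Variable R : realType.

Lemma bernoulli_half n : (0 < n)%N -> exists2 r : R, 0 < r < 1 & 2^-1 <= r ^+ n.
Proof.
move=> n0; have N0 : 0 < n%:R :> R by rewrite ltr0n.
have N1 : 1 <= n%:R :> R by rewrite ler1n.
pose h : R := (2 * n%:R)^-1; have h0 : 0 < h by rewrite invr_gt0 mulr_gt0.
have h1 : h <= 2^-1 by rewrite lef_pV2 ?posrE ?mulr_gt0 // ler_peMr.
exists (1 - h); first by apply/andP; split; lra.
have B m : 1 - m%:R * h <= (1 - h) ^+ m.
  elim: m => [|m IH]; first by rewrite mul0r subr0.
  rewrite exprS; apply: le_trans (ler_wpM2l _ IH); last by lra.
  have m0 : 0 <= m%:R :> R by []; rewrite -natr1; nra.
apply: le_trans (B n); rewrite /h invfM mulrCA divff ?gt_eqF //; lra.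
Qed.

Lemma reversal_index (i j r s : nat) : (s <= j)%N -> (r + i <= j - s)%N ->
  (s + (j - s - (r + i)) = j - (r + i))%N /\ (j - (r + i) + r = j - i)%N.
Proof. by lia. Qed.

Lemma geometric_decay n (u : nat -> R) r : (0 < n)%N -> 0 < r < 1 -> 2^-1 <= r ^+ n ->
  (forall j, 0 <= u j) -> (forall j, u j.+1 <= u j) -> (forall j, u (n + j)%N <= 2^-1 * u j) ->
  forall j, u j <= 2 * r ^+ j * u 0%N.
Proof.
move=> n0 /andP[r0 r1] rn u0 um un j.
have u_le k : u k <= u 0%N by elim: k => // k IH; exact: le_trans (um k) IH.
have blocks q k : u (q * n + k)%N <= r ^+ (q * n) * u k.
  elim: q => [|q IH]; first by rewrite expr0 mul1r.
  rewrite mulSn -addnA exprD -mulrA; apply: le_trans (un _) _.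
  by apply: ler_pM => //; rewrite ?invr_ge0.
rewrite {1 2}(divn_eq j n) exprD; set k := (j %% n)%N.
apply: le_trans (blocks _ _) _; rewrite -mulrA mulrCA -!mulrA ler_pM2l ?exprn_gt0 //.
apply: le_trans (u_le k) _; rewrite mulrA ler_peMl //.
have kn : (k <= n)%N by rewrite ltnW // ltn_pmod.
have : r ^+ n <= r ^+ k by rewrite ler_wiXn2l // ?ltW.
lra.
Qed.

End GeometricDecay.

Section Exponents.
Variables (R : realType) (E : fspace R).
Hypothesis hE : symmetric_space E.
Variable C : R.
Hypothesis C_gt0 : 0 < C.
Hypothesis sfe : square_function_equiv E C.
Implicit Types (c : nat -> R).

(** A sequence is the sum of two disjoint copies of its compression by 2. *)
Lemma Nm_shiftr1 c : nondec c -> Em E 0 (shiftr 1 c) ->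
  Em E 0 c /\ Nm E 0 c <= 2 * Nm E 0 (shiftr 1 c).
Proof.
move=> nc ES; have [c0 cm] := nc; have nS := shiftr_nondec 1 nc.
pose G j := tn 1 c (fun i => (i == j)%:R).
have EG j : (j < 2)%N -> Em E 1 (G j) /\ Nm E 1 (G j) <= Nm E 0 (shiftr 1 c).
  move=> j2; apply: Em_mono => // s s0; rewrite /G norm_tn // (nondec_norm nS) wdist_shiftr //.
  rewrite wdist_tn -rsumZ; last exact: asum_wtb.
  apply: eq_ler; congr rsum; apply/funext => q.
  rewrite (bigD1 (Ordinal (j2 : (j < 2 ^ 1)%N))) //= eqxx mulr1 big1 => [|i ij].
    by rewrite addr0; ring.
  by rewrite (negbTE (_ : (i != j :> nat))) ?mulr0 ?(le_gtF s0).
have [E1 N1] := Em_sum hE (isT : (0 < 2)%N) (fun j j2 => proj1 (EG j j2)).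
have [Ec N2] : Em E 0 c /\ Nm E 0 c <= Nm E 1 (fun k => \sum_(j < 2) G j k).
  apply: Em_mono => // s s0; rewrite -(@wdist_block R 1 (fun i => `|c i|)).
  apply: eq_ler; congr wdist; apply/funext => k; congr (`| _ |).
  rewrite !big_ord_recr big_ord0 /= add0r /G /tn.
  have := ltn_pmod k (isT : (0 < 2 ^ 1)%N).
  by case: (k %% 2 ^ 1)%N => [|[|//]] _ /=; rewrite !(mulr0, mulr1) ?addr0 ?add0r.
split=> //; apply: le_trans N2 _; apply: le_trans N1 _.
rewrite !big_ord_recr big_ord0 /= add0r.
by have [_ a] := EG 0%N isT; have [_ b] := EG 1%N isT; lra.
Qed.

(** Strict inequalities between the dilation exponents and their trivial values
    1 and 2, that is, nontrivial Boyd indices.  For the dilations one compresses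
    back: t i = 2^i N(shiftr i b) is nondecreasing and doubles in every r steps
    after the index s, while shiftr j (shiftl j c) <= c. *)
Lemma dilation_bounds : exists r : R * R * R, let: (rho, sigma, K) := r in
  [/\ 0 < rho < 1, 0 < sigma < 2, 0 < K &
   forall c, nondec c -> Em E 0 c -> forall j,
     [/\ Nm E 0 (shiftr j c) <= K * rho ^+ j * Nm E 0 c, Em E 0 (shiftl j c) &
         Nm E 0 (shiftl j c) <= K * sigma ^+ j * Nm E 0 c]].
Proof.
have [n n0 comp] := compress_half hE C_gt0 sfe.
have [[s r] /= r0 expd] := expand_half hE C_gt0 sfe.
have [rho hrho rhon] := bernoulli_half R n0.
have [tau htau taur] := bernoulli_half R r0.
have /andP[t0 t1] := htau.
have K1 : 1 <= (tau ^+ s)^-1 by rewrite invf_ge1 ?exprn_gt0 // exprn_ile1 // ltW.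
exists (rho, 2 * tau, 2 * (tau ^+ s)^-1); split=> //.
- by apply/andP; split; lra.
- by rewrite mulr_gt0 // invr_gt0 exprn_gt0.
move=> c nc Ec j; have N0 := Nm_ge0 hE Ec.
have ES c' (nc' : nondec c') (Ec' : Em E 0 c') i := shiftr_Em hE i nc' Ec'.
have shiftSr c' i : shiftr i.+1 c' = shiftr 1 (shiftr i c') by rewrite shiftr_add.
have lower : Nm E 0 (shiftr j c) <= 2 * rho ^+ j * Nm E 0 c.
  have -> : Nm E 0 c = Nm E 0 (shiftr 0 c).
    by congr (Nm E 0 _); apply/funext => i; rewrite /shiftr /= subn0.
  apply: (geometric_decay n0 hrho rhon (u := fun i => Nm E 0 (shiftr i c))) => i.
  - by apply: Nm_ge0 => //; case: (ES c nc Ec i).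
  - rewrite shiftSr; have [Ei _] := ES c nc Ec i.
    by case: (ES _ (shiftr_nondec i nc) Ei 1%N).
  - rewrite -shiftr_add; have [Ei _] := ES c nc Ec i.
    exact: comp (shiftr_nondec i nc) Ei.
have rj0 : 0 <= rho ^+ j by case/andP: hrho => /ltW ? _; exact: exprn_ge0.
have nL := shiftl_nondec j nc; set b := shiftl j c in nL *.
have [ESb NSb] : Em E 0 (shiftr j b) /\ Nm E 0 (shiftr j b) <= Nm E 0 c.
  have [c0 cm] := nc; apply: Em_le => // k; rewrite /shiftr /b /shiftl; case: ltnP => jk.
    by rewrite normr0.
  by rewrite subnK.
have Eb : Em E 0 b.
  move: ESb; elim: (j) => [|i IH] Ei.
    suff <- : shiftr 0 b = b by [].
    by apply/funext => k; rewrite /shiftr /= subn0.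
  apply: IH; move: Ei; rewrite shiftSr.
  by move=> /(Nm_shiftr1 (shiftr_nondec i nL)) [].
split=> //.
  apply: le_trans lower _; rewrite ler_wpM2r // ler_wpM2r //; lra.
pose t i := 2 ^+ i * Nm E 0 (shiftr i b) : R.
have t0' i : 0 <= t i by rewrite mulr_ge0 ?exprn_ge0 //; apply: Nm_ge0; case: (ES b nL Eb i).
have tm i : t i <= t i.+1.
  rewrite /t shiftSr exprSr -mulrA ler_pM2l ?exprn_gt0 //.
  have [Ei _] := ES b nL Eb i; have ni := shiftr_nondec i nL.
  have [E1 _] := ES _ ni Ei 1%N.
  by have [] := Nm_shiftr1 ni E1.
have t_mono i k : (i <= k)%N -> t i <= t k.
  by move/subnK => <-; elim: (k - i)%N => // d IH; rewrite addSn; exact: le_trans IH (tm _).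
have te k : t (s + k)%N <= 2^-1 * t (s + k + r)%N.
  have [Ei _] := ES b nL Eb k; have ni := shiftr_nondec k nL.
  have := expd _ ni Ei; rewrite !shiftr_add => e.
  rewrite /t addnAC !exprD.
  have := ler_wpM2l (exprn_ge0 (s + k) (ler0n R 2)) e; rewrite !exprD => /le_trans; apply.
  by apply: eq_ler; field.
have jt : Nm E 0 b <= 2 * (tau ^+ s)^-1 * tau ^+ j * t j.
  have -> : Nm E 0 b = t 0%N.
    by rewrite /t expr0 mul1r; congr (Nm E 0 _); apply/funext => k; rewrite /shiftr /= subn0.
  have [js|sj] := leqP j s.
    apply: le_trans (t_mono _ _ (leq0n j)) _; rewrite ler_peMl //.
    have : 1 <= (tau ^+ s)^-1 * tau ^+ j.
      rewrite mulrC ler_pdivlMr ?exprn_gt0 // mul1r ler_wiXn2l // ?ltW //.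
    by rewrite -mulrA; lra.
  (* Growth of t up to j is decay of the reversed sequence. *)
pose u i := if (i <= j - s)%N then t (j - i)%N else 0.
  have := geometric_decay r0 htau taur (u := u) _ _ _ (j - s)%N.
  rewrite /u leqnn leq0n subn0 (subKn (ltnW sj)) => dec.
  apply: le_trans (t_mono _ _ (leq0n s)) _; apply: le_trans (dec _ _ _) _.
  - by move=> i; case: ifP.
  - move=> i; case: ifP => ij; last by case: ifP.
    by rewrite (ltnW ij) t_mono // leq_sub2l.
  - move=> i; case: ifP => ij; last by case: ifP => // _; rewrite mulr_ge0 ?invr_ge0.
    have ij' : (i <= j - s)%N by apply: leq_trans ij; exact: leq_addl.
    rewrite ij'; have := te (j - s - (r + i))%N.
    by have [-> ->] := reversal_index (ltnW sj) ij.
  apply: eq_ler; congr (_ * _); rewrite -mulrA; congr (_ * _).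
  by rewrite -{2}(subnKC (ltnW sj)) exprD mulKf // expf_neq0 // gt_eqF.
apply: le_trans jt _; rewrite /t exprMn.
have /(ler_wpM2l (_ : 0 <= 2 * (tau ^+ s)^-1 * tau ^+ j * 2 ^+ j)) : Nm E 0 (shiftr j b) <= Nm E 0 c by [].
move=> /(_ _) le; apply: le_trans (le_trans (le _) _); try by apply: eq_ler; ring.
by rewrite !mulr_ge0 ?invr_ge0 ?exprn_ge0 // ltW.
Qed.

End Exponents.

(** * Series in a symmetric space *)

Section SeriesInE.
Variables (R : realType) (E : fspace R).
Local Notation leb := (@lebesgue_measure R).
Hypothesis hE : symmetric_space E.
Implicit Types (c : nat -> R) (f g h : R -> R).

Lemma dist_add f g s t : measurable_fun I01 f -> measurable_fun I01 g ->
  (dist (fun u => (f u + g u)%R) (s + t)%R <= dist f s + dist g t)%E.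
Proof.
move=> mf mg; have ms := measurable_dist s mf; have mt := measurable_dist t mg.
apply: (@le_trans _ _ (leb ((I01 `&` [set u | s < `|f u|]) `|` (I01 `&` [set u | t < `|g u|])))).
  apply: le_measure; rewrite ?inE.
  - by apply: measurable_dist; exact: measurable_funD.
  - exact: measurableU.
  move=> u [Iu /= st]; have [fs|fs] := ltP s `|f u|; [by left|right].
  split=> //=; have := ler_normD (f u) (g u); lra.
exact: measureU2.
Qed.

Lemma nondec_one : nondec (fun=> 1 : R).
Proof. by []. Qed.

Lemma Nm_indicator_gt0 i : Em E 0 (shiftr i (fun=> 1)) /\ 0 < Nm E 0 (shiftr i (fun=> 1)).
Proof.
elim: i => [|i [Ei Ni]].
  rewrite (_ : shiftr 0 _ = fun=> 1); last by apply/funext.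
  by split; [exact: Em_one|exact: Nm_one_gt0].
have [ES _] := shiftr_Em hE i.+1 nondec_one (Em_one hE); split=> //.
move: ES; rewrite -[i.+1]add1n -shiftr_add => ES.
have [_ le] := Nm_shiftr1 hE (shiftr_nondec i nondec_one) ES.
by have := lt_le_trans Ni le; rewrite pmulr_rgt0.
Qed.

(** A nondecreasing sequence dominates c i times the indicator of the set of indices k >= i. *)
Lemma Em_point c i : nondec c -> Em E 0 c -> c i * Nm E 0 (shiftr i (fun=> 1)) <= Nm E 0 c.
Proof.
move=> nc Ec; have [c0 cm] := nc; have [Ei _] := Nm_indicator_gt0 i.
have [_] := Em_scale hE (c i) Ei; rewrite ger0_norm // => <-.
have [] // := Em_le hE Ec (g := fun k => c i * shiftr i (fun=> 1) k) => k.
rewrite /shiftr; case: ltnP => ik; first by rewrite mulr0 normr0.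
by rewrite mulr1 !ger0_norm // cm.
Qed.

(** Chebyshev inequality in E: convergence in norm implies convergence in measure. *)
Lemma norm_small_dist h (d : R) j : E h -> 0 < d ->
  fnorm E h < d * Nm E 0 (shiftr j (fun=> 1)) -> (dist h d <= ((2^-1) ^+ j)%:E)%E.
Proof.
move=> Eh d0 lt; rewrite leNgt; apply/negP => gt.
have [Ej _] := Nm_indicator_gt0 j.
have [_] := Em_scale hE d Ej; rewrite gtr0_norm // => NE.
have nd : nondec (fun k => d * shiftr j (fun=> 1) k).
  by apply: nondec_scale; [exact: ltW|exact: shiftr_nondec nondec_one].
suff [_] : Em E 0 (fun k => d * shiftr j (fun=> 1) k) /\
    Nm E 0 (fun k => d * shiftr j (fun=> 1) k) <= fnorm E h by rewrite NE leNgt lt.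
apply: Em_dist => // s s0; rewrite (nondec_norm nd).
have [sd|ds] := ltP s d; last first.
  rewrite wdist_none ?dist_ge0 // => i; apply: le_trans ds.
  by rewrite /shiftr; case: ifP => _; rewrite ?mulr0 ?mulr1 // ltW.
apply: (@le_trans _ _ ((2^-1) ^+ j)%:E).
  by rewrite lee_fin; apply: wdist0_le => k kj; rewrite /shiftr kj mulr0.
apply: (le_trans (ltW gt)); apply: dist_anti (ltW sd).
exact: sym_meas hE _ Eh.
Qed.

Section Series.
Variables (v : nat -> nat -> R) (B : R).
Hypothesis nv : forall l, nondec (v l).
Hypothesis Ev : forall l, Em E 0 (v l).
Hypothesis vB : forall n, \sum_(l < n) Nm E 0 (v l) <= B.

Local Notation a := (fun l => Nm E 0 (v l)).
Local Notation S := (fun n i => \sum_(l < n.+1) v l i).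

Lemma series_norm_asum : asummable a.
Proof.
exists B => n; apply: le_trans (vB n); apply: eq_ler; apply: eq_bigr => l _.
by rewrite ger0_norm // Nm_ge0.
Qed.

Lemma series_point i : asummable (fun l => v l i).
Proof.
have [_ p0] := Nm_indicator_gt0 i.
apply: asummable_le (asummableZ (Nm E 0 (shiftr i (fun=> 1)))^-1 series_norm_asum) => l.
rewrite ger0_norm; last by case: (nv l).
by rewrite mulrC ler_pdivlMr // Em_point.
Qed.

Lemma series_incr n k : Em E 0 (fun i => S (n + k)%N i - S n i) /\
  Nm E 0 (fun i => S (n + k)%N i - S n i) <= \sum_(l < (n + k).+1) a l - \sum_(l < n.+1) a l.
Proof.
elim: k => [|k [Ek Nk]].
  rewrite addn0 subrr; have [] := Em_scale hE 0 (Em_one hE).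
  rewrite normr0 !mul0r => E0 N0.
  have -> : (fun i => S n i - S n i) = (fun=> 0 : R) by apply/funext => i; rewrite subrr.
  by split=> //; exact: eq_ler N0.
have [E' N'] := Em_add hE Ek (Ev (n + k).+1).
have -> : (fun i => S (n + k.+1)%N i - S n i) = (fun i => (S (n + k)%N i - S n i) + v (n + k).+1 i).
  by apply/funext => i; rewrite addnS [in LHS]big_ord_recr /=; ring.
split=> //; apply: le_trans N' _; rewrite addnS [in leRHS]big_ord_recr /=; lra.
Qed.

Lemma series_partial n : Em E 0 (S n) /\ Nm E 0 (S n) <= \sum_(l < n.+1) a l.
Proof. by apply: (Em_sum hE) => // j _; exact: Ev. Qed.

Lemma series_nondec : nondec (fun i => rsum (v^~ i)).
Proof.
split=> [i|i j ij].
  by apply: rsum_ge0 => [|l]; [exact: series_point|case: (nv l)].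
by apply: rsum_le => [||l]; [exact: series_point..|case: (nv l) => _; exact].
Qed.

Lemma series_limit : exists2 g, E g & fnorm E (fun u => lm 0 (S n) u - g u) @[n --> \oo] --> 0.
Proof.
apply: (sym_complete hE) => [n|e e0]; first exact: (proj1 (series_partial n)).
have sa := series_norm_asum; pose A n := \sum_(l < n) a l.
have a0 l : 0 <= a l by apply: Nm_ge0.
have [N AN] : exists N, rsum a - e < A N.
  apply: contrapT => nex; suff : rsum a <= rsum a - e by lra.
  apply: rsum_le_bound => // n; rewrite leNgt; apply/negP => lt; apply: nex.
  by exists n.
have Am i k : (i <= k)%N -> A i <= A k.
  move/subnK => <-; elim: (k - i)%N => // d IH; rewrite addSn.
  by apply: le_trans IH _; rewrite /A big_ord_recr /= lerDl.
have close n m : (N <= n)%N -> (n <= m)%N ->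
    E (fun u => lm 0 (S m) u - lm 0 (S n) u) /\
    fnorm E (fun u => lm 0 (S m) u - lm 0 (S n) u) < e.
  move=> Nn nm; have [E' N'] := series_incr n (m - n).
  rewrite subnKC // in E' N'; split=> //; apply: le_lt_trans N' _.
  rewrite -/(A m.+1) -/(A n.+1).
  have := Am _ _ (leqW Nn); have : A m.+1 <= rsum a by exact: rsum_ge_part.
  lra.
exists N => m n Nm' Nn; have [nm|mn] := leqP n m; first by case: (close n m Nn nm).
have [E' N'] := close m n Nm' (ltnW mn).
have := sym_normZ hE (-1) E'; rewrite normrN1 mul1r.
rewrite (_ : (fun u => -1 * _) = (fun u => lm 0 (S m) u - lm 0 (S n) u)); first by move=> ->.
by apply/funext => u; ring.
Qed.

(** Completeness yields a limit g of the partial sums; since E need not have the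
    Fatou property, the pointwise sum is compared with g in distribution, using
    convergence in measure. *)
Lemma Em_series : Em E 0 (fun i => rsum (v^~ i)) /\ Nm E 0 (fun i => rsum (v^~ i)) <= B.
Proof.
have [g Eg cv] := series_limit; have mg := sym_meas hE Eg.
pose h n u := lm 0 (S n) u - g u.
have Eh n : E (h n).
  have [ES _] := series_partial n.
  have := sym_add hE ES (sym_scale hE (-1) Eg).
  rewrite (_ : (fun u => _) = h n) //; apply/funext => u; rewrite /h /lm; ring.
have mh n := sym_meas hE (Eh n).
have small e n0 : 0 < e -> exists2 n, (n0 <= n)%N & fnorm E (h n) < e.
  move=> e0; have /cvgrPdist_lt/(_ e e0)[N _ HN] := cv.
  exists (maxn N n0); first exact: leq_maxr.
  have := HN (maxn N n0) (leq_maxl _ _); rewrite /= sub0r normrN.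
  by apply: le_lt_trans; exact: ler_norm.
have v0 l i : 0 <= v l i by case: (nv l).
have [E' N'] : Em E 0 (fun i => rsum (v^~ i)) /\ Nm E 0 (fun i => rsum (v^~ i)) <= fnorm E g.
  apply: Em_dist => // t t0; rewrite (nondec_norm series_nondec).
  have [le|[n0 [-> tn]]] := wdist0_nondec t series_nondec.
    by rewrite wdist_none ?dist_ge0.
  have [n Sn] : exists n, t < \sum_(l < n) v l n0.
    apply: contrapT => nex; move: tn; apply/negP; rewrite -leNgt.
    apply: rsum_le_bound (series_point n0) _ => n; rewrite leNgt; apply/negP => lt.
    by apply: nex; exists n.
  pose d := 2^-1 * (\sum_(l < n) v l n0 - t).
  have d0 : 0 < d by rewrite mulr_gt0 // subr_gt0.
  have dg := fineK (dist_fin t mg); rewrite -dg lee_fin.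
  apply/ler_addgt0Pr => e e0; have [j je] := halfX_small e0.
  have [_ p0] := Nm_indicator_gt0 j.
  have [m nm hm] := small _ n (mulr_gt0 d0 p0).
  have hd := norm_small_dist (Eh m) d0 hm.
  have mS := mlm 0 (S m).
  have : (((2^-1) ^+ n0)%:E <= dist g t + dist (h m) d)%E.
    apply: (@le_trans _ _ (dist (lm 0 (S m)) (t + d)%R)); last first.
      apply: le_trans (dist_add _ _ mg (mh m)).
      rewrite (_ : (fun u => g u + h m u) = lm 0 (S m)) //; apply/funext => u; rewrite /h; ring.
    rewrite dist_lm lee_fin; apply: wdist0_ge => k n0k.
    rewrite ger0_norm ?sumr_ge0 //.
    have : \sum_(l < n) v l n0 <= \sum_(l < m.+1) v l k.
      rewrite (big_ord_widen m.+1 (fun l => v l n0)) ?(leqW nm) // [leLHS]big_mkcond /=.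
      apply: ler_sum => l _; case: ifP => _ //.
      by case: (nv l) => _; exact.
    rewrite /d; lra.
  rewrite -dg => /le_trans /(_ (leeD2l _ hd)) => le.
  move: le; rewrite -EFinD lee_fin; lra.
split=> //; apply: le_trans N' _; apply/ler_addgt0Pr => e e0.
have [n _ hn] := small e 0%N e0; have [ES NS] := series_partial n.
have := sym_normD hE ES (sym_scale hE (-1) (Eh n)).
rewrite (sym_normZ hE) // normrN1 mul1r.
rewrite (_ : (fun u => _) = g); last by apply/funext => u; rewrite /h /lm; ring.
have := vB n.+1; rewrite /Nm in NS *; move: NS hn; lra.
Qed.

End Series.
End SeriesInE.

(** * Rearrangements and distributions in L_p *)

Section LpBounds.
Variable R : realType.
Local Notation leb := (@lebesgue_measure R).
Variable p : R.
Hypothesis p0 : 0 < p.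
Implicit Types (d : nat -> R) (f : R -> R).

Lemma powR_le (x y : R) : 0 <= x -> x <= y -> x `^ p <= y `^ p.
Proof.
by move=> x0 xy; have y0 := le_trans x0 xy; rewrite ge0_ler_powR ?nnegrE // ltW.
Qed.

Lemma powR_lt (x y : R) : 0 <= x -> x < y -> x `^ p < y `^ p.
Proof.
by move=> x0 xy; have y0 := ltW (le_lt_trans x0 xy); rewrite gt0_ltr_powR ?nnegrE.
Qed.

Lemma powR_expn (x : R) k : 0 <= x -> (x ^+ k) `^ p = (x `^ p) ^+ k.
Proof.
move=> x0; elim: k => [|k IH]; first by rewrite !expr0 powR1.
by rewrite !exprS powRM ?exprn_ge0 // IH.
Qed.

Lemma powR_invK (x : R) : 0 <= x -> (x `^ p) `^ p^-1 = x.
Proof. by move=> x0; rewrite -powRrM divff ?gt_eqF // powRr1. Qed.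

Definition pint f : \bar R := (\int[leb]_(t in I01) (`|f t| `^ p)%:E)%E.

Lemma pint_ge0 f : (0 <= pint f)%E.
Proof. by apply: integral_ge0 => t _; rewrite lee_fin powR_ge0. Qed.

Lemma Lnorm_I01 f : 'N[leb]_(p%:E)[EFin \o (f \_ I01)]%E = (pint f `^ p^-1)%E.
Proof.
rewrite unlock /Lnorm; congr (_ `^ _)%E; rewrite [RHS]integral_mkcond.
apply: eq_integral => t _ /=; rewrite /patch; case: ifP => _ //=.
by rewrite normr0 powR0 // gt_eqF.
Qed.

Lemma Lp_of_pint f (b : R) : measurable_fun I01 f -> (pint f <= (b `^ p)%:E)%E -> 0 <= b ->
  Lp01 p f /\ fnorm (Lp01 p) f <= b.
Proof.
move=> mf; have := pint_ge0 f; case E : (pint f) => [x| |] //; rewrite !lee_fin => x0 xb b0.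
have N : 'N[leb]_(p%:E)[EFin \o (f \_ I01)]%E = (x `^ p^-1)%:E.
  by rewrite Lnorm_I01 E poweR_EFin.
split; first by split=> //; rewrite N ltry.
rewrite /= N /= -(powR_invK b0); apply: ge0_ler_powR; rewrite ?nnegrE ?powR_ge0 //.
by rewrite invr_ge0 ltW.
Qed.

Lemma pint_Lp f : Lp01 p f -> pint f = (fnorm (Lp01 p) f `^ p)%:E /\ 0 <= fnorm (Lp01 p) f.
Proof.
move=> [mf]; rewrite /= Lnorm_I01; have := pint_ge0 f; case E : (pint f) => [x| |] //; last first.
  by rewrite poweRyr ?invr_neq0 ?gt_eqF.
rewrite lee_fin poweR_EFin /= => x0 _; split; last exact: powR_ge0.
by rewrite -powRrM mulVf ?gt_eqF // powRr1.
Qed.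

Lemma integral_step (A : set R) (x : R) : 0 <= x -> measurable A -> A `<=` I01 ->
  (\int[leb]_(t in I01) (x * \1_A t)%:E = x%:E * leb A)%E.
Proof.
move=> x0 mA AI; under eq_integral do rewrite EFinM.
have -> : (\int[leb]_(t in I01) (x%:E * (\1_A t)%:E) = x%:E * \int[leb]_(t in I01) (\1_A t)%:E)%E.
  apply: ge0_integralZl_EFin => //; first exact: measurable_I01.
  by apply/measurable_EFinP; exact: measurable_indic.
rewrite integral_indic //; last exact: measurable_I01.
by rewrite setIidl.
Qed.

Lemma measurable_pow f : measurable_fun I01 f -> measurable_fun I01 (fun t => (`|f t| `^ p)%:E).
Proof.
move=> mf; apply/measurable_EFinP; apply: (measurableT_comp (measurable_powR p)).
exact: measurableT_comp.
Qed.

Lemma chebyshev f (s : R) : measurable_fun I01 f -> 0 < s -> ((s `^ p)%:E * dist f s <= pint f)%E.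
Proof.
move=> mf s0; have mA := measurable_dist s mf.
have AI : I01 `&` [set u | s < `|f u|] `<=` I01 by move=> t [].
rewrite /dist -(integral_step (powR_ge0 s p) mA AI).
apply: ge0_le_integral.
- exact: measurable_I01.
- by move=> t _; rewrite lee_fin mulr_ge0 // powR_ge0.
- by apply/measurable_EFinP; apply: measurable_funM => //; exact: measurable_indic.
- exact: measurable_pow.
move=> t _; rewrite lee_fin indicE; case: (boolP (t \in _)) => [|_]; last by rewrite mulr0 powR_ge0.
by rewrite inE => -[_ /= st]; rewrite mulr1; apply: powR_le; exact: ltW.
Qed.

(** Chebyshev inequality, in terms of the base al = 2^(1/p). *)
Lemma Lp_rearr (al : R) f i : 0 < al -> al `^ p = 2 -> Lp01 p f ->
  rearrangement f ((2^-1) ^+ i) <= fnorm (Lp01 p) f * al ^+ i.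
Proof.
move=> a0 ap Lf; have [Ip N0] := pint_Lp Lf; have mf : measurable_fun I01 f by case: Lf.
set N := fnorm _ f in Ip N0 *; have ai := exprn_gt0 i a0.
have Na : 0 <= N * al ^+ i by rewrite mulr_ge0 // ltW.
apply/(rearr_leP mf Na (halfX_gt0 _ _)).
apply: dist_right => // s Ns; have s0 := le_lt_trans Na Ns.
have := chebyshev mf s0; rewrite Ip -(fineK (dist_fin s mf)) -EFinM !lee_fin => le.
have sp : 0 < s `^ p by exact: powR_gt0.
rewrite -(ler_pM2l sp); apply: le_trans le _.
have : (N * al ^+ i) `^ p <= s `^ p by apply: powR_le => //; exact: ltW.
rewrite powRM ?(ltW ai) // powR_expn ?(ltW a0) // ap exprVn => le.
by rewrite ler_pdivlMr ?exprn_gt0.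
Qed.

(** Pointwise |f|^p is below the sum of d_0^p and of the d_(k+1)^p over the k with
    d_k < |f|: either some d_k bounds |f|, or infinitely many terms are bounded
    away from 0.  The k-th of these sets has measure at most 2^-(k+1). *)
Lemma pint_dominated f d (B : R) : measurable_fun I01 f -> nondec d -> (exists k, 0 < d k) ->
  (forall s, 0 <= s -> (dist f s <= (wdist (wt R 0) d s)%:E)%E) ->
  (forall n, \sum_(k < n) (2^-1) ^+ k * d k `^ p <= B) -> (pint f <= B%:E)%E.
Proof.
move=> mf nd [k0 dk0] fd dB; have [d0 dm] := nd.
pose A k := if k is k'.+1 then I01 `&` [set u | d k' < `|f u|] else I01.
have mA k : measurable (A k) by case: k => [|k]; [exact: measurable_I01|exact: measurable_dist].
have AI k : A k `<=` I01 by case: k => // k t [].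
pose F k t : \bar R := (d k `^ p * \1_(A k) t)%:E.
have F0 k t : (0 <= F k t)%E by rewrite lee_fin mulr_ge0 // powR_ge0.
have mF k : measurable_fun I01 (F k).
  by apply/measurable_EFinP; apply: measurable_funM => //; exact: measurable_indic.
have le_sum t : I01 t -> exists n, `|f t| `^ p <= \sum_(k < n) d k `^ p * \1_(A k) t.
  move=> It; have term_ge0 k : 0 <= d k `^ p * \1_(A k) t by rewrite mulr_ge0 // powR_ge0.
  have [ex|nex] := pselect (exists k, `|f t| <= d k).
    case: (ex_minnP ex) => k fk min; exists k.+1; rewrite big_ord_recr /=.
    have -> : \1_(A k) t = 1 :> R.
      rewrite indicE mem_set //; case: k fk min => [//|k] fk min; split=> //=.
      by rewrite ltNge; apply/negP => /min; rewrite ltnn.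
    by rewrite mulr1; apply: le_trans (powR_le (normr_ge0 _) fk) _; rewrite lerDr sumr_ge0.
  have At k : \1_(A k) t = 1 :> R.
    rewrite indicE mem_set //; case: k => // k; split=> //=.
    by rewrite ltNge; apply/negP => le; apply: nex; exists k.
  have b0 : 0 < d k0 `^ p by exact: powR_gt0.
  pose n := (Num.truncn (`|f t| `^ p / d k0 `^ p)).+1; exists (k0 + n)%N.
  rewrite big_split_ord /=; apply: (@le_trans _ _ (\sum_(i < n) d k0 `^ p)).
    by rewrite sumr_const card_ord -mulr_natl -ler_pdivrMr //; apply: ltW; exact: truncnS_gt.
  rewrite -[leLHS]add0r; apply: lerD; first by rewrite sumr_ge0.
  by apply: ler_sum => i _; rewrite At mulr1; apply: powR_le => //; apply: dm; exact: leq_addr.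
apply: (@le_trans _ _ (\int[leb]_(t in I01) (\sum_(k <oo) F k t))%E).
  apply: ge0_le_integral.
  - exact: measurable_I01.
  - by move=> t _; rewrite lee_fin powR_ge0.
  - exact: measurable_pow.
  - by apply: (@ge0_emeasurable_sum _ _ _ I01 F xpredT) => // k t _ _; exact: F0.
  move=> t It; have [n le] := le_sum t It.
  apply: (@le_trans _ _ (\sum_(0 <= k < n) F k t)%E).
    by rewrite big_mkord /F sumEFin lee_fin.
  by apply: nneseries_lim_ge => k _ _; exact: F0.
rewrite integral_nneseries //; last exact: measurable_I01.
apply: lime_le.
  by apply: is_cvg_nneseries => k _ _; apply: integral_ge0 => t _; exact: F0.
apply: nearW => n; rewrite big_mkord.
apply: (@le_trans _ _ (\sum_(k < n) ((2^-1) ^+ k * d k `^ p)%:E)%E); last first.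
  by rewrite sumEFin lee_fin.
apply: lee_sum => k _; rewrite integral_step ?powR_ge0 // mulrC EFinM.
apply: lee_wpmul2l; first by rewrite lee_fin powR_ge0.
case: (nat_of_ord k) => [|j] /=; first by rewrite leb_I01 expr0.
apply: le_trans (fd _ (d0 j)) _; rewrite lee_fin; apply: wdist0_le => i ij.
exact: dm.
Qed.

(** The factor 2^-i in the integral becomes al^-i in the norm, which will cancel
    against the factor al^i of the weak-type bound. *)
Lemma Lp_dominated (al M G : R) i f d : 0 < al -> al `^ p = 2 -> 0 <= M -> 0 <= G ->
  measurable_fun I01 f -> nondec d -> (exists k, 0 < d k) ->
  (forall s, 0 <= s -> (dist f s <= (wdist (wt R 0) d s)%:E)%E) ->
  (forall n, \sum_(k < n) (2^-1) ^+ k * d k `^ p <= (2^-1) ^+ i * (M `^ p * G)) ->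
  Lp01 p f /\ fnorm (Lp01 p) f <= (al^-1) ^+ i * (M * G `^ p^-1).
Proof.
move=> a0 ap M0 G0 mf nd dk fd dB; have ai : 0 <= al^-1 by rewrite invr_ge0 ltW.
apply: Lp_of_pint => //; last by rewrite !mulr_ge0 ?exprn_ge0 ?powR_ge0.
apply: le_trans (pint_dominated mf nd dk fd dB) _; rewrite lee_fin.
rewrite powRM ?exprn_ge0 ?mulr_ge0 ?powR_ge0 // powR_expn // powRM ?powR_ge0 //.
rewrite -[(G `^ _) `^ _]powRrM mulVf ?gt_eqF // powRr1 //.
suff -> : al^-1 `^ p = 2^-1 by [].
by rewrite -powR_inv1 ?(ltW a0) // -powRrM mulN1r powRN ap.
Qed.

End LpBounds.

(** * Splitting a function at a height *)

Section Geometric.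
Variable R : realType.

Lemma geo_le (x : R) n : 0 <= x < 1 -> \sum_(l < n) x ^+ l <= (1 - x)^-1.
Proof.
move=> /andP[x0 x1]; have d0 : 0 < 1 - x by rewrite subr_gt0.
rewrite -[leRHS]mul1r ler_pdivlMr //.
suff -> : (\sum_(l < n) x ^+ l) * (1 - x) = 1 - x ^+ n by rewrite lerBlDr lerDl exprn_ge0.
elim: n => [|n IH]; first by rewrite big_ord0 mul0r expr0 subrr.
by rewrite big_ord_recr /= mulrDl IH exprSr; ring.
Qed.

Lemma geo_rev_le (x : R) n : 0 <= x < 1 -> \sum_(k < n) x ^+ (n - k) <= (1 - x)^-1.
Proof.
move=> hx; apply: le_trans (geo_le n.+1 hx); have /andP[x0 _] := hx.
rewrite [leRHS]big_ord_recl (reindex_inj rev_ord_inj) /= ler_wpDl //.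
by apply: ler_sum => i _; rewrite subKn.
Qed.

Lemma exponent_of_base (a : R) : 1 < a -> exists2 p, 0 < p & a `^ p = 2.
Proof.
move=> a1; have l0 : 0 < ln a by rewrite ln_gt0.
have a0 : 0 < a by apply: lt_trans a1.
exists (ln 2 / ln a); first by rewrite divr_gt0 // ln_gt0 // ltr1n.
rewrite /powR gt_eqF // divfK ?gt_eqF // lnK // posrE ltr0n //.
Qed.

Lemma exponent_anti (a b p q : R) : 1 < b -> b < a -> 0 < p -> 0 < q -> a `^ p = 2 -> b `^ q = 2 -> p < q.
Proof.
move=> b1 ba p0 q0 ap bq; rewrite ltNge; apply/negP => qp.
have b0 : 0 < b by apply: lt_trans b1.
have : b `^ q <= b `^ p by apply: ler_powR => //; exact: ltW.
have : b `^ p < a `^ p by apply: powR_lt => //; exact: ltW.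
by rewrite ap bq; lra.
Qed.

End Geometric.

Section Splitting.
Variables (R : realType).
Implicit Types (c : nat -> R) (f : R -> R).

Definition top c i f : R -> R := fun u => if c i < `|f u| then f u else 0.
Definition bottom c i f : R -> R := fun u => if c i < `|f u| then 0 else f u.

Lemma top_bottom c i f : f = (fun u => top c i f u + bottom c i f u).
Proof. by apply/funext => u; rewrite /top /bottom; case: ifP => _; rewrite ?addr0 ?add0r. Qed.

Lemma measurable_top_bottom c i f : measurable_fun I01 f ->
  measurable_fun I01 (top c i f) /\ measurable_fun I01 (bottom c i f).
Proof.
move=> mf; have mI := @measurable_I01 R.
have mb : measurable_fun I01 (fun u => c i < `|f u|).
  by apply: measurable_fun_ltr => //; exact: measurableT_comp.
by split; apply: measurable_fun_if => //; apply: (measurable_funS mI) mf => // u [].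
Qed.

Variables (p q al be ga ga' : R) (c : nat -> R) (f : R -> R) (i : nat) (M : R).
Hypothesis p0 : 0 < p.
Hypothesis q0 : 0 < q.
Hypothesis al1 : 1 < al.
Hypothesis be1 : 1 < be.
Hypothesis alp : al `^ p = 2.
Hypothesis beq : be `^ q = 2.
Hypothesis ga1 : 1 < ga < al.
Hypothesis ga'1 : be < ga'.
Hypothesis nc : nondec c.
Hypothesis mf : measurable_fun I01 f.
Hypothesis fc : forall s, 0 <= s -> (dist f s <= (wdist (wt R 0) c s)%:E)%E.
Hypothesis M0 : 0 < M.
Hypothesis cr : forall k, (i <= k)%N -> c k <= M * ga ^+ (k - i).
Hypothesis cl : forall k, (k <= i)%N -> c k <= M * (ga'^-1) ^+ (i - k).

Definition cst_top : R := (1 - 2^-1 * ga `^ p)^-1.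
Definition cst_bottom : R := (1 - 2 * (ga'^-1) `^ q)^-1 + (1 - 2^-1)^-1.

Let x1 := 2^-1 * ga `^ p.
Let y1 := 2 * (ga'^-1) `^ q.

Lemma x1_bound : 0 <= x1 < 1.
Proof.
have /andP[g1 ga_al] := ga1; have g0 : 0 <= ga by apply: ltW; apply: lt_trans g1.
have := powR_lt p0 g0 ga_al; rewrite alp /x1; have := powR_ge0 ga p.
by move=> a b; apply/andP; split; lra.
Qed.

Lemma y1_bound : 0 <= y1 < 1.
Proof.
have b0 : 0 < be by apply: lt_trans be1.
have g0 : 0 < ga' by apply: lt_trans ga'1.
rewrite /y1 mulr_ge0 ?powR_ge0 //=; have := powR_lt q0 (ltW b0) ga'1; rewrite beq => lt.
rewrite -powR_inv1 ?(ltW g0) // -powRrM mulN1r powRN.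
by rewrite ltr_pdivrMr ?mul1r // powR_gt0.
Qed.

Lemma cst_top_ge0 : 0 <= cst_top.
Proof. by have /andP[_ b] := x1_bound; rewrite invr_ge0 subr_ge0 ltW. Qed.

Lemma cst_bottom_ge0 : 0 <= cst_bottom.
Proof.
have /andP[_ b] := y1_bound; rewrite addr_ge0 // invr_ge0; first by rewrite subr_ge0 ltW.
by lra.
Qed.

Lemma half01 : 0 <= (2^-1 : R) < 1. Proof. by apply/andP; split; lra. Qed.

(** Above the height c i the dyadic values are dominated by M ga^(k-i), with ga^p < 2. *)
Lemma top_Lp : Lp01 p (top c i f) /\
  fnorm (Lp01 p) (top c i f) <= (al^-1) ^+ i * (M * cst_top `^ p^-1).
Proof.
have [c0 cm] := nc; have [mt _] := measurable_top_bottom c i mf.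
have /andP[g1 _] := ga1; have g0 : 0 < ga by apply: lt_trans g1.
have a0 : 0 < al by apply: lt_trans al1.
pose e k := M * ga ^+ k.
have ne : nondec e.
  split=> [k|k l kl]; first by rewrite mulr_ge0 ?exprn_ge0 ?ltW.
  by rewrite /e ler_pM2l // ler_weXn2l // ltW.
apply: (Lp_dominated p0 a0 alp (ltW M0) cst_top_ge0 mt (shiftr_nondec i ne)).
- by exists i; rewrite /shiftr ltnn subnn /e expr0 mulr1.
- move=> s s0; pose s' := Num.max s (c i).
  have ss' : s <= s' by rewrite le_max lexx.
  have cs' : c i <= s' by rewrite le_max lexx orbT.
  apply: (@le_trans _ _ (dist f s')).
    apply: dist_sub => // u _; rewrite /top; case: ifP => [cf sf|_]; last by rewrite normr0 ltNge s0.
    by rewrite gt_max sf cf.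
  apply: le_trans (fc (le_trans s0 ss')) _; rewrite lee_fin.
  apply: (wdist_le (wt_gt0 R 0) (wt_asum R 0)) => k sk.
  have ik : (i <= k)%N.
    rewrite leqNgt; apply/negP => ki; have := lt_le_trans sk (le_trans (cm _ _ (ltnW ki)) cs').
    by rewrite ltxx.
  by rewrite /shiftr ltnNge ik /=; apply: le_lt_trans ss' (lt_le_trans sk (cr ik)).
move=> n; pose F k := (2^-1) ^+ k * shiftr i e k `^ p.
have F0 k : 0 <= F k by rewrite mulr_ge0 ?powR_ge0 // ltW // halfX_gt0.
apply: (@le_trans _ _ (\sum_(k < i + n) F k)).
  by rewrite addnC big_split_ord /= lerDl sumr_ge0.
rewrite big_split_ord /= big1 ?add0r => [|k _]; last first.
  by rewrite /F /shiftr ltn_ord powR0 ?mulr0 // gt_eqF.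
apply: (@le_trans _ _ (\sum_(k < n) (2^-1) ^+ i * (M `^ p * x1 ^+ k))).
  apply: ler_sum => k _; rewrite /F /shiftr ltnNge leq_addr /= addKn /e.
  rewrite powRM ?(ltW M0) ?exprn_ge0 ?(ltW g0) // powR_expn ?(ltW g0) // /x1 exprMn exprD.
  by apply: eq_ler; ring.
rewrite -!mulr_sumr ler_pM2l ?halfX_gt0 // ler_pM2l ?powR_gt0 //.
exact: geo_le x1_bound.
Qed.

(** Below the height c i the dyadic values are dominated by M ga'^-(i-k) for
    k <= i and by M for k > i, with ga'^q > 2. *)
Lemma bottom_Lq : Lp01 q (bottom c i f) /\
  fnorm (Lp01 q) (bottom c i f) <= (be^-1) ^+ i * (M * cst_bottom `^ q^-1).
Proof.
have [c0 cm] := nc; have [_ mb] := measurable_top_bottom c i mf.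
have b0 : 0 < be by apply: lt_trans be1.
have g0 : 0 < ga' by apply: lt_trans ga'1.
have gi0 : 0 < ga'^-1 by rewrite invr_gt0.
have gi1 : ga'^-1 <= 1 by rewrite invf_le1 // ltW // (lt_trans be1).
pose d k := M * (ga'^-1) ^+ (i - k).
have nd : nondec d.
  split=> [k|k l kl]; first by rewrite mulr_ge0 ?exprn_ge0 ?ltW.
  by rewrite /d ler_pM2l // ler_wiXn2l ?(ltW gi0) // leq_sub2l.
apply: (Lp_dominated q0 b0 beq (ltW M0) cst_bottom_ge0 mb nd).
- by exists i; rewrite /d subnn expr0 mulr1.
- move=> s s0; have [sc|cs] := ltP s (c i); last first.
    apply: (@le_trans _ _ 0%E); last by rewrite lee_fin wdist_ge0 //; [exact: wt_gt0|exact: wt_asum].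
    rewrite /dist (_ : _ `&` _ = set0) ?measure0 //; apply/seteqP; split=> // u [_ /=].
    rewrite /bottom; case: ifPn => [_|]; first by rewrite normr0 ltNge s0.
    by rewrite -leNgt => fci /lt_le_trans/(_ fci)/lt_le_trans/(_ cs); rewrite ltxx.
  apply: (@le_trans _ _ (dist f s)).
    apply: dist_sub => // u _; rewrite /bottom; case: ifP => // _; by rewrite normr0 ltNge s0.
  apply: le_trans (fc s0) _; rewrite lee_fin.
  apply: wdist_le; [exact: wt_gt0|exact: wt_asum|] => k sk.
  have [ki|ik] := leqP k i; first exact: lt_le_trans sk (cl ki).
  apply: lt_le_trans sc _; have := cl (leqnn i); rewrite subnn /d.
  by have -> : (i - k = 0)%N by apply/eqP; rewrite subn_eq0 ltnW.
move=> n; pose F k := (2^-1) ^+ k * d k `^ q.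
have F0 k : 0 <= F k by rewrite mulr_ge0 ?powR_ge0 // ltW // halfX_gt0.
apply: (@le_trans _ _ (\sum_(k < i + n) F k)).
  by rewrite addnC big_split_ord /= lerDl sumr_ge0.
rewrite big_split_ord /= /cst_bottom mulrDr mulrDr; apply: lerD.
  apply: (@le_trans _ _ (\sum_(k < i) (2^-1) ^+ i * (M `^ q * y1 ^+ (i - k)))).
    apply: ler_sum => k _; rewrite /F /d.
    rewrite powRM ?(ltW M0) ?exprn_ge0 ?(ltW gi0) // powR_expn ?(ltW gi0) // /y1 exprMn.
    have : (2^-1) ^+ i * 2 ^+ (i - k) = (2^-1) ^+ k :> R.
      by rewrite -{1}(subnKC (ltnW (ltn_ord k))) exprD -mulrA -exprMn mulVf // expr1n mulr1.
    by move=> <-; apply: eq_ler; ring.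
  rewrite -!mulr_sumr ler_pM2l ?halfX_gt0 // ler_pM2l ?powR_gt0 //.
  exact: geo_rev_le y1_bound.
apply: (@le_trans _ _ (\sum_(k < n) (2^-1) ^+ i * (M `^ q * (2^-1) ^+ k))).
  apply: ler_sum => k _; rewrite /F /d.
  have -> : (i - (i + k) = 0)%N by apply/eqP; rewrite subn_eq0 leq_addr.
  by rewrite expr0 mulr1 exprD; apply: eq_ler; ring.
rewrite -!mulr_sumr ler_pM2l ?halfX_gt0 // ler_pM2l ?powR_gt0 //.
exact: geo_le half01.
Qed.

End Splitting.

(** * Interpolation *)

Section Envelope.
Variables (R : realType) (E : fspace R).
Hypothesis hE : symmetric_space E.
Variables (rho sigma K ga ga' : R).
Hypothesis rho0 : 0 < rho.
Hypothesis sigma0 : 0 < sigma.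
Hypothesis K0 : 0 < K.
Hypothesis dil : forall c, nondec c -> Em E 0 c -> forall j,
     [/\ Nm E 0 (shiftr j c) <= K * rho ^+ j * Nm E 0 c, Em E 0 (shiftl j c) &
         Nm E 0 (shiftl j c) <= K * sigma ^+ j * Nm E 0 c].
Hypothesis ga_sigma : sigma < ga.
Hypothesis ga'0 : 0 < ga'.
Hypothesis ga'_rho : ga' * rho < 1.
Implicit Types (c : nat -> R).

Lemma ga0 : 0 < ga. Proof. exact: lt_trans ga_sigma. Qed.

Definition upper c l i : R := (ga^-1) ^+ l * shiftl l c i.
Definition lower c l i : R := ga' ^+ l * shiftr l c i.
(** Sums rather than suprema, so that the triangle inequality bounds the norm. *)
Definition envelope c i : R := rsum (fun l => upper c l i) + rsum (fun l => lower c l i).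

Lemma Em_geometric (v : nat -> nat -> R) (A x : R) : (forall l, nondec (v l)) ->
  (forall l, Em E 0 (v l)) -> 0 <= A -> 0 <= x < 1 -> (forall l, Nm E 0 (v l) <= A * x ^+ l) ->
  [/\ forall i, asummable (fun l => v l i), Em E 0 (fun i => rsum (v^~ i)) &
      Nm E 0 (fun i => rsum (v^~ i)) <= A * (1 - x)^-1].
Proof.
move=> nv Ev A0 hx vA.
have vB n : \sum_(l < n) Nm E 0 (v l) <= A * (1 - x)^-1.
  apply: (@le_trans _ _ (\sum_(l < n) A * x ^+ l)); first by apply: ler_sum => l _; exact: vA.
  by rewrite -mulr_sumr ler_wpM2l // geo_le.
have [Es Ns] := Em_series hE nv Ev vB.
by split=> // i; exact: (series_point hE nv Ev vB).
Qed.

Definition env_cst : R := K * (1 - ga^-1 * sigma)^-1 + K * (1 - ga' * rho)^-1.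

Lemma up01 : 0 <= ga^-1 * sigma < 1.
Proof.
have g0 := ga0; rewrite mulr_ge0 ?invr_ge0 ?ltW //=.
by rewrite mulrC ltr_pdivrMr // mul1r.
Qed.

Lemma lo01 : 0 <= ga' * rho < 1.
Proof. by rewrite mulr_ge0 ?ltW. Qed.

Lemma env_cst_ge0 : 0 <= env_cst.
Proof.
have /andP[_ a] := up01; have /andP[_ b] := lo01.
by rewrite addr_ge0 // mulr_ge0 ?invr_ge0 ?subr_ge0 // ltW.
Qed.

Lemma upper_series c : nondec c -> Em E 0 c ->
  [/\ forall i, asummable (fun l => upper c l i), Em E 0 (fun i => rsum (fun l => upper c l i)) &
      Nm E 0 (fun i => rsum (fun l => upper c l i)) <= K * Nm E 0 c * (1 - ga^-1 * sigma)^-1].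
Proof.
move=> nc Ec; have g0 := ga0; have gi : 0 <= ga^-1 by rewrite invr_ge0 ltW.
apply: (Em_geometric (v := upper c)).
- by move=> l; apply: nondec_scale; [exact: exprn_ge0|exact: shiftl_nondec].
- by move=> l; have [_ El _] := dil nc Ec l; case: (Em_scale hE ((ga^-1) ^+ l) El).
- by rewrite mulr_ge0 ?(ltW K0) ?Nm_ge0.
- exact: up01.
move=> l; have [_ El Nl] := dil nc Ec l; have [_] := Em_scale hE ((ga^-1) ^+ l) El.
rewrite /upper ger0_norm ?exprn_ge0 // => ->.
apply: le_trans (ler_wpM2l _ Nl) _; first exact: exprn_ge0.
by rewrite exprMn; apply: eq_ler; ring.
Qed.

Lemma lower_series c : nondec c -> Em E 0 c ->
  [/\ forall i, asummable (fun l => lower c l i), Em E 0 (fun i => rsum (fun l => lower c l i)) &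
      Nm E 0 (fun i => rsum (fun l => lower c l i)) <= K * Nm E 0 c * (1 - ga' * rho)^-1].
Proof.
move=> nc Ec; have gl l : 0 <= ga' ^+ l by rewrite exprn_ge0 // ltW.
apply: (Em_geometric (v := lower c)).
- by move=> l; apply: nondec_scale; [exact: gl|exact: shiftr_nondec].
- by move=> l; have [El _] := shiftr_Em hE l nc Ec; case: (Em_scale hE (ga' ^+ l) El).
- by rewrite mulr_ge0 ?(ltW K0) ?Nm_ge0.
- exact: lo01.
move=> l; have [Nl _ _] := dil nc Ec l; have [El _] := shiftr_Em hE l nc Ec.
have [_] := Em_scale hE (ga' ^+ l) El.
rewrite /lower ger0_norm // => ->.
apply: le_trans (ler_wpM2l _ Nl) _; first exact: gl.
by rewrite exprMn; apply: eq_ler; ring.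
Qed.

Lemma Em_envelope c : nondec c -> Em E 0 c ->
  Em E 0 (envelope c) /\ Nm E 0 (envelope c) <= env_cst * Nm E 0 c.
Proof.
move=> nc Ec; have [_ E1 N1] := upper_series nc Ec; have [_ E2 N2] := lower_series nc Ec.
have [E3 N3] := Em_add hE E1 E2; split; first exact: E3.
apply: le_trans N3 _; apply: le_trans (lerD N1 N2) _.
by rewrite /env_cst mulrDl; apply: eq_ler; ring.
Qed.

Lemma rsum_ge_term (u : nat -> R) l : asummable u -> (forall k, 0 <= u k) -> u l <= rsum u.
Proof.
move=> su u0; apply: le_trans (rsum_ge_part l.+1 su u0).
by rewrite big_ord_recr /= lerDr sumr_ge0.
Qed.

Lemma envelope_bounds c i : nondec c -> Em E 0 c ->
  [/\ 0 <= envelope c i,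
      forall k, (i <= k)%N -> c k <= envelope c i * ga ^+ (k - i) &
      forall k, (k <= i)%N -> c k <= envelope c i * (ga'^-1) ^+ (i - k)].
Proof.
move=> nc Ec; have [c0 _] := nc; have g0 := ga0.
have [su _ _] := upper_series nc Ec; have [sl _ _] := lower_series nc Ec.
have u0 l : 0 <= upper c l i by rewrite mulr_ge0 ?exprn_ge0 ?invr_ge0 ?(ltW g0) // c0.
have l0 l : 0 <= lower c l i.
  by rewrite mulr_ge0 ?exprn_ge0 ?(ltW ga'0) //; case: (shiftr_nondec l nc).
have ru := rsum_ge0 (su i) u0; have rl := rsum_ge0 (sl i) l0.
split; first exact: addr_ge0.
- move=> k ik; have := rsum_ge_term (k - i) (su i) u0.
  rewrite /upper /shiftl subnKC // exprVn mulrC ler_pdivrMr ?exprn_gt0 // => /le_trans; apply.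
  by rewrite ler_wpM2r ?exprn_ge0 ?(ltW g0) // lerDl.
move=> k ki; have := rsum_ge_term (i - k) (sl i) l0.
rewrite /lower /shiftr ltnNge leq_subr /= subKn // => le.
rewrite exprVn ler_pdivlMr ?exprn_gt0 // mulrC; apply: le_trans le _.
by rewrite lerDr.
Qed.

End Envelope.

Section Interpolation.
Variables (R : realType) (E : fspace R).
Local Notation leb := (@lebesgue_measure R).
Hypothesis hE : symmetric_space E.
Variables (rho sigma K ga ga' p q al be : R).
Hypothesis rho0 : 0 < rho.
Hypothesis sigma0 : 0 < sigma.
Hypothesis K0 : 0 < K.
Hypothesis dil : forall c, nondec c -> Em E 0 c -> forall j,
     [/\ Nm E 0 (shiftr j c) <= K * rho ^+ j * Nm E 0 c, Em E 0 (shiftl j c) &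
         Nm E 0 (shiftl j c) <= K * sigma ^+ j * Nm E 0 c].
Hypothesis ga_sigma : sigma < ga.
Hypothesis ga'_rho : ga' * rho < 1.
Hypothesis p0 : 0 < p.
Hypothesis q0 : 0 < q.
Hypothesis al1 : 1 < al.
Hypothesis be1 : 1 < be.
Hypothesis alp : al `^ p = 2.
Hypothesis beq : be `^ q = 2.
Hypothesis ga1 : 1 < ga < al.
Hypothesis ga'1 : be < ga'.
Implicit Types (c : nat -> R) (f g : R -> R).

Lemma dist_ae f g s : measurable_fun I01 f -> measurable_fun I01 g -> ae01 f g ->
  dist f s = dist g s.
Proof.
suff le f' g' : measurable_fun I01 f' -> measurable_fun I01 g' -> ae01 f' g' ->
    (dist f' s <= dist g' s)%E.
  move=> mf mg fg; apply/eqP; rewrite eq_le !le //.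
  have [N [mN N0 subN]] := fg; exists N; split=> // u /= nfg; apply: subN => /= fgu.
  by apply: nfg => Iu; rewrite fgu.
move=> mf mg [N [mN N0 subN]].
apply: (@le_trans _ _ (leb ((I01 `&` [set u | s < `|g' u|]) `|` N))).
  apply: le_measure; rewrite ?inE.
  - exact: measurable_dist.
  - by apply: measurableU => //; exact: measurable_dist.
  move=> u [Iu /= su]; have [Nu|nNu] := pselect (N u); [by right|left; split=> //=].
  suff <- : f' u = g' u by [].
  by apply: contrapT => ne; apply: nNu; apply: subN => /= /(_ Iu).
have : (leb ((I01 `&` [set u | s < `|g' u|]%R) `|` N) <= dist g' s + leb N)%E.
  by apply: measureU2 => //; exact: measurable_dist.
by rewrite N0 adde0.
Qed.

(** M may be any positive majorant of the envelope: it need not be attained, which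
    avoids the degenerate case of a vanishing envelope. *)
Lemma split_levels f i (M : R) : E f -> envelope ga ga' (dyadic f) i <= M -> 0 < M ->
  let c := dyadic f in
  [/\ Lp01 p (top c i f), Lp01 q (bottom c i f),
      fnorm (Lp01 p) (top c i f) <= (al^-1) ^+ i * (M * cst_top p ga `^ p^-1) &
      fnorm (Lp01 q) (bottom c i f) <= (be^-1) ^+ i * (M * cst_bottom q ga' `^ q^-1)].
Proof.
move=> Ef eM M0 c; have mf := sym_meas hE Ef; have nc := dyadic_nondec mf.
have [Ec _] := dyadic_Em hE Ef.
have ga'0 : 0 < ga' by apply: lt_trans ga'1; exact: lt_trans be1.
have [e0 er el] := envelope_bounds hE rho0 sigma0 K0 dil ga_sigma ga'0 ga'_rho i nc Ec.
have g0 : 0 < ga by exact: lt_trans ga_sigma.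
have fc s := @dist_le_dyadic R f s mf.
have cr k : (i <= k)%N -> c k <= M * ga ^+ (k - i).
  by move=> ik; apply: le_trans (er k ik) _; rewrite ler_wpM2r // exprn_ge0 // ltW.
have cl k : (k <= i)%N -> c k <= M * (ga'^-1) ^+ (i - k).
  by move=> ki; apply: le_trans (el k ki) _; rewrite ler_wpM2r // exprn_ge0 // invr_ge0 ltW.
have [L1 N1] := top_Lp p0 al1 alp ga1 nc mf fc M0 cr.
by have [L2 N2] := bottom_Lq q0 be1 beq ga'1 nc mf fc M0 cl.
Qed.

Lemma E_sub_fsum f : E f -> fsum (Lp01 p) (Lp01 q) f.
Proof.
move=> Ef; pose M := Num.max 1 (envelope ga ga' (dyadic f) 0).
have M0 : 0 < M by rewrite lt_max ltr01.
have eM : envelope ga ga' (dyadic f) 0 <= M by rewrite le_max lexx orbT.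
have [L1 L2 _ _] := split_levels Ef eM M0.
by exists (top (dyadic f) 0 f), (bottom (dyadic f) 0 f); split=> //; exact: top_bottom.
Qed.

(** The dyadic values of f are O(be^i), and the envelope of 1 grows at least like ga'^i. *)
Lemma Lq_sub_E f : Lp01 q f -> E f.
Proof.
move=> Lf; have mf : measurable_fun I01 f by case: Lf.
have ga'0 : 0 < ga' by apply: lt_trans ga'1; exact: lt_trans be1.
have b0 : 0 < be by apply: lt_trans be1.
have n1 := @nondec_one R; have E1 := Em_one hE.
have [Ee _] := Em_envelope hE rho0 sigma0 K0 dil ga_sigma ga'0 ga'_rho n1 E1.
set N := fnorm (Lp01 q) f; have [_ N0] := pint_Lp q0 Lf.
have [EN _] := Em_scale hE (N * be) Ee.
apply: (proj1 (fnorm_le_dyadic hE mf _)).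
apply: (proj1 (Em_le hE EN _)) => k.
have [e0 _ el] := envelope_bounds hE rho0 sigma0 K0 dil ga_sigma ga'0 ga'_rho k n1 E1.
rewrite ger0_norm; last by case: (dyadic_nondec mf).
rewrite ger0_norm; last by rewrite !mulr_ge0 // ltW.
have := Lp_rearr q0 k.+1 b0 beq Lf; rewrite -/N -/(dyadic f k) exprS mulrA => dN.
apply: le_trans dN _.
apply: ler_wpM2l; first by rewrite mulr_ge0 // ltW.
have := el 0%N isT; rewrite subn0 exprVn ler_pdivlMr ?exprn_gt0 // mul1r => /(le_trans _); apply.
by rewrite lerXn2r ?nnegrE ?(ltW b0) ?(ltW ga'0) // ltW.
Qed.

Lemma fsum_measurable f : fsum (Lp01 p) (Lp01 q) f -> measurable_fun I01 f.
Proof. by move=> [f1 [f2 [[m1 _] [m2 _] ->]]]; exact: measurable_funD. Qed.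

Lemma Lp_0 (r : R) : 0 < r -> Lp01 r (fun=> 0 : R).
Proof.
move=> r0; apply: (proj1 (@Lp_of_pint _ r r0 (fun=> 0) 0 _ _ _)) => //.
rewrite /pint powR0 ?gt_eqF //.
rewrite (eq_integral (fun=> 0%E)) ?integral0 // => t _.
by rewrite normr0 powR0 // gt_eqF.
Qed.

(** Splitting f at the height c i gives T f = T f1 + T f2 and
    rearr(T f)(2^-(i+1)) <= D M for each M above the envelope of c at i; the norm
    of T f is then controlled by that of the envelope. *)
Lemma interpolation_of_dilation : interpolation E (Lp01 p) (Lp01 q).
Proof.
split=> [f [_ Lf]||T [TD Tae Tlin] [A1 HA1] [A2 HA2]]; first exact: Lq_sub_E.
  exact: E_sub_fsum.
pose Gp := `|A1| * (al ^+ 2 * cst_top p ga `^ p^-1).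
pose Gq := `|A2| * (be ^+ 2 * cst_bottom q ga' `^ q^-1).
pose D := Gp + Gq.
have a0 : 0 < al by apply: lt_trans al1.
have b0 : 0 < be by apply: lt_trans be1.
have D0 : 0 <= D by rewrite addr_ge0 // mulr_ge0 // mulr_ge0 ?powR_ge0 ?exprn_ge0 // ltW.
have ga'0 : 0 < ga' by apply: lt_trans ga'1.
exists (D * (env_cst rho sigma K ga ga' * 2)) => f Ef.
have mf := sym_meas hE Ef; have nc := dyadic_nondec mf.
have [Ec Nc] := dyadic_Em hE Ef; set c := dyadic f in nc Ec Nc.
have Df := E_sub_fsum Ef; have mT := fsum_measurable (TD f Df).
have key i M : envelope ga ga' c i <= M -> 0 < M -> dyadic (T f) i <= D * M.
  move=> eM M0; have [L1 L2 N1 N2] := split_levels Ef eM M0.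
  set f1 := top _ _ _ in L1 N1; set f2 := bottom _ _ _ in L2 N2.
  have D1 : fsum (Lp01 p) (Lp01 q) f1.
    exists f1, (fun=> 0); split=> //; first exact: Lp_0.
    by apply/funext => u; rewrite addr0.
  have D2 : fsum (Lp01 p) (Lp01 q) f2.
    exists (fun=> 0), f2; split=> //; first exact: Lp_0.
    by apply/funext => u; rewrite add0r.
  have [LT1 NT1] := HA1 f1 L1; have [LT2 NT2] := HA2 f2 L2.
  have [m1 _] := LT1; have [m2 _] := LT2.
  have Tf : ae01 (T f) (fun u => T f1 u + T f2 u).
    have := Tlin 1 f1 f2 D1 D2.
    rewrite (_ : (fun u => 1 * f1 u + f2 u) = f); last first.
      by rewrite [RHS](top_bottom c i f); apply/funext => u; rewrite mul1r.
    by rewrite (_ : (fun u => 1 * T f1 u + T f2 u) = (fun u => T f1 u + T f2 u)) //;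
      apply/funext => u; rewrite mul1r.
  pose t : R := (2^-1) ^+ i.+2; have t0 : 0 < t by exact: halfX_gt0.
  pose s1 := rearrangement (T f1) t; pose s2 := rearrangement (T f2) t.
  have s10 : 0 <= s1 := rearr_ge0 _ _; have s20 : 0 <= s2 := rearr_ge0 _ _.
  have d1 : (dist (T f1) s1 <= t%:E)%E by apply/(rearr_leP m1 s10 t0); exact: lexx.
  have d2 : (dist (T f2) s2 <= t%:E)%E by apply/(rearr_leP m2 s20 t0); exact: lexx.
  (* The two exceptional sets have measure 2^-(i+2) each. *)
  have le12 : dyadic (T f) i <= s1 + s2.
    apply/(rearr_leP mT (addr_ge0 s10 s20) (halfX_gt0 _ _)).
    rewrite (dist_ae _ mT (measurable_funD m1 m2) Tf).
    apply: le_trans (dist_add _ _ m1 m2) _; apply: le_trans (leeD d1 d2) _.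
    by rewrite -EFinD lee_fin /t exprS -mulrDl; apply: eq_ler; field.
  have b1 : s1 <= Gp * M.
    apply: le_trans (Lp_rearr p0 i.+2 a0 alp LT1) _.
    have N10 : 0 <= fnorm (Lp01 p) f1 by case: (pint_Lp p0 L1).
    have : fnorm (Lp01 p) (T f1) <= `|A1| * ((al^-1) ^+ i * (M * cst_top p ga `^ p^-1)).
      apply: le_trans NT1 _; apply: le_trans (ler_wpM2r _ (ler_norm _)) _ => //; by rewrite ler_wpM2l.
    move/(ler_wpM2r (exprn_ge0 i.+2 (ltW a0)))/le_trans; apply.
    have e : (al^-1) ^+ i * al ^+ i = 1 by rewrite exprVn mulVf // expf_neq0 // gt_eqF.
    rewrite /Gp -addn2 exprD; apply: eq_ler.
    transitivity (`|A1| * (al ^+ 2 * cst_top p ga `^ p^-1) * M * ((al^-1) ^+ i * al ^+ i)); first by ring.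
    by rewrite e mulr1.
  have b2 : s2 <= Gq * M.
    apply: le_trans (Lp_rearr q0 i.+2 b0 beq LT2) _.
    have N20 : 0 <= fnorm (Lp01 q) f2 by case: (pint_Lp q0 L2).
    have : fnorm (Lp01 q) (T f2) <= `|A2| * ((be^-1) ^+ i * (M * cst_bottom q ga' `^ q^-1)).
      apply: le_trans NT2 _; apply: le_trans (ler_wpM2r _ (ler_norm _)) _ => //; by rewrite ler_wpM2l.
    move/(ler_wpM2r (exprn_ge0 i.+2 (ltW b0)))/le_trans; apply.
    have e : (be^-1) ^+ i * be ^+ i = 1 by rewrite exprVn mulVf // expf_neq0 // gt_eqF.
    rewrite /Gq -addn2 exprD; apply: eq_ler.
    transitivity (`|A2| * (be ^+ 2 * cst_bottom q ga' `^ q^-1) * M * ((be^-1) ^+ i * be ^+ i)); first by ring.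
    by rewrite e mulr1.
  by apply: le_trans le12 _; rewrite /D mulrDl; exact: lerD.
have [Ee Ne] := Em_envelope hE rho0 sigma0 K0 dil ga_sigma ga'0 ga'_rho nc Ec.
have e0 i : 0 <= envelope ga ga' c i.
  by case: (envelope_bounds hE rho0 sigma0 K0 dil ga_sigma ga'0 ga'_rho i nc Ec).
(* Let M decrease to the envelope. *)
have le i : dyadic (T f) i <= D * envelope ga ga' c i.
  apply/ler_addgt0Pr => e epos; have D1 : 0 < D + 1 by rewrite ltr_wpDl.
  have M0 : 0 < envelope ga ga' c i + e / (D + 1) by rewrite ltr_wpDl // divr_gt0.
  apply: le_trans (key i _ _ M0) _; first by rewrite lerDl divr_ge0 ?ltW.
  rewrite mulrDr lerD2l mulrCA ler_piMr ?(ltW epos) // ler_pdivrMr // mul1r lerDl //.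
have [EDe NDe] := Em_scale hE D Ee.
have [ET NT] : Em E 0 (dyadic (T f)) /\ Nm E 0 (dyadic (T f)) <= Nm E 0 (fun i => D * envelope ga ga' c i).
  apply: Em_le => // i; rewrite !ger0_norm ?mulr_ge0 //.
  by case: (dyadic_nondec mT).
have [EfT NfT] := fnorm_le_dyadic hE mT ET; split=> //.
apply: le_trans NfT _; apply: le_trans NT _; rewrite NDe ger0_norm // -!mulrA ler_wpM2l //.
apply: le_trans Ne _; rewrite ler_wpM2l //.
by apply: env_cst_ge0.
Qed.

End Interpolation.

Theorem theorem1p4 (R : realType) (E : fspace R) (hE : symmetric_space E)
    (hBG : BG_decomposition_equivalence E \/ BG_max_equivalence E) :
  exists p q : R, [/\ 1 < p, p < q & interpolation E (Lp01 p) (Lp01 q)].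
Proof.
have [C C0 sfe] := square_function_of_BG hE hBG.
have [[[rho sigma] K] [hrho hsigma K0 dil]] := dilation_bounds hE C0 sfe.
have /andP[rho0 rho1] := hrho; have /andP[sigma0 sigma2] := hsigma.
have [ga [al [ga1 sga al2]]] : exists ga al : R, [/\ 1 < ga < al, sigma < ga & al < 2].
  pose m := Num.max 1 sigma; have m2 : m < 2 by rewrite gt_max sigma2 ltr1n.
  have m1 : 1 <= m by rewrite le_max lexx.
  have ms : sigma <= m by rewrite le_max lexx orbT.
  exists (m + 3^-1 * (2 - m)), (m + 2 * 3^-1 * (2 - m)).
  by split; [apply/andP; split|..]; lra.
have al1 : 1 < al by case/andP: ga1 => a b; exact: lt_trans b.
have [be [ga' [be1 bega be_al ga'rho]]] : exists be ga' : R,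
    [/\ 1 < be, be < ga', be < al & ga' * rho < 1].
  pose t := Num.min al rho^-1; have t1 : 1 < t by rewrite lt_min al1 invf_gt1.
  have ta : t <= al by rewrite ge_min lexx.
  have tr : t <= rho^-1 by rewrite ge_min lexx orbT.
  exists (1 + 3^-1 * (t - 1)), (1 + 2 * 3^-1 * (t - 1)); split; try lra.
  by rewrite -ltr_pdivlMr // div1r; lra.
have [p p0 alp] := exponent_of_base al1; have [q q0 beq] := exponent_of_base be1.
exists p, q; split.
- rewrite ltNge; apply/negP => p1.
  have := ler_powR (ltW al1) p1; rewrite alp powRr1 ?(ltW (lt_trans ltr01 al1)) //; lra.
- exact: exponent_anti be1 be_al p0 q0 alp beq.
exact: (interpolation_of_dilation hE rho0 sigma0 K0 dil sga ga'rho p0 q0 al1 be1 alp beq ga1 bega).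
Qed.
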